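(* For every $\alpha\in(0,1)$, the median $m_\alpha$ of $\mathbf{Z}_\alpha$ satisfies $$\max\left\{\alpha\left(\frac{1-\alpha}{\log 2}\right)^{\frac{1-\alpha}{\alpha}},\ \left(\frac{1}{\log(2)\,\Gamma(1-\alpha)}\right)^{\frac1\alpha}\right\}\;\le\;m_\alpha\;\le\;\alpha\left(\frac{1-\alpha}{m_{\mathbf{S}}}\right)^{\frac{1-\alpha}{\alpha}}.$$
   Context: For $\alpha\in(0,1)$, $\mathbf{Z}_\alpha$ is the positive random variable with $\mathbb{E}[e^{-\lambda \mathbf{Z}_\alpha}]=e^{-\lambda^\alpha}$ for all $\lambda\ge0$. $\mathbf{S}=e^{\mathbf{X}}$, where $\mathbf{X}$ is the real random variable with characteristic function $\mathbb{E}[e^{\mathrm{i}\lambda\mathbf{X}}]=e^{\mathrm{i}\lambda(\log|\lambda|-1)-\pi|\lambda|/2}$, $\lambda\in\mathbb{R}$. For a real random variable $X$ whose density does not vanish on its support, its median $m_X$ is the unique number with $\mathbb{P}[X\le m_X]=\mathbb{P}[X\ge m_X]=\frac12$; $m_\alpha=m_{\mathbf{Z}_\alpha}$ and $m_{\mathbf{S}}$ is the median of $\mathbf{S}$. *)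

(* Defs.v *)
From HB Require Import structures.
From mathcomp Require Export all_boot all_order all_algebra.
From mathcomp Require Export all_classical all_reals all_analysis.
From mathcomp Require Export complex.
Set Implicit Arguments.
Unset Strict Implicit.
Unset Printing Implicit Defensive.
Import Order.TTheory GRing.Theory Num.Theory.
Import numFieldNormedType.Exports.

Local Open Scope classical_set_scope.
Local Open Scope ring_scope.
Local Open Scope complex_scope.

Definition cexp (R : realType) (z : R[i]) : R[i] :=
  (expR (complex.Re z))%:C * (cos (complex.Im z) +i* sin (complex.Im z)).

(* The real and imaginary parts are averaged separately; [fine] loses nothing
   for a bounded measurable F, the only case used below. *)
Definition cexpectation d (T : measurableType d) (R : realType)
    (P : probability T R) (F : T -> R[i]) : R[i] :=
  fine ('E_P[fun w => complex.Re (F w)])%E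
  +i* fine ('E_P[fun w => complex.Im (F w)])%E.

Definition char_fun d (T : measurableType d) (R : realType)
    (P : probability T R) (X : T -> R) (l : R) : R[i] :=
  cexpectation P (fun w => cexp ('i * (l * X w)%:C)).

(* Euler's integral, for s > 0. *)
Definition Gamma (R : realType) (s : R) : R :=
  \int[lebesgue_measure]_(t in `]0, +oo[) (t `^ (s - 1) * expR (- t)).

(* X follows the law of Z_alpha. *)
Definition positive_stable d (T : measurableType d) (R : realType)
    (P : probability T R) (alpha : R) (X : {RV P >-> R}) : Prop :=
  {ae P, forall w, 0 < X w} /\
  forall l : R, 0 <= l ->
    ('E_P[fun w => expR (- (l * X w))] = (expR (- (l `^ alpha)))%:E)%E.

(* X follows the law of log S.  At l = 0 the library convention ln 0 = 0 makes
   the right-hand side equal to 1, as it should be. *)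
Definition log_S_law d (T : measurableType d) (R : realType)
    (P : probability T R) (X : {RV P >-> R}) : Prop :=
  forall l : R,
    char_fun P X l =
    cexp ('i * (l * (ln `|l| - 1))%:C - (pi * `|l| / 2)%:C).

Definition is_median d (T : measurableType d) (R : realType)
    (P : probability T R) (X : T -> R) (m : R) : Prop :=
  unique (fun x : R => P [set w | X w <= x] = (2^-1)%:E /\
                       P [set w | x <= X w] = (2^-1)%:E) m.

(* Main.v *)
(** The variable [S_al = (1 - al) (Z / al)^(- al / (1 - al))] is a decreasing
    function of [Z = Z_al], so the upper bound follows from the stochastic
    domination of [S] by [S_al].  From [E Z^(-q) = Gamma(1 + q/al) / Gamma(1 + q)]
    and Binet's formula, [E S_al^s = s^s e^(-s) e^(M - L(s / (1 - al)))], where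
    [M = - ln(al) / 2] and [L] is the Laplace transform of a positive measure of
    mass [M] on the half-line.  Multiplying [S_al] by an independent factor
    [e^(-Y / (1 - al)) <= 1], with [Y] compound Poisson for that measure, thus gives
    a variable with moments [n^n e^(-n) <= n!].  These determine the law, and they
    are the moments of [S], by a contour shift in the characteristic function of
    [log S].

    The first lower bound is the Chernoff bound.  For the second, strict
    stability gives [P(Z <= x) <= P(Z <= n^(1/al) x)^n], hence a tail bound
    [P(Z > x) <= (1 + o(1)) ln 2 (m / x)^al]; inserting it into
    [1 - e^(- l^al) = int e^(-v) P(l Z > v) dv] and letting [l] tend to [0] yields
    [1 <= ln 2 m^al Gamma(1 - al)]. *)

Require Import Defs.
From HB Require Import structures.
From mathcomp Require Import measurable_realfun ring lra.
Import Order.TTheory GRing.Theory Num.Theory.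
Import numFieldNormedType.Exports.

Set Implicit Arguments.
Unset Strict Implicit.
Unset Printing Implicit Defensive.

Local Open Scope classical_set_scope.
Local Open Scope ring_scope.

(** * Laplace transforms and moments determine tails *)

(** The form of the moments of [S] comes from [z ln z - z], holomorphic on [Re z > 0]: it equals
    [s ln s - s] at [z = s] and tends to [i l (ln l - 1) - pi l / 2] as [z] tends to [i l], which is
    the exponent of the characteristic function of [X]. Integrability of [e^(s X)] is not known
    beforehand, so the moment is damped by [e^(- (eta X)^2 / 4)]; a Gaussian integral expresses the
    damped moment through the characteristic function, the contour is shifted for that expression,
    and monotone convergence removes [eta]. The crux of the upper bound is the positivity of the
    measure behind [L]. Its density is [(phi(x / al) - phi(x)) / x] with [phi] the kernel of Binet's
    formula, and [phi] is nondecreasing because [x <= 2 sinh(x / 2)]. Its mass is the limit of [L]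
    at 0, where both Gamma values tend to 1. Moments bounded by [n!] give exponential moments of
    every order below 1. This suffices to reach the Laplace transform at all integers in steps of
    1/2, and these values determine the tails. *)

Lemma integrable_le_bound d (T : measurableType d) (R : realType)
    (mu : {finite_measure set T -> \bar R}) (f : T -> R) (M : R) :
  measurable_fun setT f -> (forall x, `|f x| <= M) ->
  mu.-integrable setT (EFin \o f).
Proof.
move=> mf fM; apply: (@le_integrable _ _ _ _ _ _ _ (cst M%:E)) => //.
- exact/measurable_EFinP.
- by move=> x _ /=; rewrite lee_fin (le_trans (fM x))// ler_norm.
- exact: finite_measure_integrable_cst.
Qed.

Lemma cvg_le_harmonic (R : realType) (u : R^nat) (l C : R) :
  (forall n, `|u n.+1 - l| <= C * n.+1%:R^-1) -> u @ \oo --> l.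
Proof.
move=> ul; rewrite -cvg_shiftS; apply/cvgrPdistC_le => /= e e0.
have : (fun n => C * n.+1%:R^-1) @ \oo --> C * 0.
  by apply: cvgM; [exact: cvg_cst|exact: cvg_harmonic].
rewrite mulr0 => /cvgr0_norm_le /(_ _ e0); apply: filterS => n.
by apply: le_trans; rewrite (le_trans (ul n)) ?ler_norm.
Qed.

Section laplace_determines.
Variable R : realType.

Lemma bernoulli_1B (p : R) k : 0 <= p <= 1 -> 1 - k%:R * p <= (1 - p) ^+ k.
Proof.
move=> /andP[p0 p1]; elim: k => [|k ih]; first by rewrite mul0r subr0.
rewrite exprS; apply: (@le_trans _ _ ((1 - p) * (1 - k%:R * p))); last first.
  by apply: ler_wpM2l; rewrite ?subr_ge0.
rewrite -subr_ge0 -natr1.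
rewrite (_ : _ - _ = k%:R * (p * p)); last by ring.
by rewrite mulr_ge0 ?ler0n ?mulr_ge0.
Qed.

(** The power behaves like [exp(- n e^(n (x - y)))]. The extra factor [n] in the exponent forces the
    limit 0 at [x = y] as well, so that the limit is the strict indicator at every point and atoms
    cause no trouble. *)
Lemma pow_1Bexp_cvg (y x : R) : 0 <= y ->
  (fun n => (1 - expR (- (n%:R * y))) ^+ Num.truncn (n%:R * expR (n%:R * x)))
    @ \oo --> ((x < y)%R%:R : R).
Proof.
move=> y0.
have q01 n : 0 <= 1 - expR (- (n%:R * y)) <= 1.
  by rewrite subr_ge0 expR_le1 oppr_le0 mulr_ge0//= gerBl expR_ge0.
have p01 n : 0 <= expR (- (n%:R * y)) <= 1.
  by rewrite expR_ge0 expR_le1 oppr_le0 mulr_ge0.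
have n0 n : 0 <= n.+1%:R * expR (n.+1%:R * x) by rewrite mulr_ge0 ?expR_ge0.
have [xy|yx] := ltrP x y.
(* Bernoulli's inequality bounds the error by [n e^(- n (y - x))], and [t^2 / 2 <= e^t] at
   [t = n (y - x)] makes this [O(1/n)] with the stated constant. *)
- apply: (@cvg_le_harmonic _ _ _ (2 / (y - x) ^+ 2)) => n.
  have d0 : 0 < y - x by rewrite subr_gt0.
  rewrite ler0_norm; last first.
    by have /andP[? ?] := q01 n.+1; rewrite subr_le0 exprn_ile1.
  rewrite opprB lerBlDr addrC -lerBlDr.
  apply: le_trans (bernoulli_1B _ (p01 n.+1)).
  rewrite lerB// (@le_trans _ _ (n.+1%:R * expR (- (n.+1%:R * (y - x)))))//.
    rewrite mulrBr opprB expRD mulrA ler_wpM2r ?expR_ge0//.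
    by rewrite truncn_le.
  rewrite expRN ler_pdivrMr ?expR_gt0//.
  set m : R := n.+1%:R; have m0 : 0 < m by rewrite ltr0n.
  have h : (m * (y - x)) ^+ 2 / 2 <= expR (m * (y - x)).
    have := @expR_ge1Dxn R (m * (y - x)) 1 (mulr_ge0 (ltW m0) (ltW d0)).
    by apply: le_trans; rewrite lerDr.
  have c0 : 0 <= 2 / (y - x) ^+ 2 * m^-1.
    by rewrite !mulr_ge0 ?invr_ge0 ?sqr_ge0 ?ltW.
  apply: le_trans (ler_wpM2l c0 h).
  by rewrite le_eqVlt; apply/orP; left; apply/eqP; field; rewrite !gt_eqF.
- apply: (@cvg_le_harmonic _ _ _ 1) => n; rewrite subr0 mul1r.
  rewrite ger0_norm ?exprn_ge0//; last by case/andP: (q01 n.+1).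
  set k := Num.truncn _.
  apply: (@le_trans _ _ (expR (- expR (- (n.+1%:R * y))) ^+ k)).
    rewrite lerXn2r ?nnegrE ?expR_ge0//; first by case/andP: (q01 n.+1).
    exact: expR_ge1Dx.
  rewrite -expRM_natl mulrN [expR (- (k%:R * _))]expRN.
  rewrite lef_pV2 ?posrE ?ltr0n ?expR_gt0//.
  apply: le_trans (expR_ge1Dx _).
  have : n.+1%:R * expR (n.+1%:R * x) < k.+1%:R by exact: truncnS_gt.
  rewrite -lerBlDl -[k.+1%:R]natr1 -ltrBlDr => /ltW h.
  apply: (@le_trans _ _ ((n.+1%:R * expR (n.+1%:R * x) - 1) * expR (- (n.+1%:R * y)))); last first.
    by rewrite ler_wpM2r ?expR_ge0.
  rewrite mulrBl mul1r lerB//; last by case/andP: (p01 n.+1).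
  rewrite -mulrA -expRD -mulrBr.
  by rewrite ler_peMr// -expR0 ler_expR mulr_ge0// subr_ge0.
Qed.

Section two_measures.
Context d (T : measurableType d) d' (T' : measurableType d').
Variables (mu : {finite_measure set T -> \bar R}).
Variables (nu : {finite_measure set T' -> \bar R}).
Variables (f : T -> R) (g : T' -> R).
Hypotheses (mf : measurable_fun setT f) (mg : measurable_fun setT g).
Hypotheses (f0 : forall w, 0 <= f w) (g0 : forall w, 0 <= g w).
Hypothesis fg : forall n : nat, (\int[mu]_w (expR (- (n%:R * f w)))%:E =
                                 \int[nu]_w (expR (- (n%:R * g w)))%:E)%E.

Let poly n k m (y : R) := (1 - expR (- (n%:R * y))) ^+ k * expR (- (m%:R * y)).

Let mpoly n k m : measurable_fun setT (poly n k m).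
Proof.
have me l : measurable_fun setT (fun y : R => expR (- (l * y))).
  by apply: measurableT_comp => //; apply: measurableT_comp.
by apply: measurable_funM => //; apply: measurable_funX; exact: measurable_funB.
Qed.

Let poly_le n k m (y : R) : 0 <= y -> `|poly n k m y| <= 1.
Proof.
move=> y0; have e01 l : 0 <= expR (- (l%:R * y)) <= 1.
  by rewrite expR_ge0 expR_le1 oppr_le0 mulr_ge0.
have /andP[em0 em1] := e01 m; have /andP[en0 en1] := e01 n.
have a0 : 0 <= 1 - expR (- (n%:R * y)) by rewrite subr_ge0.
have a1 : 1 - expR (- (n%:R * y)) <= 1 by rewrite gerBl.
by rewrite /poly normrM normrX (ger0_norm a0) (ger0_norm em0) mulr_ile1
  ?exprn_ge0 ?exprn_ile1.
Qed.

(** The factor [e^(- m y)] is carried along for the induction: expanding one factor [1 - e^(- n y)]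
    gives two terms, with [m] and with [n + m]. *)
Let int_poly n k m : (\int[mu]_w (poly n k m (f w))%:E =
                      \int[nu]_w (poly n k m (g w))%:E)%E.
Proof.
elim: k m => [|k ih] m.
  under eq_integral do rewrite /poly expr0 mul1r.
  by rewrite fg; apply: eq_integral => w _; rewrite /poly expr0 mul1r.
have E y : poly n k.+1 m y = poly n k m y - poly n k (n + m) y.
  by rewrite /poly natrD mulrDl opprD expRD exprS; ring.
under eq_integral do rewrite E EFinB.
under [RHS]eq_integral do rewrite E EFinB.
rewrite !integralB_EFin//; first by rewrite !ih.
- by apply: (@integrable_le_bound _ _ _ nu _ 1);
    [exact: measurableT_comp|move=> w; exact: poly_le].
- by apply: (@integrable_le_bound _ _ _ nu _ 1);
    [exact: measurableT_comp|move=> w; exact: poly_le].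
- by apply: (@integrable_le_bound _ _ _ mu _ 1);
    [exact: measurableT_comp|move=> w; exact: poly_le].
- by apply: (@integrable_le_bound _ _ _ mu _ 1);
    [exact: measurableT_comp|move=> w; exact: poly_le].
Qed.

Let tail_cvg d0 (T0 : measurableType d0) (m0 : {finite_measure set T0 -> \bar R})
    (h : T0 -> R) (x : R) : measurable_fun setT h -> (forall w, 0 <= h w) ->
  (fun n => \int[m0]_w (poly n (Num.truncn (n%:R * expR (n%:R * x))) 0 (h w))%:E)%E
    @ \oo --> m0 [set w | x < h w].
Proof.
move=> mh h0.
have mA : measurable [set w | x < h w].
  rewrite (_ : [set _ | _] = h @^-1` `]x, +oo[).
    by rewrite -[X in measurable X]setTI; exact: mh.
  by apply/seteqP; split => w /=; rewrite in_itv/= andbT.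
rewrite -(setIT [set w | _]) -integral_indic//.
have [] := @dominated_convergence _ _ _ m0 setT measurableT
  (fun n w => (poly n (Num.truncn (n%:R * expR (n%:R * x))) 0 (h w))%:E)
  (fun w => (\1_[set w | x < h w] w)%:E) (cst 1%:E) => //.
- by move=> n; apply/measurable_EFinP; exact: measurableT_comp.
- exact/measurable_EFinP.
- apply: aeW => w _; apply: cvg_EFin; first exact: nearW.
  rewrite indicE (_ : (w \in _) = (x < h w)); last first.
    by apply/idP/idP; rewrite inE.
  rewrite [X in X @ _ --> _](_ : _ = (fun n => (1 - expR (- (n%:R * h w))) ^+
      Num.truncn (n%:R * expR (n%:R * x)))); last first.
    by apply/funext => n; rewrite /= /poly mul0r oppr0 expR0 mulr1.
  exact: pow_1Bexp_cvg.
- exact: finite_measure_integrable_cst.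
- by apply: aeW => w n _; rewrite abse_EFin lee_fin poly_le.
Qed.

(* [1 - e^(-n y)] to the power [n e^(n x)] is a polynomial in [e^(-y)] that
   tends to the indicator of [x < y]. *)
Lemma laplace_determines_tail x : mu [set w | x < f w] = nu [set w | x < g w].
Proof.
rewrite -(cvg_lim (@ereal_hausdorff R) (@tail_cvg _ _ mu f x mf f0)).
rewrite -(cvg_lim (@ereal_hausdorff R) (@tail_cvg _ _ nu g x mg g0)).
by congr (lim _); under eq_fun do rewrite int_poly.
Qed.

End two_measures.
End laplace_determines.

Section moments_determine.
Variable R : realType.

Lemma expR_psum_cvg (y : R) :
  (fun K => \sum_(k < K) y ^+ k / k`!%:R) @ \oo --> expR y.
Proof.
have /cvg_ex[l hl] := @is_cvg_series_exp_coeff R y.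
have -> : expR y = l by exact/cvg_lim.
rewrite (_ : (fun _ => _) = series (exp_coeff y))//.
apply/funext => K; rewrite /series/= big_mkord; apply: eq_bigr => k _.
by rewrite exp_coeffE mulrC.
Qed.

Lemma expR_psum_ndecr (y : R) : 0 <= y ->
  nondecreasing_seq (fun K => \sum_(k < K) y ^+ k / k`!%:R).
Proof.
move=> y0; apply/nondecreasing_seqP => n; rewrite big_ord_recr/= lerDl.
by rewrite mulr_ge0 ?exprn_ge0// invr_ge0.
Qed.

Lemma expR_psum_le (y : R) K : 0 <= y -> \sum_(k < K) y ^+ k / k`!%:R <= expR y.
Proof.
move=> y0; rewrite -(cvg_lim (@Rhausdorff R) (@expR_psum_cvg y)).
apply: (nondecreasing_cvgn_le (expR_psum_ndecr y0)).
by apply/cvg_ex; exists (expR y); exact: expR_psum_cvg.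
Qed.

Lemma exprn_le_expR (y : R) n : 0 <= y -> y ^+ n <= n`!%:R * expR y.
Proof.
move=> y0; rewrite -ler_pdivrMl ?ltr0n ?fact_gt0// mulrC.
apply: le_trans (expR_psum_le n.+1 y0).
by rewrite big_ord_recr/= lerDr sumr_ge0// => k _; rewrite mulr_ge0 ?exprn_ge0// invr_ge0.
Qed.

Section exp_moment.
Context d (T : measurableType d).
Variables (mu : {measure set T -> \bar R}).
Variables (f : T -> R) (c : nat -> R).
Hypothesis mf : measurable_fun setT f.
Hypothesis f0 : forall w, 0 <= f w.
Hypothesis fc : forall n : nat, (\int[mu]_w (f w ^+ n)%:E = (c n)%:E)%E.
Hypothesis c_le : forall n, c n <= n`!%:R.

(** Since [c n <= n!], the exponential series integrates to at most the geometric series of [q]. *)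
Lemma exp_moment_lt_pinfty (q : R) : 0 <= q -> q < 1 ->
  (\int[mu]_w (expR (q * f w))%:E < +oo)%E.
Proof.
move=> q0 q1.
have mfk k : measurable_fun setT (fun w => (q * f w) ^+ k / k`!%:R).
  by apply: measurable_funM => //; apply: measurable_funX; exact: measurable_funM.
have t0 k w : 0 <= (q * f w) ^+ k / k`!%:R.
  by rewrite mulr_ge0 ?invr_ge0// exprn_ge0// mulr_ge0.
pose S K w := (\sum_(k < K) (q * f w) ^+ k / k`!%:R)%:E.
have SE : (\int[mu]_w (expR (q * f w))%:E = limn (fun K => \int[mu]_w S K w))%E.
  rewrite -monotone_convergence//.
  - apply: eq_integral => w _; apply/esym/cvg_lim => //.
    by apply: cvg_EFin; [exact: nearW|exact: expR_psum_cvg].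
  - move=> K; apply/measurable_EFinP.
    by apply: measurable_sum.
  - by move=> K w _; rewrite lee_fin sumr_ge0.
  - move=> w _; apply/nondecreasing_seqP => K.
    by rewrite lee_fin big_ord_recr/= lerDl.
have SK K : (\int[mu]_w S K w <= ((1 - q)^-1)%:E)%E.
  rewrite /S; under eq_integral do rewrite -sumEFin.
  rewrite ge0_integral_sum//; last 2 first.
  - by move=> k; exact/measurable_EFinP.
  - by move=> k w _; rewrite lee_fin.
  apply: (@le_trans _ _ (\sum_(k < K) (q ^+ k)%:E)%E).
    apply: lee_sum => k _.
    rewrite (eq_integral (fun w => ((q ^+ k / k`!%:R)%:E * (f w ^+ k)%:E)%E)); last first.
      by move=> w _; rewrite -EFinM exprMn mulrAC.
    rewrite ge0_integralZl//.
    - rewrite fc -EFinM lee_fin -mulrA ler_piMr ?exprn_ge0//.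
      by rewrite ler_pdivrMl ?ltr0n ?fact_gt0// mulr1.
    - by apply/measurable_EFinP; exact: measurable_funX.
    - by move=> w _; rewrite lee_fin exprn_ge0.
    - by rewrite lee_fin mulr_ge0 ?exprn_ge0// invr_ge0.
  rewrite sumEFin lee_fin -[leRHS]mul1r ler_pdivlMr ?subr_gt0//.
  by rewrite -[1 - q]opprB mulrN mulrC -subrX1 opprB gerBl exprn_ge0.
rewrite SE (@le_lt_trans _ _ ((1 - q)^-1)%:E) ?ltry//.
apply: lime_le; last exact: nearW.
apply: ereal_nondecreasing_is_cvgn => m n mn; apply: ge0_le_integral => //.
- by move=> w _; rewrite lee_fin sumr_ge0.
- by apply/measurable_EFinP; exact: measurable_sum.
- by apply/measurable_EFinP; exact: measurable_sum.
- by move=> w _; rewrite lee_fin expR_psum_ndecr// mulr_ge0.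
Qed.

(* The tilt by [exp (- j f / 2)] is built up in [j] steps, since the series of
   [exp (- f / 2)] integrates termwise but that of [exp (- j f / 2)] need not. *)
Lemma tilted_moment_cvg n j :
  (fun K => \int[mu]_w (\sum_(k < K) ((- 2^-1) ^+ k / k`!%:R) *
     (f w ^+ (n + k) * expR (- (j%:R / 2 * f w))))%:E)%E @ \oo -->
  (\int[mu]_w (f w ^+ n * expR (- (j.+1%:R / 2 * f w)))%:E)%E.
Proof.
have mfe m l : measurable_fun setT (fun w => f w ^+ m * expR (l * f w)).
  apply: measurable_funM; first exact: measurable_funX.
  by apply: measurableT_comp => //; exact: measurable_funM.
have mfe' m l : measurable_fun setT (fun w => f w ^+ m * expR (- (l * f w))).
  by under eq_fun do rewrite -mulNr; exact: mfe.
(* The partial sums are at most [f^n e^(f / 2)] in absolute value, and [f^n <= n! 4^n e^(f / 4)].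
   The resulting rate [3 / 4] stays below 1, where exponential moments are finite. *)
have [] := @dominated_convergence _ _ _ mu setT measurableT
  (fun K w => (\sum_(k < K) ((- 2^-1) ^+ k / k`!%:R) *
     (f w ^+ (n + k) * expR (- (j%:R / 2 * f w))))%:E)
  (fun w => (f w ^+ n * expR (- (j.+1%:R / 2 * f w)))%:E)
  (fun w => ((n`!%:R * 4 ^+ n) * expR (3 / 4 * f w))%:E).
- move=> K; apply/measurable_EFinP; apply: measurable_sum => k.
  by apply: measurable_funM.
- exact/measurable_EFinP.
- apply: aeW => w _; apply: cvg_EFin; first exact: nearW.
  rewrite [X in X @ _](_ : _ = fun K => f w ^+ n * expR (- (j%:R / 2 * f w)) *
      \sum_(k < K) (- (f w / 2)) ^+ k / k`!%:R); last first.
    apply/funext => K /=; rewrite mulr_sumr; apply: eq_bigr => k _.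
    by rewrite (_ : - (f w / 2) = f w * - 2^-1) ?exprD ?exprMn; ring.
  rewrite (_ : _ * expR (- (j.+1%:R / 2 * f w)) =
    f w ^+ n * expR (- (j%:R / 2 * f w)) * expR (- (f w / 2))); last first.
    rewrite (_ : j.+1%:R / 2 * f w = j%:R / 2 * f w + f w / 2).
      by rewrite opprD expRD mulrA.
    by rewrite -natr1; ring.
  by apply: cvgM; [exact: cvg_cst|exact: expR_psum_cvg].
- apply: (@eq_integrable _ _ _ _ _ _
    (fun w => ((n`!%:R * 4 ^+ n)%:E * (expR (3 / 4 * f w))%:E)%E)) => //.
  apply: integrableZl => //; apply/integrableP; split.
    apply/measurable_EFinP; apply: measurableT_comp => //.
    exact: measurable_funM.
  under eq_integral do rewrite gee0_abs ?lee_fin ?expR_ge0//.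
  by apply: exp_moment_lt_pinfty; lra.
- apply: aeW => w K _; rewrite abse_EFin lee_fin.
  apply: le_trans (ler_norm_sum _ _ _) _.
  apply: (@le_trans _ _ (f w ^+ n * \sum_(k < K) (f w / 2) ^+ k / k`!%:R)).
    rewrite mulr_sumr; apply: ler_sum => k _.
    rewrite !normrM normfV normrX normrN !ger0_norm ?exprn_ge0 ?expR_ge0 ?invr_ge0//.
    rewrite (_ : f w ^+ n * _ = 2^-1 ^+ k / k`!%:R * (f w ^+ (n + k) * 1)); last first.
      by rewrite exprMn exprD; ring.
    apply: ler_wpM2l; first by rewrite divr_ge0 ?exprn_ge0.
    apply: ler_wpM2l; first by rewrite exprn_ge0.
    by rewrite expR_le1 oppr_le0 !mulr_ge0 ?invr_ge0.
  have f20 : 0 <= f w / 2 by rewrite divr_ge0.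
  apply: (@le_trans _ _ (f w ^+ n * expR (f w / 2))).
    by rewrite ler_wpM2l ?exprn_ge0// expR_psum_le.
  rewrite (_ : 3 / 4 * f w = f w / 4 + f w / 2); last by field.
  rewrite expRD mulrA ler_wpM2r ?expR_ge0//.
  have := @exprn_le_expR (f w / 4) n (divr_ge0 (f0 w) (ler0n _ _)).
  rewrite exprMn exprVn ler_pdivrMr ?exprn_gt0//.
  by move=> /le_trans; apply; rewrite -!mulrA [expR _ * _]mulrC.
- by [].
Qed.

End exp_moment.

Section two_measures.
Context d (T : measurableType d) d' (T' : measurableType d').
Variables (mu : {finite_measure set T -> \bar R}).
Variables (nu : {finite_measure set T' -> \bar R}).
Variables (f : T -> R) (g : T' -> R) (c : nat -> R).
Hypotheses (mf : measurable_fun setT f) (mg : measurable_fun setT g).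
Hypotheses (f0 : forall w, 0 <= f w) (g0 : forall w, 0 <= g w).
Hypothesis fc : forall n : nat, (\int[mu]_w (f w ^+ n)%:E = (c n)%:E)%E.
Hypothesis gc : forall n : nat, (\int[nu]_w (g w ^+ n)%:E = (c n)%:E)%E.
Hypothesis c_le : forall n, c n <= n`!%:R.

(** All moments tilted by [j / 2] determine those tilted by [(j + 1) / 2], as limits of the same
    linear combinations under both measures. *)
Let tilted j n : (\int[mu]_w (f w ^+ n * expR (- (j%:R / 2 * f w)))%:E =
                  \int[nu]_w (g w ^+ n * expR (- (j%:R / 2 * g w)))%:E)%E.
Proof.
elim: j n => [|j ih] n.
  under eq_integral do rewrite !mul0r oppr0 expR0 mulr1.
  under [RHS]eq_integral do rewrite !mul0r oppr0 expR0 mulr1.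
  by rewrite fc gc.
have ifj : forall d0 (T0 : measurableType d0) (m0 : {finite_measure set T0 -> \bar R})
    (h : T0 -> R) k, measurable_fun setT h -> (forall w, 0 <= h w) ->
    (forall n : nat, (\int[m0]_w (h w ^+ n)%:E = (c n)%:E)%E) ->
  m0.-integrable setT (fun w => (h w ^+ k * expR (- (j%:R / 2 * h w)))%:E).
  move=> d0 T0 m0 h k mh h0 hc.
  have mX : measurable_fun setT (fun w => h w ^+ k) by exact: measurable_funX.
  apply: (@le_integrable _ _ _ _ _ _ _ (fun w => (h w ^+ k)%:E)) => //.
  - apply/measurable_EFinP; apply: measurable_funM => //.
    apply: measurableT_comp => //; apply: measurableT_comp => //.
    exact: measurable_funM.
  - move=> w _; rewrite !abse_EFin lee_fin normrM ger0_norm ?exprn_ge0//.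
    rewrite ler_piMr ?exprn_ge0// ger0_norm ?expR_ge0// expR_le1 oppr_le0.
    by rewrite !mulr_ge0.
  - apply/integrableP; split; first exact/measurable_EFinP.
    under eq_integral do rewrite gee0_abs ?lee_fin ?exprn_ge0//.
    by rewrite hc ltry.
have E K : forall d0 (T0 : measurableType d0) (m0 : {finite_measure set T0 -> \bar R})
    (h : T0 -> R), measurable_fun setT h -> (forall w, 0 <= h w) ->
    (forall n : nat, (\int[m0]_w (h w ^+ n)%:E = (c n)%:E)%E) ->
  (\int[m0]_w (\sum_(k < K) ((- 2^-1) ^+ k / k`!%:R) *
     (h w ^+ (n + k) * expR (- (j%:R / 2 * h w))))%:E =
   \sum_(k < K) ((- 2^-1) ^+ k / k`!%:R)%:E *
     \int[m0]_w (h w ^+ (n + k) * expR (- (j%:R / 2 * h w)))%:E)%E.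
  move=> d0 T0 m0 h mh h0 hc.
  under eq_integral do rewrite -sumEFin.
  rewrite integral_sum//; last first.
    by move=> k; under eq_fun do rewrite EFinM; apply: integrableZl => //; exact: ifj.
  apply: eq_bigr => k _; under eq_integral do rewrite EFinM.
  by rewrite integralZl//; exact: ifj.
rewrite -(cvg_lim (@ereal_hausdorff R) (tilted_moment_cvg (n:=n) (j:=j) mf f0 fc c_le)).
rewrite -(cvg_lim (@ereal_hausdorff R) (tilted_moment_cvg (n:=n) (j:=j) mg g0 gc c_le)).
have limE (F G : nat -> \bar R) : F =1 G -> limn F = limn G by move=> /funext ->.
apply: limE => K.
by rewrite (E _ _ _ mu f)// (E _ _ _ nu g)//; apply: eq_bigr => k _; rewrite ih.
Qed.

Lemma moments_determine_tail x : mu [set w | x < f w] = nu [set w | x < g w].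
Proof.
apply: laplace_determines_tail => // n.
(* A tilt by [2 n] half-steps is the Laplace transform at [n]. *)
have := tilted (n * 2) 0.
under eq_integral do rewrite expr0 mul1r natrM mulfK//.
by under [X in _ = X -> _]eq_integral do rewrite expr0 mul1r natrM mulfK//.
Qed.

End two_measures.
End moments_determine.

(** * Shifting the contour in the characteristic function of log S *)

Section derive_rules.
Context {R : realType}.
Implicit Types (f g : R -> R) (x df dg k : R).

(** Lets a derivative be assembled by the rules below and its value be simplified afterwards with
    [ring] or [field]. *)
Lemma drv_eq f x df df' : is_derive x 1 f df' -> df' = df -> is_derive x 1 f df.
Proof. by move=> + <-. Qed.

Lemma drv_cst k x : is_derive x 1 (fun _ : R => k) 0.
Proof. exact: is_derive_cst. Qed.

Lemma drv_id x : is_derive x 1 (fun y : R => y) 1.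
Proof. exact: is_derive_id. Qed.

Lemma drvD f g x df dg : is_derive x 1 f df -> is_derive x 1 g dg ->
  is_derive x 1 (fun y => f y + g y) (df + dg).
Proof. by move=> *; exact: is_deriveD. Qed.

Lemma drvN f x df : is_derive x 1 f df -> is_derive x 1 (fun y => - f y) (- df).
Proof. by move=> *; exact: is_deriveN. Qed.

Lemma drvM f g x df dg : is_derive x 1 f df -> is_derive x 1 g dg ->
  is_derive x 1 (fun y => f y * g y) (f x * dg + g x * df).
Proof. by move=> *; exact: is_deriveM. Qed.

Lemma drvX f x df n : is_derive x 1 f df ->
  is_derive x 1 (fun y => f y ^+ n) (n%:R * f x ^+ n.-1 * df).
Proof. by move=> hf; have := is_deriveX n hf; rewrite exprfctE. Qed.

Lemma drv_exp f x df : is_derive x 1 f df ->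
  is_derive x 1 (fun y => expR (f y)) (expR (f x) * df).
Proof. by move=> hf; exact: (is_derive1_comp (is_derive_expR (f x)) hf). Qed.

Lemma drv_cos f x df : is_derive x 1 f df ->
  is_derive x 1 (fun y => cos (f y)) (- sin (f x) * df).
Proof. by move=> hf; exact: (is_derive1_comp (is_derive_cos (f x)) hf). Qed.

Lemma drv_sin f x df : is_derive x 1 f df ->
  is_derive x 1 (fun y => sin (f y)) (cos (f x) * df).
Proof. by move=> hf; exact: (is_derive1_comp (is_derive_sin (f x)) hf). Qed.

Lemma drv_ln f x df : 0 < f x -> is_derive x 1 f df ->
  is_derive x 1 (fun y => ln (f y)) ((f x)^-1 * df).
Proof. by move=> f0 hf; exact: (is_derive1_comp (is_derive1_ln f0) hf). Qed.

Lemma drv_atan f x df : is_derive x 1 f df ->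
  is_derive x 1 (fun y => atan (f y)) ((1 + f x ^+ 2)^-1 * df).
Proof. by move=> hf; exact: (is_derive1_comp (is_derive1_atan (f x)) hf). Qed.

Lemma drvV f x df : f x != 0 -> is_derive x 1 f df ->
  is_derive x 1 (fun y => (f y)^-1) (- (f x) ^- 2 * df).
Proof. by move=> f0 hf; exact: is_deriveV. Qed.

Lemma drv_continuous f x df : is_derive x 1 f df -> {for x, continuous f}.
Proof. by move=> hf; apply/differentiable_continuous/derivable1_diffP. Qed.

End derive_rules.

Section exponential_tail.
Context {R : realType}.
Local Notation leb := (@lebesgue_measure R).

Lemma integral_expRN_tail (a : R) :
  (\int[leb]_(v in `[a, +oo[) (expR (- v))%:E = (expR (- a))%:E)%E.
Proof.
have dE (x : R) : is_derive x 1 (fun v => - expR (- v)) (expR (- x)).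
  apply: (drv_eq (drvN (drv_exp (drvN (drv_id x))))).
  by rewrite mulrN1 opprK.
rewrite (@ge0_continuous_FTC2y _ _ (fun v => - expR (- v)) a 0).
- by rewrite sub0e EFinN oppeK.
- by move=> x _; exact: expR_ge0.
- apply: continuous_subspaceT => x.
  by have := drv_continuous (drv_exp (drvN (drv_id x))).
- by rewrite -oppr0; apply: cvgN; exact: cvgr_expR.
- by move=> x _; have [] := dE x.
- by apply: cvg_at_right_filter; exact: drv_continuous (dE a).
- by move=> x _; rewrite derive1E; have [] := dE x.
Qed.

Lemma integrable_expRN_tail (a K : R) :
  leb.-integrable `[a, +oo[ (fun v => (K * expR (- v))%:E).
Proof.
apply: (integrableZl (mu := leb) _ K (f := fun v => (expR (- v))%:E)) => //.
apply/integrableP; split.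
  by apply/measurable_EFinP; apply: measurableT_comp.
under eq_integral do rewrite gee0_abs ?lee_fin ?expR_ge0//.
by rewrite integral_expRN_tail ltry.
Qed.

End exponential_tail.

Section contour_shift.
Context {R : realType}.
Local Notation leb := (@lebesgue_measure R).

(* [A + i B] is the exponent of a function holomorphic in [c + i eta v]; its
   derivative is [p + i q], and the four [is_derive] hypotheses are the
   Cauchy-Riemann equations. *)
Variables (eta a b K : R) (A B p q : R -> R -> R).
Hypothesis eta_gt0 : 0 < eta.
Hypothesis dcA : forall c v : R, c \in `]a, b[ -> is_derive c 1 (A ^~ v) (p c v).
Hypothesis dcB : forall c v : R, c \in `]a, b[ -> is_derive c 1 (B ^~ v) (q c v).
Hypothesis dvA : forall c v : R, c \in `]a, b[ -> is_derive v 1 (A c) (- eta * q c v).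
Hypothesis dvB : forall c v : R, c \in `]a, b[ -> is_derive v 1 (B c) (eta * p c v).
Hypothesis cp : forall c : R, c \in `]a, b[ -> continuous (p c).
Hypothesis cq : forall c : R, c \in `]a, b[ -> continuous (q c).
Hypothesis B0 : forall c : R, c \in `]a, b[ -> B c 0 = 0.
Hypothesis bound : forall c v : R, c \in `]a, b[ -> 0 <= v ->
  expR (A c v) * (1 + `|p c v| + `|q c v|) <= K * expR (- v).

(** [f] is the real part of the holomorphic function and [g] its imaginary part divided by [eta]. By
    the Cauchy-Riemann equations [h] is both the derivative of [f] in [c] and that of [g] in [v]. *)
Let f c v := expR (A c v) * cos (B c v).
Let g c v := expR (A c v) * sin (B c v) / eta.
Let h c v := expR (A c v) * (p c v * cos (B c v) - q c v * sin (B c v)).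

Let dcf (c v : R) : c \in `]a, b[ -> is_derive c 1 (f ^~ v) (h c v).
Proof.
move=> cab; apply: (drv_eq (drvM (drv_exp (dcA v cab)) (drv_cos (dcB v cab)))).
by rewrite /h; ring.
Qed.

Let dvg (c v : R) : c \in `]a, b[ -> is_derive v 1 (g c) (h c v).
Proof.
move=> cab; apply: (drv_eq (drvM (drvM (drv_exp (dvA v cab)) (drv_sin (dvB v cab))) (drv_cst _ _))).
by rewrite /h; field; rewrite gt_eqF.
Qed.

Let cf (c : R) : c \in `]a, b[ -> continuous (f c).
Proof.
move=> cab v.
exact: drv_continuous (drvM (drv_exp (dvA v cab)) (drv_cos (dvB v cab))).
Qed.

Let ch (c : R) : c \in `]a, b[ -> continuous (h c).
Proof.
move=> cab v.
have cB : {for v, continuous (B c)} := drv_continuous (dvB v cab).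
have cs : {for v, continuous (fun v => sin (B c v))}.
  exact: drv_continuous (drv_sin (dvB v cab)).
have cc : {for v, continuous (fun v => cos (B c v))}.
  exact: drv_continuous (drv_cos (dvB v cab)).
have ce : {for v, continuous (fun v => expR (A c v))}.
  exact: drv_continuous (drv_exp (dvA v cab)).
apply: (cvgM ce); apply: cvgB.
  by apply: (cvgM _ cc); exact: cp.
by apply: (cvgM _ cs); exact: cq.
Qed.

Let fK (c v : R) : c \in `]a, b[ -> 0 <= v -> `|f c v| <= K * expR (- v).
Proof.
move=> cab v0; apply: le_trans (bound cab v0).
rewrite normrM ger0_norm ?expR_ge0// ler_wpM2l ?expR_ge0//.
apply: (@le_trans _ _ 1); last by rewrite -addrA lerDl addr_ge0.
by rewrite ler_norml cos_geN1 cos_le1.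
Qed.

Let hK (c v : R) : c \in `]a, b[ -> 0 <= v -> `|h c v| <= K * expR (- v).
Proof.
move=> cab v0; apply: le_trans (bound cab v0).
rewrite normrM ger0_norm ?expR_ge0// ler_wpM2l ?expR_ge0//.
rewrite (le_trans (ler_normB _ _))// !normrM -addrA ler_wpDl//.
by rewrite lerD// ler_piMr// ler_norml ?cos_geN1 ?cos_le1 ?sin_geN1 ?sin_le1.
Qed.

(** [h] is the derivative of [g] in [v], and [g] vanishes at infinity by the bound and at 0 because
    [B c 0 = 0], the function being real on the real axis. *)
Let integral_h (c : R) : c \in `]a, b[ ->
  (\int[leb]_(v in `[0%R, +oo[) (h c v)%:E = 0)%E.
Proof.
move=> cab.
have mh : measurable_fun setT (h c).
  by apply: continuous_measurable_fun; exact: ch.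
have ih : leb.-integrable `[0%R, +oo[ (fun v => (h c v)%:E).
  apply: (le_integrable _ _ _ (integrable_expRN_tail 0 K)) => //.
    by apply/measurable_EFinP; exact: measurable_funTS.
  move=> v /=; rewrite in_itv/= andbT => v0.
  by rewrite lee_fin (le_trans (hK cab v0))// ler_norm.
(* The fundamental theorem on a half-line is applied to a nonnegative integrand. Adding [K e^(- v)]
   makes [h] nonnegative, and its integral [K] is subtracted at the end. *)
have : (\int[leb]_(v in `[0%R, +oo[) (h c v + K * expR (- v))%:E = K%:E)%E.
  have dE (x : R) : is_derive x 1 (fun v => g c v - K * expR (- v))
      (h c x + K * expR (- x)).
    apply: (drv_eq (drvD (dvg x cab) (drvN (drvM (drv_cst K x) (drv_exp (drvN (drv_id x))))))).
    by ring.
  have ce (x : R) : {for x, continuous (fun v => K * expR (- v))}.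
    exact: drv_continuous (drvM (drv_cst K x) (drv_exp (drvN (drv_id x)))).
  rewrite (@ge0_continuous_FTC2y _ _ (fun v => g c v - K * expR (- v)) 0 0).
  - by rewrite sub0e /g B0// sin0 mulr0 mul0r sub0r oppr0 expR0 mulr1 EFinN oppeK.
  - move=> x x0; rewrite -lerBlDr sub0r.
    by have := hK cab x0; rewrite ler_norml => /andP[].
  - apply: continuous_subspaceT => x.
    by apply: cvgD; [exact: ch|exact: ce].
  - rewrite -[X in _ --> X](subr0 0).
    have Ke : K * expR (- v) @[v --> +oo] --> 0.
      by rewrite -[X in _ --> X](mulr0 K); apply: cvgM;
        [exact: cvg_cst|exact: cvgr_expR].
    apply: cvgB => //.
    apply: norm_cvg0.
    apply: (@squeeze_cvgr _ _ _ _ (fun=> 0) (fun v => K * expR (- v) * eta^-1)).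
    + near=> v; have v0 : 0 <= v by near: v; exact: nbhs_pinfty_ge.
      rewrite normr_ge0/= /g normrM normfV (ger0_norm (ltW eta_gt0)).
      rewrite ler_pM2r ?invr_gt0//; apply: le_trans (bound cab v0).
      rewrite normrM ger0_norm ?expR_ge0// ler_wpM2l ?expR_ge0//.
      apply: (@le_trans _ _ 1); last by rewrite -addrA lerDl addr_ge0.
      by rewrite ler_norml sin_geN1 sin_le1.
    + exact: cvg_cst.
    + by rewrite -[X in _ --> X](mul0r eta^-1); apply: cvgM => //; exact: cvg_cst.
  - by move=> x _; have [] := dE x.
  - by apply: cvg_at_right_filter; exact: drv_continuous (dE 0).
  - by move=> x _; rewrite derive1E; have [] := dE x.
under eq_integral do rewrite EFinD.
rewrite integralD//; last exact: integrable_expRN_tail.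
have -> : (\int[leb]_(v in `[0%R, +oo[) (K * expR (- v))%:E = K%:E)%E.
  under eq_integral do rewrite EFinM.
  rewrite integralZl//; first by rewrite integral_expRN_tail oppr0 expR0 mule1.
  have := @integrable_expRN_tail R 0 1.
  rewrite (_ : (fun v : R => (1 * expR (- v))%:E) = fun v => (expR (- v))%:E)//.
  by apply/funext => v; rewrite mul1r.
move=> /(congr1 (fun x => x - K%:E)%E); rewrite subee//.
by rewrite addeK// integrable_fin_num.
Unshelve. all: end_near. Qed.

(** Differentiating under the integral sign, the derivative in [c] is the integral of [h], hence
    zero. This replaces a contour theorem: only real parts on the upper half of each vertical line
    are compared. *)
Lemma contour_shift c1 c2 : c1 \in `]a, b[ -> c2 \in `]a, b[ -> c1 <= c2 ->
  (\int[leb]_(v in `[0%R, +oo[) (expR (A c2 v) * cos (B c2 v)) =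
   \int[leb]_(v in `[0%R, +oo[) (expR (A c1 v) * cos (B c1 v)))%R.
Proof.
move=> c1ab c2ab c12.
pose J c := (\int[leb]_(v in `[0%R, +oo[) f c v)%R.
have intf c : c \in `]a, b[ -> leb.-integrable `[0%R, +oo[ (EFin \o f c).
  move=> cab; apply: (le_integrable _ _ _ (integrable_expRN_tail 0 K)) => //.
    apply/measurable_EFinP; apply: measurable_funTS.
    by apply: continuous_measurable_fun; exact: cf.
  move=> v /=; rewrite in_itv/= andbT => v0.
  by rewrite lee_fin (le_trans (fK cab v0))// ler_norm.
have K0 : 0 <= K.
  have := fK c1ab (lexx 0); rewrite oppr0 expR0 mulr1.
  by apply: le_trans.
have dJ c : c \in `]a, b[ -> is_derive c 1 J 0.
  move=> cab.
  have d1 x y : `]a, b[%classic x -> `[0%R, +oo[%classic y -> derivable (f ^~ y) x 1.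
    by move=> xab _; have [] := dcf y xab.
  have d1E x y : `]a, b[%classic x -> (partial1of2 f x y)%R = h x y.
    by move=> xab; rewrite /partial1of2 derive1E; have [] := dcf y xab.
  have hG x y : `]a, b[%classic x -> `[0%R, +oo[%classic y ->
      `|(partial1of2 f x y)%R| <= K * expR (- y).
    by move=> xab; rewrite /= in_itv/= andbT => y0; rewrite d1E//; exact: hK.
  have G0 y : 0 <= K * expR (- y) by rewrite mulr_ge0 ?expR_ge0.
  have iG := integrable_expRN_tail 0 K.
  have mB : measurable (`[0%R, +oo[%classic : set (measurableTypeR R)) by [].
  apply: DeriveDef.
    exact: (derivable_under_integral mB cab intf d1 G0 iG hG).
  rewrite -derive1E (differentiation_under_integral mB cab intf d1 G0 iG hG).
  by under eq_Rintegral do rewrite d1E//; rewrite /Rintegral integral_h.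
have c12ab x : c1 <= x -> x <= c2 -> x \in `]a, b[.
  move: c1ab c2ab; rewrite !in_itv/= => /andP[ac1 _] /andP[_ c2b] xc1 xc2.
  by rewrite (lt_le_trans ac1)//= (le_lt_trans xc2).
have dJ12 (x : R) : x \in `]c1, c2[ -> is_derive x 1 J 0.
  by rewrite in_itv/= => /andP[xc1 xc2]; apply: dJ; rewrite c12ab ?ltW.
have cJ12 : {within `[c1, c2], continuous J}.
  apply: derivable_within_continuous => x; rewrite in_itv/= => /andP[xc1 xc2].
  by have [] := dJ x (c12ab x xc1 xc2).
have [x _ /eqP] := MVT_segment c12 dJ12 cJ12.
by rewrite mul0r subr_eq0 => /eqP.
Qed.

End contour_shift.

(** * The cosine transform of the Gaussian *)

Section gauss_cosine.
Context {R : realType}.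
Local Notation leb := (@lebesgue_measure R).

(** Completing the square trades Gaussian decay for the decay [e^(- v)] that the contour shift and
    dominated convergence use. *)
Lemma quadratic_exponent_le (D v : R) : D * v - v ^+ 2 <= (D + 1) ^+ 2 / 4 - v.
Proof.
rewrite -subr_ge0 (_ : _ - _ = ((D + 1) / 2 - v) ^+ 2) ?sqr_ge0//.
by field.
Qed.

Lemma integrable_dom_expRN (f : R -> R) (K : R) :
  measurable_fun setT f -> (forall v, 0 <= v -> `|f v| <= K * expR (- v)) ->
  leb.-integrable `[0%R, +oo[ (EFin \o f).
Proof.
move=> mf fK; apply: (le_integrable _ _ _ (integrable_expRN_tail 0 K)) => //.
  by apply/measurable_EFinP; exact: measurable_funTS.
move=> v /=; rewrite in_itv/= andbT => v0.
by rewrite lee_fin (le_trans (fK v v0))// ler_norm.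
Qed.

Lemma integrable_gauss_cos (y : R) :
  leb.-integrable `[0%R, +oo[ (fun v => (expR (- v ^+ 2) * cos (y * v))%:E).
Proof.
apply: (@integrable_dom_expRN _ (expR ((0 + 1) ^+ 2 / 4))).
  apply: continuous_measurable_fun => v.
  exact: drv_continuous (drvM (drv_exp (drvN (drvX 2 (drv_id v))))
    (drv_cos (drvM (drv_cst y v) (drv_id v)))).
move=> v v0; rewrite normrM (ger0_norm (expR_ge0 _)) -expRD.
apply: (@le_trans _ _ (expR (- v ^+ 2))).
  by rewrite ler_piMr ?expR_ge0// ler_norml cos_geN1 cos_le1.
by rewrite ler_expR; have := quadratic_exponent_le 0 v; rewrite mul0r; lra.
Qed.

Lemma integral_gauss : (\int[leb]_(v in `[0%R, +oo[) expR (- v ^+ 2) = Num.sqrt pi / 2)%R.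
Proof. by rewrite /Rintegral (@integral0y_gauss R). Qed.

(** The contour shift is applied to [exp(z^2)], from [Re z = |y| / 2], where its real part is
    [e^(y^2 / 4) e^(- v^2) cos(|y| v)], to [Re z = 0], where it is [e^(- v^2)]. *)
Lemma integral_gauss_cos (y : R) :
  (\int[leb]_(v in `[0%R, +oo[) (expR (- v ^+ 2) * cos (y * v)) =
   Num.sqrt pi / 2 * expR (- (y ^+ 2 / 4)))%R.
Proof.
pose b := `|y| + 1.
have yb : 0 <= `|y| / 2 by rewrite divr_ge0.
have b0 : 0 <= b by rewrite addr_ge0.
pose K : R := (1 + 2 * b) * expR (b ^+ 2 + (2 + 1) ^+ 2 / 4).
have bnd c v : c \in `](- b), b[ -> 0 <= v ->
    expR (c ^+ 2 - v ^+ 2) * (1 + `|2 * c| + `|2 * v|) <= K * expR (- v).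
  rewrite in_itv/= -ltr_norml => cb v0.
  have -> : K * expR (- v) = expR (b ^+ 2 + (2 + 1) ^+ 2 / 4 - v) * (1 + 2 * b).
    by rewrite expRD /K; ring.
  apply: (@le_trans _ _ (expR (c ^+ 2 - v ^+ 2) * (expR (2 * v) * (1 + 2 * b)))).
    rewrite ler_wpM2l ?expR_ge0// !normrM (ger0_norm v0) (@ger0_norm _ 2)//.
    apply: (@le_trans _ _ ((1 + 2 * v) * (1 + 2 * b))).
      by have := mulr_ge0 v0 b0; nra.
    by rewrite ler_wpM2r ?expR_ge1Dx// addr_ge0 ?mulr_ge0.
  rewrite mulrA -expRD ler_wpM2r ?addr_ge0 ?mulr_ge0// ler_expR.
  have := quadratic_exponent_le 2 v.
  have : c ^+ 2 <= b ^+ 2 by rewrite -real_normK ?num_real// lerXn2r ?nnegrE// ltW.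
  by lra.
have := @contour_shift R 1 (- b) b K (fun c v => c ^+ 2 - v ^+ 2)
  (fun c v => 2 * c * v) (fun c v => 2 * c) (fun c v => 2 * v) ltr01.
move=> /(_ _ _ _ _ _ _ _ bnd 0 (`|y| / 2)) H.
have {H} : (\int[leb]_(v in `[0%R, +oo[)
     (expR ((`|y| / 2) ^+ 2 - v ^+ 2) * cos (2 * (`|y| / 2) * v)) =
   \int[leb]_(v in `[0%R, +oo[) (expR (0 ^+ 2 - v ^+ 2) * cos (2 * 0 * v)))%R.
  apply: H => //.
  - move=> c v _.
    apply: (drv_eq (drvD (drvX 2 (drv_id c)) (drv_cst (- v ^+ 2) c))).
    by rewrite /=; ring.
  - move=> c v _.
    apply: (drv_eq (drvM (drvM (drv_cst 2 c) (drv_id c)) (drv_cst v c))).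
    by rewrite /=; ring.
  - move=> c v _.
    apply: (drv_eq (drvD (drv_cst (c ^+ 2) v) (drvN (drvX 2 (drv_id v))))).
    by rewrite /=; ring.
  - move=> c v _.
    apply: (drv_eq (drvM (drv_cst (2 * c) v) (drv_id v))).
    by rewrite /=; ring.
  - by move=> c _ v; exact: cvg_cst.
  - move=> c _ v; exact: drv_continuous (drvM (drv_cst 2 v) (drv_id v)).
  - by move=> c _; rewrite mulr0.
  - by rewrite in_itv/= oppr_lt0 ltr_wpDl.
  - by rewrite in_itv/= /b; apply/andP; split; have := normr_ge0 y; lra.
under [X in _ = X]eq_Rintegral do rewrite expr0n/= sub0r mulr0 mul0r cos0 mulr1.
rewrite integral_gauss => <-.
rewrite mulrC -RintegralZl//.
- apply: eq_Rintegral => v _; rewrite mulrA -expRD.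
  congr (expR _ * _).
    by rewrite expr_div_n real_normK ?num_real//; field.
  rewrite [2 * _]mulrC divfK//.
  by have [y0|y0] := leP 0 y; [rewrite ger0_norm|rewrite ltr0_norm// mulNr cosN].
- have := integrable_gauss_cos `|y|.
  move=> /(integrableZl _ (expR ((`|y| / 2) ^+ 2))) => /(_ (measurable_itv _)).
  apply: eq_integrable => // v _ /=.
  by rewrite [2 * _]mulrC divfK// -EFinM mulrA -expRD.
Qed.

End gauss_cosine.

(** * The exponent of the moments of [S] on vertical lines *)

Section shifted_exponent.
Context {R : realType}.
Local Notation leb := (@lebesgue_measure R).
Variables (s eta : R).
Hypotheses (s_gt0 : 0 < s) (eta_gt0 : 0 < eta).
Let eta_ge0 : 0 <= eta := ltW eta_gt0.

(* Real and imaginary parts of [z ln z - z + (z - s)^2 / eta^2] at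
   [z = c + i eta v], with [lnmod] and [arg] those of [ln z]. *)
Definition lnmod (c v : R) := ln (c ^+ 2 + (eta * v) ^+ 2) / 2.
Definition arg (c v : R) := atan (eta * v / c).
Definition expo_re (c v : R) :=
  c * lnmod c v - eta * v * arg c v - c + (c - s) ^+ 2 / eta ^+ 2 - v ^+ 2.
Definition expo_im (c v : R) :=
  eta * v * lnmod c v + c * arg c v - eta * v + 2 * (c - s) * v / eta.

Lemma lnmod_le (c v : R) : 0 < c -> 0 <= v -> lnmod c v <= c + eta * v.
Proof.
move=> c0 v0; have ev : 0 <= eta * v by rewrite mulr_ge0.
rewrite ler_pdivrMr//; apply: (@le_trans _ _ (ln ((c + eta * v) ^+ 2))).
  rewrite ler_ln ?posrE ?exprn_gt0 ?ltr_pwDl ?exprn_gt0 ?sqr_ge0//.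
  by have := mulr_ge0 (ltW c0) ev; nra.
rewrite lnXn ?ltr_pwDl// -[ln _ *+ 2]mulr_natr ler_pM2r//.
by apply: ltW; apply: ln_sublinear; rewrite ltr_pwDl.
Qed.

Lemma lnmod_ge (c v : R) : 0 < c -> ln c <= lnmod c v.
Proof.
move=> c0; rewrite ler_pdivlMr// mulr_natr -lnXn// ler_ln ?posrE ?exprn_gt0//.
  by rewrite lerDl sqr_ge0.
by rewrite ltr_pwDl ?exprn_gt0 ?sqr_ge0.
Qed.

Lemma arg_ge0 c v : 0 < c -> 0 <= v -> 0 <= arg c v.
Proof. by move=> c0 v0; rewrite -atan0 le_atan// divr_ge0 ?mulr_ge0// ltW. Qed.

Lemma expo_re_le (c v : R) : 0 < c -> 0 <= v ->
  expo_re c v <= c * (c + eta * v) + (c - s) ^+ 2 / eta ^+ 2 - v ^+ 2.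
Proof.
move=> c0 v0; rewrite /expo_re lerB// lerD// lerBlDr.
apply: (@le_trans _ _ (c * lnmod c v)).
  by rewrite gerBl mulr_ge0 ?arg_ge0 ?mulr_ge0.
by apply: ler_wpDr; [exact: ltW|rewrite ler_pM2l// lnmod_le].
Qed.

Let dlnmod_c (c v : R) : 0 < c -> is_derive c 1 (lnmod ^~ v) (c / (c ^+ 2 + (eta * v) ^+ 2)).
Proof.
move=> c0; have r0 : 0 < c ^+ 2 + (eta * v) ^+ 2.
  by rewrite ltr_pwDl ?exprn_gt0 ?sqr_ge0.
apply: (drv_eq (drvM (drv_ln (f := fun c => c ^+ 2 + (eta * v) ^+ 2) r0 (drvD (drvX 2 (drv_id c)) (drv_cst _ _))) (drv_cst _ _))).
by rewrite /=; field; rewrite gt_eqF.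
Qed.

Let dlnmod_v (c v : R) : 0 < c ->
  is_derive v 1 (lnmod c) (eta ^+ 2 * v / (c ^+ 2 + (eta * v) ^+ 2)).
Proof.
move=> c0; have r0 : 0 < c ^+ 2 + (eta * v) ^+ 2.
  by rewrite ltr_pwDl ?exprn_gt0 ?sqr_ge0.
apply: (drv_eq (drvM (drv_ln (f := fun v => c ^+ 2 + (eta * v) ^+ 2) r0 (drvD (drv_cst (c ^+ 2) v)
  (drvX 2 (drvM (drv_cst eta v) (drv_id v))))) (drv_cst _ _))).
by rewrite /=; field; rewrite gt_eqF.
Qed.

Let darg_c (c v : R) : 0 < c ->
  is_derive c 1 (arg ^~ v) (- (eta * v) / (c ^+ 2 + (eta * v) ^+ 2)).
Proof.
move=> c0; have r0 : 0 < c ^+ 2 + (eta * v) ^+ 2.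
  by rewrite ltr_pwDl ?exprn_gt0 ?sqr_ge0.
have cn : c != 0 by rewrite gt_eqF.
apply: (drv_eq (drv_atan (drvM (drv_cst (eta * v) c) (drvV (f := fun c => c) cn (drv_id c))))).
rewrite /=; field; rewrite cn [X in X != 0](_ : _ = c ^+ 2 + (eta * v) ^+ 2) ?gt_eqF//.
Qed.

Let darg_v (c v : R) : 0 < c ->
  is_derive v 1 (arg c) (eta * c / (c ^+ 2 + (eta * v) ^+ 2)).
Proof.
move=> c0; have r0 : 0 < c ^+ 2 + (eta * v) ^+ 2.
  by rewrite ltr_pwDl ?exprn_gt0 ?sqr_ge0.
have cn : c != 0 by rewrite gt_eqF.
apply: (drv_eq (drv_atan (drvM (drvM (drv_cst eta v) (drv_id v)) (drv_cst c^-1 v)))).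
rewrite /=; field; rewrite cn [X in X != 0](_ : _ = c ^+ 2 + (eta * v) ^+ 2) ?gt_eqF//.
Qed.

(** The term [(z - s)^2 / eta^2] contributes [- v^2] to the real part on every vertical line. This
    decay dominates the growth of [z ln z], which is at most of order [v] uniformly on the strip. *)
Lemma expo_shift c : 0 < c -> c <= s ->
  (\int[leb]_(v in `[0%R, +oo[) (expR (expo_re s v) * cos (expo_im s v)) =
   \int[leb]_(v in `[0%R, +oo[) (expR (expo_re c v) * cos (expo_im c v)))%R.
Proof.
move=> c0 cs.
(* The open strip contains [c] and [s] and stays away from the imaginary axis, so that [ln |z|] is
   bounded below on it. *)
pose a := c / 2; pose b := s + 1.
have a0 : 0 < a by rewrite divr_gt0.
have iab x : x \in `]a, b[ -> 0 < x by rewrite in_itv/= => /andP[/(lt_trans a0)].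
pose C0 := b ^+ 2 + b ^+ 2 / eta ^+ 2.
pose M := (1 + b + `|ln a| + 2 * b / eta ^+ 2 + pi / 2) + (eta + 2 / eta).
(* [C0 + b eta v - v^2] bounds the exponent and [M e^v] the factor containing [p] and [q].
   Completing the square in [(b eta + 1) v - v^2] gives the last term of [K]. *)
pose K := M * expR (C0 + (b * eta + 1 + 1) ^+ 2 / 4).
have b0 : 0 < b by rewrite addr_gt0.
have b0' := ltW b0.
have s0' := ltW s_gt0.
have pi0 : 0 <= pi / 2 :> R by rewrite divr_ge0 ?pi_ge0.
have be0 : 0 <= 2 * b / eta ^+ 2 by rewrite divr_ge0 ?mulr_ge0.
have e20 : 0 < eta ^+ 2 by rewrite exprn_gt0.
have e20' := ltW e20.
have bnd x v : x \in `]a, b[ -> 0 <= v ->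
    expR (expo_re x v) * (1 + `|lnmod x v + 2 * (x - s) / eta ^+ 2| +
      `|arg x v + 2 * v / eta|) <= K * expR (- v).
  move=> xab v0; have x0 := iab x xab.
  move: xab; rewrite in_itv/= => /andP[ax xb]; have xb' : x < s + 1 := xb.
  have ev : 0 <= eta * v by rewrite mulr_ge0.
  have xs2 : (x - s) ^+ 2 <= b ^+ 2.
    rewrite -real_normK ?num_real// lerXn2r ?nnegrE//.
    by rewrite ler_norml /b; apply/andP; split; lra.
  have E1 : expR (expo_re x v) <= expR (C0 + b * eta * v - v ^+ 2).
    rewrite ler_expR (le_trans (expo_re_le x0 v0))// lerB//.
    rewrite (_ : C0 + b * eta * v = b * (b + eta * v) + b ^+ 2 / eta ^+ 2); last first.
      by rewrite /C0; ring.
    rewrite lerD// ?ler_pM2r ?invr_gt0 ?exprn_gt0//.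
    by rewrite ler_pM ?lerD ?addr_ge0// ltW.
  have E2 : 1 + `|lnmod x v + 2 * (x - s) / eta ^+ 2| + `|arg x v + 2 * v / eta|
      <= M * expR v.
    have L : `|lnmod x v| <= b + eta * v + `|ln a|.
      rewrite ler_norml; apply/andP; split.
        have := lnmod_ge v x0; apply: le_trans.
        have : ln a <= ln x by rewrite ler_ln ?posrE// ltW.
        apply: le_trans; have : - `|ln a| <= ln a by rewrite lerNl -normrN ler_norm.
        by move: ev (ltW b0); lra.
      by have := lnmod_le x0 v0; have := normr_ge0 (ln a); lra.
    have L2 : `|2 * (x - s) / eta ^+ 2| <= 2 * b / eta ^+ 2.
      rewrite normrM normfV (ger0_norm (sqr_ge0 _)) ler_pM2r ?invr_gt0 ?exprn_gt0//.
      by rewrite normrM (@ger0_norm _ 2)// ler_pM2l// ler_norml /b; apply/andP; split; lra.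
    have L3 : `|arg x v + 2 * v / eta| <= pi / 2 + 2 / eta * v.
      rewrite ger0_norm; last by rewrite addr_ge0 ?arg_ge0 ?divr_ge0 ?mulr_ge0.
      by apply: lerD; [apply/ltW/atan_ltpi2|rewrite mulrAC].
    have L0 := ler_normD (lnmod x v) (2 * (x - s) / eta ^+ 2).
    pose M1 : R := 1 + b + `|ln a| + 2 * b / eta ^+ 2 + pi / 2.
    have M10 : 0 <= M1 by rewrite !addr_ge0.
    have M20 : 0 <= eta + 2 / eta by rewrite addr_ge0 ?divr_ge0.
    have ME : M = M1 + (eta + 2 / eta) by [].
    have E3 : 1 + `|lnmod x v + 2 * (x - s) / eta ^+ 2| +
        `|arg x v + 2 * v / eta| <= M1 + (eta + 2 / eta) * v.
      rewrite [(eta + _) * v]mulrDl; apply: (@le_trans _ _ (1 + (b + eta * v + `|ln a| +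
        2 * b / eta ^+ 2) + (pi / 2 + 2 / eta * v))).
        apply: lerD => //; rewrite lerD2l; exact: (le_trans L0 (lerD L L2)).
      by rewrite le_eqVlt; apply/orP; left; apply/eqP; rewrite /M1; ring.
    apply: (le_trans E3); apply: (@le_trans _ _ (M * (1 + v))).
      rewrite ME; have := mulr_ge0 M10 v0.
      by move: M10 M20 v0; move: (eta + 2 / eta) (M1) => z1 z2; nra.
    by rewrite ler_wpM2l ?expR_ge1Dx// ME addr_ge0.
  have M0 : 0 <= M by apply: addr_ge0; [rewrite !addr_ge0|rewrite addr_ge0 ?divr_ge0].
  apply: (@le_trans _ _ (expR (C0 + b * eta * v - v ^+ 2) * (M * expR v))).
    by rewrite ler_pM ?expR_ge0 ?addr_ge0.
  rewrite /K mulrCA -[leRHS]mulrA -!expRD ler_wpM2l// ler_expR.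
  by have := quadratic_exponent_le (b * eta + 1) v; lra.
apply: (contour_shift (K := K) (a := a) (b := b) (eta := eta)
  (p := fun x v => lnmod x v + 2 * (x - s) / eta ^+ 2)
  (q := fun x v => arg x v + 2 * v / eta)).
- exact: eta_gt0.
- move=> x v /iab x0.
  apply: (drv_eq (drvD (drvD (drvD (drvD (drvM (drv_id x) (dlnmod_c v x0))
    (drvN (drvM (drv_cst (eta * v) x) (darg_c v x0)))) (drvN (drv_id x)))
    (drvM (drvX 2 (drvD (drv_id x) (drv_cst (- s) x))) (drv_cst _ _)))
    (drv_cst _ _))).
  have r0 : 0 < x ^+ 2 + (eta * v) ^+ 2 by rewrite ltr_pwDl ?exprn_gt0 ?sqr_ge0.
  by rewrite /=; field; rewrite !gt_eqF.
- move=> x v /iab x0.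
  apply: (drv_eq (drvD (drvD (drvD (drvM (drv_cst (eta * v) x) (dlnmod_c v x0))
    (drvM (drv_id x) (darg_c v x0))) (drv_cst (- (eta * v)) x))
    (drvM (drvM (drvM (drv_cst 2 x) (drvD (drv_id x) (drv_cst (- s) x))) (drv_cst v x)) (drv_cst _ _)))).
  have r0 : 0 < x ^+ 2 + (eta * v) ^+ 2 by rewrite ltr_pwDl ?exprn_gt0 ?sqr_ge0.
  by rewrite /=; field; rewrite !gt_eqF.
- move=> x v /iab x0.
  apply: (drv_eq (drvD (drvD (drvD (drvD (drvM (drv_cst x v) (dlnmod_v v x0))
    (drvN (drvM (drvM (drv_cst eta v) (drv_id v)) (darg_v v x0)))) (drv_cst (- x) v))
    (drv_cst _ _)) (drvN (drvX 2 (drv_id v))))).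
  have r0 : 0 < x ^+ 2 + (eta * v) ^+ 2 by rewrite ltr_pwDl ?exprn_gt0 ?sqr_ge0.
  by rewrite /=; field; rewrite !gt_eqF.
- move=> x v /iab x0.
  apply: (drv_eq (drvD (drvD (drvD (drvM (drvM (drv_cst eta v) (drv_id v)) (dlnmod_v v x0))
    (drvM (drv_cst x v) (darg_v v x0))) (drvN (drvM (drv_cst eta v) (drv_id v))))
    (drvM (drvM (drv_cst (2 * (x - s)) v) (drv_id v)) (drv_cst _ _)))).
  have r0 : 0 < x ^+ 2 + (eta * v) ^+ 2 by rewrite ltr_pwDl ?exprn_gt0 ?sqr_ge0.
  by rewrite /=; field; rewrite !gt_eqF.
- move=> x /iab x0 v.
  exact: drv_continuous (drvD (dlnmod_v v x0) (drv_cst _ _)).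
- move=> x /iab x0 v.
  exact: drv_continuous (drvD (darg_v v x0) (drvM (drvM (drv_cst 2 v) (drv_id v)) (drv_cst _ _))).
- by move=> x _; rewrite /expo_im /arg !mulr0 !mul0r atan0 mulr0; ring.
- by [].
- by rewrite in_itv/= /a /b; apply/andP; split; lra.
- by rewrite in_itv/= /a /b; apply/andP; split; lra.
- by [].
Qed.

End shifted_exponent.

Section limits_of_shift.
Context {R : realType}.
Local Notation leb := (@lebesgue_measure R).

(** Pointwise convergence is required away from 0 only: the limits of [lnmod] and [arg] at the
    imaginary axis are taken with [eta v > 0]. The origin is a null set. *)
Lemma Rintegral_dom_expRN_cvg (F : nat -> R -> R) (f : R -> R) (K : R) :
  (forall n, measurable_fun setT (F n)) -> measurable_fun setT f ->
  (forall n v, 0 <= v -> `|F n v| <= K * expR (- v)) ->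
  (forall v, 0 < v -> F ^~ v @ \oo --> f v) ->
  (fun n => \int[leb]_(v in `[0%R, +oo[) F n v)%R @ \oo -->
  (\int[leb]_(v in `[0%R, +oo[) f v)%R.
Proof.
move=> mF mf FK Ff.
have oc (g : R -> R) : measurable_fun setT g ->
    (\int[leb]_(v in `[0%R, +oo[) g v = \int[leb]_(v in `]0%R, +oo[) g v)%R.
  move=> mg; rewrite /Rintegral integral_itv_obnd_cbnd//.
  by apply/measurable_EFinP; exact: measurable_funTS.
rewrite oc//; under eq_fun do rewrite oc//.
have iK : leb.-integrable `]0%R, +oo[ (fun v => (K * expR (- v))%:E).
  apply: (integrableS _ _ _ (integrable_expRN_tail 0 K)) => //.
  by apply: subset_itvr; rewrite bnd_simp.
have [] := @dominated_convergence _ _ _ leb `]0%R, +oo[%classic (measurable_itv _)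
  (fun n v => (F n v)%:E) (fun v => (f v)%:E) (fun v => (K * expR (- v))%:E).
- by move=> n; apply/measurable_EFinP; exact: measurable_funTS (mF n).
- by apply/measurable_EFinP; exact: measurable_funTS.
- apply: aeW => v; rewrite /= in_itv/= andbT => v0.
  by apply: cvg_EFin; [exact: nearW|exact: Ff].
- exact: iK.
- apply: aeW => v n; rewrite /= in_itv/= andbT => v0.
  by rewrite lee_fin FK// ltW.
move=> i_f _; rewrite -(fineK (integrable_fin_num _ i_f))// => h.
by have /fine_cvgP[_] := h.
Qed.

Lemma measurable_expo_re (s eta c : R) : measurable_fun setT (expo_re s eta c).
Proof.
apply: measurable_funB; last exact: measurable_funX.
apply: measurable_funD => //; apply: measurable_funB => //; apply: measurable_funB.
  apply: measurable_funM => //; apply: measurable_funM => //.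
  apply: measurableT_comp => //; apply: measurable_funD => //.
  by apply: measurable_funX; exact: measurable_funM.
apply: measurable_funM; first exact: measurable_funM.
apply: measurableT_comp; last by apply: measurable_funM => //; exact: measurable_funM.
by apply: continuous_measurable_fun => x; exact: continuous_atan.
Qed.

Lemma measurable_expo_im (s eta c : R) : measurable_fun setT (expo_im s eta c).
Proof.
apply: measurable_funD; last by apply: measurable_funM => //; exact: measurable_funM.
apply: measurable_funB; last exact: measurable_funM.
apply: measurable_funD.
  apply: measurable_funM; first exact: measurable_funM.
  apply: measurable_funM => //.
  apply: measurableT_comp => //; apply: measurable_funD => //.
  by apply: measurable_funX; exact: measurable_funM.
apply: measurable_funM => //.
apply: measurableT_comp; last by apply: measurable_funM => //; exact: measurable_funM.
by apply: continuous_measurable_fun => x; exact: continuous_atan.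
Qed.

Let measurable_expcos (f g : R -> R) : measurable_fun setT f ->
  measurable_fun setT g -> measurable_fun setT (fun v => expR (f v) * cos (g v)).
Proof.
move=> mf mg; apply: measurable_funM; apply: measurableT_comp => //.
by apply: continuous_measurable_fun; exact: continuous_cos.
Qed.

Let cvg_expcos (u v : R^nat) a b : u @ \oo --> a -> v @ \oo --> b ->
  (fun n => expR (u n) * cos (v n)) @ \oo --> expR a * cos b.
Proof.
move=> ua vb; apply: cvgM.
  exact: (continuous_cvg _ (h := expR) (@continuous_expR R a) ua).
exact: (continuous_cvg _ (h := cos) (@continuous_cos R b) vb).
Qed.

Let harmonic0 : (fun n : nat => n.+1%:R^-1 : R) @ \oo --> (0:R).
Proof. exact: cvg_harmonic. Qed.

(** The lines [Re z = s / (n + 1)] approach the imaginary axis. There [arg] tends to [pi / 2], and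
    [z ln z - z] becomes the exponent of the characteristic function of [X] at [l = eta v]; the
    remaining terms come from [(z - s)^2 / eta^2] at [z = i eta v]. *)
Lemma expo_shift0 (s eta : R) : 0 < s -> 0 < eta ->
  (\int[leb]_(v in `[0%R, +oo[) (expR (expo_re s eta s v) * cos (expo_im s eta s v)) =
   \int[leb]_(v in `[0%R, +oo[) (expR (- (pi * (eta * v) / 2) + s ^+ 2 / eta ^+ 2 - v ^+ 2) *
     cos (eta * v * (ln (eta * v) - 1) - 2 * s * v / eta)))%R.
Proof.
move=> s0 eta0.
pose c (n : nat) := s / n.+1%:R.
have c0 n : 0 < c n by rewrite divr_gt0.
have cs n : c n <= s by rewrite ler_pdivrMr// ler_peMr ?ler1n// ltW.
pose K := expR (s ^+ 2 + s ^+ 2 / eta ^+ 2 + (s * eta + 1) ^+ 2 / 4).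
have : (fun n => \int[leb]_(v in `[0%R, +oo[)
    (expR (expo_re s eta (c n) v) * cos (expo_im s eta (c n) v)))%R @ \oo -->
  (\int[leb]_(v in `[0%R, +oo[) (expR (- (pi * (eta * v) / 2) + s ^+ 2 / eta ^+ 2 - v ^+ 2) *
     cos (eta * v * (ln (eta * v) - 1) - 2 * s * v / eta)))%R.
  apply: (@Rintegral_dom_expRN_cvg _ _ K).
  - by move=> n; apply: measurable_expcos;
      [exact: measurable_expo_re|exact: measurable_expo_im].
  - apply: measurable_expcos.
      apply: measurable_funB; last exact: measurable_funX.
      apply: measurable_funD => //; apply: measurableT_comp => //.
      by do ?apply: measurable_funM.
    have mev : measurable_fun setT (fun v => eta * v) by exact: measurable_funM.
    apply: measurable_funB; last by do ?apply: measurable_funM.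
    by apply: measurable_funM => //; apply: measurable_funB => //; exact: measurableT_comp.
  - move=> n v v0; rewrite normrM (ger0_norm (expR_ge0 _)).
    apply: (@le_trans _ _ (expR (expo_re s eta (c n) v))).
      by rewrite ler_piMr ?expR_ge0// ler_norml cos_geN1 cos_le1.
    rewrite -expRD ler_expR (le_trans (expo_re_le _ eta0 (c0 n) v0))//.
    have h1 : c n * (c n + eta * v) <= s * (s + eta * v).
      have ev : 0 <= eta * v by rewrite mulr_ge0 ?(ltW eta0).
      by apply: ler_pM => //; [exact: ltW|rewrite addr_ge0// ltW|rewrite lerD].
    have h2 : (c n - s) ^+ 2 / eta ^+ 2 <= s ^+ 2 / eta ^+ 2.
      rewrite ler_pM2r ?invr_gt0 ?exprn_gt0//.
      by have := c0 n; have := cs n; nra.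
    by have := quadratic_exponent_le (s * eta) v; lra.
  - move=> v v0; have ev : 0 < eta * v by rewrite mulr_gt0.
    have hc : c @ \oo --> (0:R).
      by rewrite -[X in _ --> X](mulr0 s); apply: cvgM => //; exact: cvg_cst.
    have hl : (fun n => lnmod eta (c n) v) @ \oo --> ln (eta * v).
      have -> : ln (eta * v) = ln (0 ^+ 2 + (eta * v) ^+ 2) / 2.
        by rewrite expr0n/= add0r lnXn// -[_ *+ 2]mulr_natr mulfK.
      apply: cvgM; last exact: cvg_cst.
      apply: (continuous_cvg _ (h := @ln R)).
        by apply: continuous_ln; rewrite expr0n/= add0r exprn_gt0.
      apply: cvgD; last exact: cvg_cst.
      by under eq_fun do rewrite expr2; rewrite expr2; exact: cvgM.
    have ha : (fun n => arg eta (c n) v) @ \oo --> (pi / 2 : R).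
      apply: (@cvg_comp _ _ _ (fun n => eta * v / c n) atan _ (pinfty_nbhs R)); last first.
        exact: cvgy_atan.
      rewrite (_ : (fun n => _) = (fun n => (eta * v / s) * n.+1%:R)); last first.
        by apply/funext => n; rewrite /c invf_div mulrA mulrAC.
      have M0 : 0 < eta * v / s by rewrite divr_gt0.
      apply: (@cvg_comp _ _ _ (fun n : nat => n.+1%:R) ( *%R (eta * v / s)) _ (pinfty_nbhs R)).
        by rewrite (cvg_shiftS (fun n => n%:R : R)); exact: cvgr_idn.
      exact: (gt0_cvgMry (f := id) M0).
    apply: cvg_expcos.
      rewrite (_ : - _ + _ - _ = 0 * ln (eta * v) - eta * v * (pi / 2) - 0 +
        (0 - s) ^+ 2 / eta ^+ 2 - v ^+ 2); last by field; rewrite gt_eqF.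
      apply: cvgB; last exact: cvg_cst.
      apply: cvgD.
        apply: cvgB => //; apply: cvgB; first exact: cvgM.
        by apply: cvgM => //; exact: cvg_cst.
      apply: cvgM; last exact: cvg_cst.
      have h : (fun n => c n - s) @ \oo --> 0 - s by apply: cvgB => //; exact: cvg_cst.
      by under eq_fun do rewrite expr2; rewrite expr2; exact: cvgM.
    rewrite (_ : _ - _ = eta * v * ln (eta * v) + 0 * (pi / 2) - eta * v +
      2 * (0 - s) * v / eta); last by field; rewrite gt_eqF.
    apply: cvgD.
      apply: cvgB; last exact: cvg_cst.
      apply: cvgD; last exact: cvgM.
      by apply: cvgM => //; exact: cvg_cst.
    apply: cvgM; last exact: cvg_cst.
    apply: cvgM; last exact: cvg_cst.
    apply: cvgM; first exact: cvg_cst.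
    by apply: cvgB => //; exact: cvg_cst.
move=> H; apply: etrans (cvg_lim (@Rhausdorff R) H).
apply/esym/cvg_lim => //; apply: cvg_near_cst; apply: nearW => n.
exact/esym/expo_shift.
Qed.

(** On the line [Re z = s] the quadratic term is [- v^2] whatever [eta] is, while [z = s + i eta v]
    tends to [s] as [eta] tends to 0. *)
Lemma expo_limit (s : R) : 0 < s ->
  (fun n : nat => \int[leb]_(v in `[0%R, +oo[)
     (expR (expo_re s n.+1%:R^-1 s v) * cos (expo_im s n.+1%:R^-1 s v)))%R @ \oo -->
  expR (s * ln s - s) * (Num.sqrt pi / 2).
Proof.
move=> s0.
rewrite -integral_gauss -RintegralZl//; last first.
  have := integrable_gauss_cos (0 : R); apply: eq_integrable => // v _.
  by rewrite mul0r cos0 mulr1.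
apply: (@Rintegral_dom_expRN_cvg _ _ (expR (s ^+ 2 + (s + 1) ^+ 2 / 4))).
- by move=> n; apply: measurable_expcos;
    [exact: measurable_expo_re|exact: measurable_expo_im].
- apply: measurable_funM => //; apply: measurableT_comp => //.
  by apply: measurableT_comp => //; exact: measurable_funX.
- move=> n v v0; rewrite normrM (ger0_norm (expR_ge0 _)).
  apply: (@le_trans _ _ (expR (expo_re s n.+1%:R^-1 s v))).
    by rewrite ler_piMr ?expR_ge0// ler_norml cos_geN1 cos_le1.
  have n0 : 0 < n.+1%:R^-1 :> R by rewrite invr_gt0.
  rewrite -expRD ler_expR (le_trans (expo_re_le _ n0 s0 v0))//.
  have h1 : n.+1%:R^-1 * v <= v by rewrite ler_piMl// invf_le1 ?ler1n.
  have h2 : s * (n.+1%:R^-1 * v) <= s * v by rewrite ler_pM2l.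
  rewrite subrr expr0n/= mul0r addr0.
  have := quadratic_exponent_le s v.
  have -> : s * (s + n.+1%:R^-1 * v) = s ^+ 2 + s * (n.+1%:R^-1 * v) by ring.
  by move: (s * (_ * v)) h2 => z h2; lra.
- move=> v v0.
  have -> : expR (s * ln s - s) * expR (- v ^+ 2) =
      expR (s * ln s - s - v ^+ 2) * cos 0 by rewrite cos0 mulr1 -expRD.
  have hv : (fun n : nat => n.+1%:R^-1 * v) @ \oo --> 0 * v.
    by apply: cvgM => //; exact: cvg_cst.
  have hl : (fun n => lnmod n.+1%:R^-1 s v) @ \oo --> ln s.
    have -> : ln s = ln (s ^+ 2 + (0 * v) ^+ 2) / 2.
      by rewrite mul0r expr0n/= addr0 lnXn// -[_ *+ 2]mulr_natr mulfK.
    apply: cvgM; last exact: cvg_cst.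
    apply: (continuous_cvg _ (h := @ln R)).
      by apply: continuous_ln; rewrite mul0r expr0n/= addr0 exprn_gt0.
    apply: cvgD; first exact: cvg_cst.
    by under eq_fun do rewrite expr2; rewrite expr2; exact: cvgM.
  have ha : (fun n => arg n.+1%:R^-1 s v) @ \oo --> (0 : R).
    rewrite -[X in _ --> X](@atan0 R).
    apply: (continuous_cvg _ (h := @atan R)); first exact: continuous_atan.
    rewrite (_ : 0 = 0 * v / s); last by rewrite !mul0r.
    by apply: cvgM => //; exact: cvg_cst.
  apply: cvg_expcos.
    rewrite (_ : s * ln s - s + - v ^+ 2 = s * ln s - 0 * v * 0 - s + 0 - v ^+ 2); last by ring.
    apply: cvgB; last exact: cvg_cst.
    apply: cvgD; last by under eq_fun do rewrite subrr expr0n/= mul0r; exact: cvg_cst.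
    apply: cvgB; last exact: cvg_cst.
    apply: cvgB; last exact: (cvgM hv ha).
    by apply: cvgM => //; exact: cvg_cst.
  rewrite [X in _ --> X](_ : 0 = 0 * v * ln s + s * 0 - 0 * v + 0); last by ring.
  apply: cvgD; last by under eq_fun do rewrite subrr mulr0 !mul0r; exact: cvg_cst.
  apply: cvgB => //; apply: cvgD; first exact: cvgM.
  by apply: cvgM => //; exact: cvg_cst.
Qed.

End limits_of_shift.

Lemma integral_indicM d (T : measurableType d) (R : realType)
    (mu : {measure set T -> \bar R}) (D : set T) (g : T -> R) :
  (\int[mu]_x (\1_D x * g x)%:E = \int[mu]_(x in D) (g x)%:E)%E.
Proof.
rewrite [RHS]integral_mkcond; apply: eq_integral => x _.
by rewrite patchE indicE; case: ifPn; rewrite ?mul1r ?mul0r.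
Qed.

(** * From the characteristic function of [log S] to the moments of [S] *)

Section exp_moments_of_log_S.
Context {R : realType} d (T : measurableType d) (P : probability T R).
Variable X : T -> R.
Local Notation leb := (@lebesgue_measure R).
Hypothesis mX : measurable_fun setT X.
Hypothesis cosX : forall l, 0 <= l -> (\int[P]_w (cos (l * X w))%:E =
  (expR (- (pi * l / 2)) * cos (l * (ln l - 1)))%:E)%E.
Hypothesis sinX : forall l, 0 <= l -> (\int[P]_w (sin (l * X w))%:E =
  (expR (- (pi * l / 2)) * sin (l * (ln l - 1)))%:E)%E.

Let mcos : measurable_fun setT (@cos R).
Proof. by apply: continuous_measurable_fun; exact: continuous_cos. Qed.

Let msin : measurable_fun setT (@sin R).
Proof. by apply: continuous_measurable_fun; exact: continuous_sin. Qed.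

Let cos_le (x : R) : `|cos x| <= 1.
Proof. by rewrite ler_norml cos_geN1 cos_le1. Qed.

Let cos_shift (l a : R) : 0 <= l -> (\int[P]_w (cos (l * X w - a))%:E =
  (expR (- (pi * l / 2)) * cos (l * (ln l - 1) - a))%:E)%E.
Proof.
move=> l0.
have ic : P.-integrable setT (fun w => (cos (l * X w))%:E).
  apply: (@integrable_le_bound _ _ _ P _ 1) => //.
  by apply: measurableT_comp => //; exact: measurable_funM.
have is_ : P.-integrable setT (fun w => (sin (l * X w))%:E).
  apply: (@integrable_le_bound _ _ _ P _ 1).
    by apply: measurableT_comp => //; exact: measurable_funM.
  by move=> w; rewrite ler_norml sin_geN1 sin_le1.
rewrite (eq_integral (fun w => ((cos a)%:E * (cos (l * X w))%:E +
    (sin a)%:E * (sin (l * X w))%:E)%E)); last first.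
  by move=> w _; rewrite cosB -!EFinM -EFinD; congr EFin; ring.
rewrite integralD//; [|exact: integrableZl|exact: integrableZl].
rewrite !integralZl// cosX// sinX// -!EFinM -EFinD cosB.
by congr EFin; ring.
Qed.

Let integrable_damped_cos (k a : R) : 0 <= k ->
  leb.-integrable `[0%R, +oo[ (fun v => (expR (- (pi * (k * v) / 2) - v ^+ 2) *
      cos (k * v * (ln (k * v) - 1) - a * v))%:E).
Proof.
move=> k0.
apply: (@integrable_dom_expRN _ _ (expR ((0 + 1) ^+ 2 / 4))).
  have mkv : measurable_fun setT (fun v : R => k * v) by exact: measurable_funM.
  apply: measurable_funM.
    apply: measurableT_comp => //; apply: measurable_funB; last exact: measurable_funX.
    by apply: measurableT_comp => //; do ?apply: measurable_funM.
  apply: measurableT_comp => //; apply: measurable_funB; last exact: measurable_funM.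
  by apply: measurable_funM => //; apply: measurable_funB => //; exact: measurableT_comp.
move=> v v0; rewrite normrM (ger0_norm (expR_ge0 _)) -expRD.
apply: (@le_trans _ _ (expR (- (pi * (k * v) / 2) - v ^+ 2))).
  by rewrite ler_piMr ?expR_ge0.
rewrite ler_expR; have := quadratic_exponent_le 0 v; rewrite mul0r.
have : 0 <= pi * (k * v) / 2 by rewrite divr_ge0 ?mulr_ge0 ?pi_ge0.
by move: (pi * (k * v) / 2) => z; lra.
Qed.

(** The factor [e^(- v^2)] makes the integrand integrable on the product, so Fubini applies; the
    expectation is then the characteristic function at [k v], rotated by the angle [a v]. *)
Let fourier_swap (k a : R) : 0 <= k ->
  (\int[P]_w (\int[leb]_(v in `[0%R, +oo[)
      (expR (- v ^+ 2) * cos ((k * X w - a) * v)))%R%:E =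
   (\int[leb]_(v in `[0%R, +oo[) (expR (- (pi * (k * v) / 2) - v ^+ 2) *
      cos (k * v * (ln (k * v) - 1) - a * v)))%R%:E)%E.
Proof.
move=> k0.
pose D : set (measurableTypeR R) := `[0%R, +oo[%classic.
have mD : measurable D by exact: measurable_itv.
pose f (z : T * measurableTypeR R) : \bar R :=
  (\1_D z.2 * (expR (- z.2 ^+ 2) * cos ((k * X z.1 - a) * z.2)))%:E.
have mf : measurable_fun setT f.
  apply/measurable_EFinP; apply: measurable_funM.
    by apply: measurableT_comp.
  apply: measurable_funM.
    apply: measurableT_comp => //; apply: measurableT_comp => //.
    by apply: measurable_funX; exact: measurable_snd.
  apply: measurableT_comp => //; apply: measurable_funM; last exact: measurable_snd.
  apply: measurable_funB => //; apply: measurable_funM => //.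
  by apply: measurableT_comp => //; exact: measurable_fst.
have f_fin w : (\int[leb]_v f (w, v) =
    (\int[leb]_(v in `[0%R, +oo[) (expR (- v ^+ 2) * cos ((k * X w - a) * v)))%R%:E)%E.
  rewrite /f/= integral_indicM /Rintegral fineK//.
  by apply: integrable_fin_num => //; exact: integrable_gauss_cos.
have i_f : (P \x leb)%E.-integrable setT f.
  have mg : measurable_fun setT
      (fun z : T * measurableTypeR R => (\1_D z.2 * expR (- z.2 ^+ 2))%:E).
    apply/measurable_EFinP; apply: measurable_funM.
      by apply: measurableT_comp.
    apply: measurableT_comp => //; apply: measurableT_comp => //.
    by apply: measurable_funX; exact: measurable_snd.
  apply: (@le_integrable _ _ _ _ _ _ _
    (fun z : T * measurableTypeR R => (\1_D z.2 * expR (- z.2 ^+ 2))%:E)) => //.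
    move=> z _; rewrite !abse_EFin lee_fin !normrM ler_wpM2l//.
    by rewrite ler_piMr.
  apply/integrable12ltyP => //.
  under eq_integral => w _.
    under eq_integral do rewrite /= ger0_norm ?mulr_ge0 ?expR_ge0//.
    rewrite integral_indicM integral0y_gauss.
    over.
  by rewrite integral_cst//= probability_setT mule1 ltry.
have := Fubini i_f.
under eq_integral do rewrite f_fin.
move=> ->.
transitivity (\int[leb]_v (\1_D v * (expR (- (pi * (k * v) / 2) - v ^+ 2) *
      cos (k * v * (ln (k * v) - 1) - a * v)))%:E)%E.
  apply: eq_integral => v _; rewrite /f/= indicE.
  have [|vD] := boolP (v \in D).
    rewrite inE /D/= in_itv/= andbT => v0; rewrite mul1r.
    have kv : 0 <= k * v by rewrite mulr_ge0.
    transitivity (\int[P]_w ((expR (- v ^+ 2))%:E * (cos (k * v * X w - a * v))%:E))%E.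
      apply: eq_integral => w _; rewrite mul1r EFinM; congr (_ * (cos _)%:E)%E.
      by ring.
    rewrite integralZl//; last first.
      apply: (@integrable_le_bound _ _ _ P _ 1) => //.
      apply: measurableT_comp => //; apply: measurable_funB => //.
      exact: measurable_funM.
    rewrite cos_shift// -EFinM [X in X%:E]mulrA -expRD; congr (expR _ * _)%:E.
    by rewrite addrC.
  by under eq_integral do rewrite mul0r; rewrite integral0 mul0r.
rewrite integral_indicM /Rintegral fineK//; apply: integrable_fin_num => //.
exact: integrable_damped_cos.
Qed.

(** With [a = 2 s / eta], the exponent is [s^2 / eta^2 - (eta X - a)^2 / 4]. The Gaussian in
    [eta X - a] is a cosine transform by [integral_gauss_cos], whose expectation involves only the
    characteristic function. *)
Let regularized_moment (s eta : R) : 0 < s -> 0 < eta ->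
  (\int[P]_w (expR (s * X w - (eta * X w) ^+ 2 / 4))%:E =
   (2 / Num.sqrt pi * \int[leb]_(v in `[0%R, +oo[)
     (expR (expo_re s eta s v) * cos (expo_im s eta s v)))%R%:E)%E.
Proof.
move=> s0 eta0; rewrite expo_shift0//.
have sp : 0 < Num.sqrt pi :> R by rewrite sqrtr_gt0 pi_gt0.
pose a := 2 * s / eta.
have sw := @fourier_swap eta a (ltW eta0).
pose k := 2 / Num.sqrt pi * expR (s ^+ 2 / eta ^+ 2).
transitivity (k%:E * \int[P]_w (\int[leb]_(v in `[0%R, +oo[)
      (expR (- v ^+ 2) * cos ((eta * X w - a) * v)))%R%:E)%E.
  rewrite -ge0_integralZl//.
  - apply: eq_integral => w _; rewrite integral_gauss_cos -EFinM; congr EFin.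
    rewrite /k [RHS](_ : _ = expR (s ^+ 2 / eta ^+ 2) *
      expR (- ((eta * X w - a) ^+ 2 / 4))); last by field; rewrite gt_eqF.
    rewrite -expRD; congr expR; rewrite /a; field.
    by rewrite gt_eqF.
  - apply/measurable_EFinP.
    under eq_fun do rewrite integral_gauss_cos.
    apply: measurable_funM => //; apply: measurableT_comp => //.
    apply: measurableT_comp => //; apply: measurable_funM => //.
    apply: measurable_funX; apply: measurable_funB => //.
    exact: measurable_funM.
  - by move=> w _; rewrite lee_fin integral_gauss_cos mulr_ge0 ?expR_ge0 ?divr_ge0.
  - by rewrite lee_fin mulr_ge0 ?expR_ge0// divr_ge0.
rewrite sw -EFinM; congr EFin; rewrite /k.
apply: etrans (esym (mulrA _ _ _)) _; congr (_ * _).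
rewrite -RintegralZl//; last by apply: integrable_damped_cos; exact: ltW.
  apply: eq_Rintegral => v _; rewrite mulrA -expRD; congr (expR _ * cos _).
    by ring.
by rewrite /a; field; rewrite gt_eqF.
Qed.

(** The damping factor increases to 1 as [eta = 1 / (n + 1)] decreases, so monotone convergence
    yields the value and the integrability of [e^(s X)] together. *)
Lemma exp_moment_log_S (s : R) : 0 < s ->
  (\int[P]_w (expR (s * X w))%:E = (expR (s * ln s - s))%:E)%E.
Proof.
move=> s0.
have sp : 0 < Num.sqrt pi :> R by rewrite sqrtr_gt0 pi_gt0.
pose F (n : nat) w := (expR (s * X w - (n.+1%:R^-1 * X w) ^+ 2 / 4))%:E.
have F_cvg w : F ^~ w @ \oo --> (expR (s * X w))%:E.
  apply: cvg_EFin; first exact: nearW.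
  apply: (continuous_cvg _ (h := expR)); first exact: continuous_expR.
  rewrite -[X in _ --> X](subr0 (s * X w)); apply: cvgB; first exact: cvg_cst.
  rewrite (_ : 0 = (0 * X w) * (0 * X w) / 4); last by rewrite !mul0r.
  apply: cvgM; last exact: cvg_cst.
  have h : (fun n : nat => n.+1%:R^-1 * X w) @ \oo --> 0 * X w.
    by apply: cvgM; [exact: cvg_harmonic|exact: cvg_cst].
  by under eq_fun do rewrite expr2; exact: cvgM.
have mF n : measurable_fun setT (F n).
  apply/measurable_EFinP; apply: measurableT_comp => //.
  apply: measurable_funB; first exact: measurable_funM.
  by apply: measurable_funM => //; apply: measurable_funX; exact: measurable_funM.
have := @cvg_monotone_convergence _ _ _ P setT measurableT F mF.
have F0 n w : setT w -> (0 <= F n w)%E by rewrite lee_fin expR_ge0.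
have Fnd w : setT w -> {homo F ^~ w : n m / (n <= m)%N >-> (n <= m)%E}.
  move=> _ n m nm; rewrite lee_fin ler_expR lerB// ler_pM2r// !exprMn.
  rewrite ler_wpM2r ?sqr_ge0// lerXn2r ?nnegrE ?invr_ge0//.
  by rewrite lef_pV2 ?posrE ?ltr0n// ler_nat.
move=> /(_ F0 Fnd) /(cvg_lim (@ereal_hausdorff R)).
rewrite (eq_integral (fun w => (expR (s * X w))%:E)); last first.
  by move=> w _; exact/cvg_lim.
move=> <-; apply/cvg_lim => //.
under eq_fun do rewrite regularized_moment//.
apply: cvg_EFin; first exact: nearW.
rewrite (_ : expR _ = 2 / Num.sqrt pi * (expR (s * ln s - s) * (Num.sqrt pi / 2))).
  by apply: cvgM; [exact: cvg_cst|exact: expo_limit].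
by field; rewrite gt_eqF.
Qed.

End exp_moments_of_log_S.

Section log_S_fourier.
Context {R : realType} d (T : measurableType d) (P : probability T R).
Variable X : {RV P >-> R}.
Hypothesis X_law : log_S_law X.

Lemma log_S_fourier (l : R) : 0 <= l ->
  (\int[P]_w (cos (l * X w))%:E =
    (expR (- (pi * l / 2)) * cos (l * (ln l - 1)))%:E)%E /\
  (\int[P]_w (sin (l * X w))%:E =
    (expR (- (pi * l / 2)) * sin (l * (ln l - 1)))%:E)%E.
Proof.
move=> l0.
have mlX : measurable_fun setT (fun w => l * X w) by exact: measurable_funM.
(* [cexpectation] averages through [fine], which can be undone because these integrals are
   finite. *)
have fin (h : R -> R) : continuous h -> (forall x, -1 <= h x <= 1) ->
    (\int[P]_w (h (l * X w))%:E \is a fin_num)%E.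
  move=> ch h1; apply: integrable_fin_num => //.
  apply: (@integrable_le_bound _ _ _ P _ 1); last by move=> w; rewrite ler_norml.
  by apply: measurableT_comp => //; exact: continuous_measurable_fun.
have fc := fin _ (@continuous_cos R) (fun x => introT andP (conj (cos_geN1 x) (cos_le1 x))).
have fs := fin _ (@continuous_sin R) (fun x => introT andP (conj (sin_geN1 x) (sin_le1 x))).
have cexpE (a b : R) : cexp ('i%C * (a%:C)%C - (b%:C)%C) =
    ((expR (- b) * cos a) +i* (expR (- b) * sin a))%C.
  by rewrite /cexp/=; simpc.
have cexp0 (a : R) : cexp ('i%C * (a%:C)%C) = (cos a +i* sin a)%C.
  rewrite -[X in cexp X]subr0 (cexpE a 0) (_ : - (0 : R) = 0) ?oppr0//.
  by rewrite expR0 !mul1r.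
have := X_law l.
rewrite /char_fun /cexpectation [@expectation]unlock ger0_norm// cexpE.
under eq_integral do rewrite cexp0.
under [X in (_ +i* fine X)%C]eq_integral do rewrite cexp0.
move=> [E1 E2]; split.
  by apply: etrans (esym (fineK fc)) _; rewrite E1.
by apply: etrans (esym (fineK fs)) _; rewrite E2.
Qed.

End log_S_fourier.

(** * Gamma function, negative moments and Binet's formula *)

Section half_line.
Context {R : realType}.
Local Notation leb := (@lebesgue_measure R).
Local Notation pos := (`]0%R, +oo[%classic : set (measurableTypeR R)).

(** Indicators of the two sets are multiplied in, because the integrands met below may be negative
    off the rectangle. *)
Lemma tonelli_in d1 d2 (T1 : measurableType d1) (T2 : measurableType d2)
    (m1 : {sigma_finite_measure set T1 -> \bar R})
    (m2 : {sigma_finite_measure set T2 -> \bar R})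
    (D1 : set T1) (D2 : set T2) (f : T1 * T2 -> R) :
  measurable D1 -> measurable D2 -> measurable_fun setT f ->
  (forall x y, D1 x -> D2 y -> 0 <= f (x, y)) ->
  (\int[m1]_(x in D1) \int[m2]_(y in D2) (f (x, y))%:E =
   \int[m2]_(y in D2) \int[m1]_(x in D1) (f (x, y))%:E)%E.
Proof.
move=> mD1 mD2 mf f0.
pose g (z : T1 * T2) := (\1_D1 z.1 * (\1_D2 z.2 * f z))%:E.
have mg : measurable_fun setT g.
  apply/measurable_EFinP; apply: measurable_funM.
    by apply: measurableT_comp => //; exact: measurable_fst.
  by apply: measurable_funM => //; apply: measurableT_comp => //; exact: measurable_snd.
have g0 z : (0 <= g z)%E.
  case: z => x y; rewrite lee_fin /= !indicE.
  have [xD|_] := boolP (x \in D1); last by rewrite mul0r.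
  have [yD|_] := boolP (y \in D2); last by rewrite mul0r mulr0.
  by rewrite !mul1r f0//; exact: set_mem.
transitivity (\int[m1]_x \int[m2]_y g (x, y))%E.
  rewrite integral_mkcond; apply: eq_integral => x _.
  rewrite patchE /g/= indicE; case: ifPn => xD.
    by under [RHS]eq_integral do rewrite mul1r; rewrite integral_indicM.
  by under eq_integral do rewrite mul0r; rewrite integral0.
rewrite (fubini_tonelli g mg g0).
rewrite [RHS]integral_mkcond; apply: eq_integral => y _.
rewrite patchE /g/=.
under eq_integral do rewrite mulrCA [\1_D2 y]indicE.
case: ifPn => yD.
  by under eq_integral do rewrite mul1r; rewrite integral_indicM.
by under eq_integral do rewrite mul0r; rewrite integral0.
Qed.

Lemma lebesgue_measure_scale (a : R) (a0 : 0 < a) (A : set (measurableTypeR R)) :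
  measurable A -> (a%:E * leb ( *%R a @^-1` A) = leb A)%E.
Proof.
move=> mA.
have ma : measurable_fun setT ( *%R a : measurableTypeR R -> measurableTypeR R).
  exact: measurable_funM.
pose m : {measure set (measurableTypeR R) -> \bar R} := mscale (NngNum (ltW a0))
  (measure_function_pushforward__canonical__measure_function_Measure leb ma).
apply/esym/(@lebesgue_measure_unique R m) => // _ [[x y]] _ <-.
rewrite /m/= /mscale/= /pushforward/=.
rewrite (_ : *%R a @^-1` _ = `](x / a), (y / a)]%classic); last first.
  by apply/seteqP; split => z /=; rewrite !in_itv/= ltr_pdivrMr// ler_pdivlMr// mulrC.
rewrite !lebesgue_measure_itv/= !lte_fin ltr_pM2r ?invr_gt0//.
case: ifP => _; last by rewrite mule0.
by rewrite -!EFinB -EFinM -mulrBl mulrCA divff ?gt_eqF// mulr1.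
Qed.

Lemma integral_pos_scale (a : R) (f : R -> R) : 0 < a -> measurable_fun setT f ->
  (forall x, 0 < x -> 0 <= f x) ->
  (\int[leb]_(x in `]0%R, +oo[) (f x)%:E =
   a%:E * \int[leb]_(x in `]0%R, +oo[) (f (a * x))%:E)%E.
Proof.
move=> a0 mf f0.
have ma : measurable_fun setT ( *%R a : measurableTypeR R -> measurableTypeR R).
  exact: measurable_funM.
pose p := measure_function_pushforward__canonical__measure_function_Measure leb ma.
have f0' (x : R) : `]0%R, +oo[%classic x -> (0 <= (f x)%:E)%E.
  by rewrite /= in_itv/= andbT => x0; rewrite lee_fin f0.
have mf' : measurable_fun pos (fun x => (f x)%:E).
  by apply/measurable_EFinP; exact: measurable_funTS.
transitivity (\int[mscale (NngNum (ltW a0)) p]_(x in `]0%R, +oo[) (f x)%:E)%E.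
  apply: eq_measure_integral => A mA _.
  exact/esym/(lebesgue_measure_scale a0 mA).
rewrite ge0_integral_mscale//; congr (_ * _)%E.
rewrite (ge0_integral_pushforward ma)//; last by move=> y /set_mem; exact: f0'.
congr (integral _ _ _); apply/seteqP; split => x /=; rewrite !in_itv/= !andbT.
  by rewrite pmulr_rgt0.
by rewrite pmulr_rgt0.
Qed.

End half_line.

Section gamma_function.
Context {R : realType}.
Local Notation leb := (@lebesgue_measure R).
Local Notation pos := (`]0%R, +oo[%classic : set (measurableTypeR R)).

(** Extended-valued, so that Tonelli's theorem can be used on it before finiteness is known. *)
Definition gammaE (s : R) : \bar R :=
  (\int[leb]_(t in `]0%R, +oo[) (t `^ (s - 1) * expR (- t))%:E)%E.

Lemma measurable_ltM d (T : measurableType d) (f g h : T -> R) :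
  measurable_fun setT f -> measurable_fun setT g -> measurable_fun setT h ->
  measurable_fun setT (fun x => (f x < g x)%R%:R * h x).
Proof.
move=> mf mg mh; apply: measurable_funM => //.
apply: (measurableT_comp (f := fun b : bool => b%:R : R)) => //.
exact: measurable_fun_ltr.
Qed.

Lemma integral_ltM (c k : R) : 0 <= c -> 0 <= k ->
  (\int[leb]_(x in `]0%R, +oo[) ((x < c)%R%:R * k)%:E = (c * k)%:E)%E.
Proof.
move=> c0 k0.
transitivity (\int[leb]_(x in `]0%R, c[) (cst k%:E x))%E.
  rewrite [LHS]integral_mkcond [RHS]integral_mkcond; apply: eq_integral => x _.
  rewrite !patchE /=; have [xp|xp] := boolP (x \in _).
    rewrite inE/= in_itv/= andbT in xp; rewrite (_ : (x \in _) = (x < c)).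
      by case: ifPn => _; rewrite ?mul1r ?mul0r.
    by apply/idP/idP; rewrite inE/= in_itv/= xp.
  case: ifPn => // xc; case/negP: xp; move: xc; rewrite !inE/= !in_itv/= andbT.
  by case/andP.
rewrite integral_cst//= lebesgue_measure_itv/= lte_fin -EFinB subr0.
case: ltgtP c0 => // [_ _|<- _]; last by rewrite mule0 mul0r.
by rewrite -EFinM mulrC.
Qed.

Lemma integral_expRN_gt (a : R) : 0 <= a ->
  (\int[leb]_(t in `]0%R, +oo[) ((a < t)%R%:R * expR (- t))%:E = (expR (- a))%:E)%E.
Proof.
move=> a0; rewrite -integral_expRN_tail -integral_itv_obnd_cbnd; last first.
  by apply/measurable_EFinP; apply: measurableT_comp => //; exact: measurable_funTS.
rewrite [LHS]integral_mkcond [RHS]integral_mkcond; apply: eq_integral => x _.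
rewrite !patchE /=; have [xp|xp] := boolP (x \in _).
  rewrite inE/= in_itv/= andbT in xp; rewrite (_ : (x \in _) = (a < x)).
    by case: ifPn => _; rewrite ?mul1r ?mul0r.
  by apply/idP/idP; rewrite inE/= in_itv/= andbT.
case: ifPn => // xc; case/negP: xp; move: xc; rewrite !inE/= !in_itv/= !andbT.
exact: le_lt_trans.
Qed.

Lemma measurable_powR2 d (T : measurableType d) (f : T -> R) (p : R) :
  measurable_fun setT f -> measurable_fun setT (fun x => f x `^ p).
Proof. by move=> mf; exact: (measurableT_comp (measurable_powR p)). Qed.

Lemma ltr_powR_swap (r x t : R) : 0 < r -> 0 < x -> 0 < t ->
  (x < t `^ r) = (x `^ r^-1 < t).
Proof.
move=> r0 x0 t0; have ri : 0 < r^-1 by rewrite invr_gt0.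
apply/idP/idP => h.
  have := gt0_ltr_powR ri (ltW x0) (powR_ge0 t r) h.
  by rewrite -powRrM divff ?gt_eqF// powRr1// ltW.
have := gt0_ltr_powR r0 (powR_ge0 x r^-1) (ltW t0) h.
by rewrite -powRrM mulVf ?gt_eqF// powRr1// ltW.
Qed.

(** Layer cake: [t^r] is the length of the set of [x < t^r], that is [x^(1/r) < t], and Tonelli
    leaves the exponential tail from [x^(1/r)]. This form can be matched with a Laplace transform of
    type [e^(- l^al)]. *)
Lemma gammaE_layer (r : R) : 0 < r ->
  gammaE (1 + r) = (\int[leb]_(x in `]0%R, +oo[) (expR (- (x `^ r^-1)))%:E)%E.
Proof.
move=> r0.
transitivity (\int[leb]_(t in `]0%R, +oo[)
  \int[leb]_(x in `]0%R, +oo[) ((x < t `^ r)%R%:R * expR (- t))%:E)%E.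
  apply: eq_integral => t _; rewrite integral_ltM ?powR_ge0 ?expR_ge0//.
  by rewrite addrAC subrr add0r.
rewrite (@tonelli_in _ _ _ _ _ leb leb _ _
  (fun z : measurableTypeR R * measurableTypeR R => (z.2 < z.1 `^ r)%R%:R * expR (- z.1)))//=.
- apply: eq_integral => x; rewrite inE/= in_itv/= andbT => x0.
  rewrite -integral_expRN_gt ?powR_ge0//; apply: eq_integral => t.
  by rewrite inE/= in_itv/= andbT => t0; rewrite ltr_powR_swap.
- apply: measurable_ltM => //; first exact: measurable_powR2.
  by apply: measurableT_comp => //; exact: measurableT_comp.
Qed.

(* The integral over [x] of [e^(- x^(1/q) z)] is [gammaE (1 + q) z^(-q)], and
   its expectation at [z = f w] is computed from the Laplace transform of [f]. *)
Lemma neg_moment_of_laplace d (T : measurableType d) (P : probability T R)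
    (f : T -> R) (al q : R) : 0 < al -> 0 < q ->
  measurable_fun setT f -> (forall w, 0 < f w) ->
  (forall l, 0 <= l ->
     (\int[P]_w (expR (- (l * f w)))%:E = (expR (- (l `^ al)))%:E)%E) ->
  (gammaE (1 + q / al) = gammaE (1 + q) * \int[P]_w (f w `^ (- q))%:E)%E.
Proof.
move=> al0 q0 mf f0 lap.
rewrite gammaE_layer ?divr_gt0// invf_div.
transitivity (\int[leb]_(x in `]0%R, +oo[) \int[P]_w (expR (- (x `^ q^-1 * f w)))%:E)%E.
  apply: eq_integral => x _; rewrite (lap _ (powR_ge0 _ _)).
  by rewrite -powRrM [q^-1 * _]mulrC.
rewrite (@tonelli_in _ _ _ _ _ leb P `]0%R, +oo[ setT
  (fun z : measurableTypeR R * T => expR (- (z.1 `^ q^-1 * f z.2))))//=; last first.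
  apply: measurableT_comp => //; apply: measurableT_comp => //.
  by apply: measurable_funM; [exact: measurable_powR2|exact: measurableT_comp].
rewrite -ge0_integralZl//; last 3 first.
- by apply/measurable_EFinP; exact: measurable_powR2.
- by move=> w _; rewrite lee_fin powR_ge0.
- by apply: integral_ge0 => t _; rewrite lee_fin mulr_ge0 ?powR_ge0 ?expR_ge0.
apply: eq_integral => w _; rewrite gammaE_layer//.
have fq : 0 < f w `^ (- q) by rewrite powR_gt0.
rewrite (@integral_pos_scale R (f w `^ (- q)) (fun x => expR (- (x `^ q^-1 * f w)))) //.
- rewrite muleC; congr (_ * _)%E; apply: eq_integral => x.
  rewrite inE/= in_itv/= andbT => x0.
  rewrite powRM ?ltW// -powRrM mulNr divff ?gt_eqF// powR_inv1 ?ltW//.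
  by rewrite mulrAC mulVf ?gt_eqF// mul1r.
- apply: measurableT_comp => //; apply: measurableT_comp => //.
  by apply: measurable_funM => //; exact: measurable_powR2.
Qed.

(** From [ln u < u] at [u = t / (2 r)]. Half of the decay of [e^(- t)] remains for integrability. *)
Lemma powR_le_expR (r t : R) : 0 < r -> 0 < t ->
  t `^ r <= (2 * r) `^ r * expR (t / 2).
Proof.
move=> r0 t0; have r20 : 0 < 2 * r by rewrite mulr_gt0.
have r20' := ltW r20; have tr : 0 <= t / (2 * r) by rewrite divr_ge0// ltW.
have -> : t `^ r = (2 * r) `^ r * (t / (2 * r)) `^ r.
  by rewrite -powRM// mulrC divfK// gt_eqF.
rewrite ler_pM2l ?powR_gt0// /powR gt_eqF ?divr_gt0// ler_expR.
have /ltW := ln_sublinear (divr_gt0 t0 r20); rewrite -(ler_pM2l r0) => /le_trans; apply.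
by rewrite le_eqVlt; apply/orP; left; apply/eqP; field; rewrite gt_eqF.
Qed.

Lemma gammaE_fin (r : R) : 0 < r -> gammaE (1 + r) \is a fin_num.
Proof.
move=> r0; have C0 : 0 <= (2 * r) `^ r by exact: powR_ge0.
have p0 (t : R) : 0 <= t `^ (1 + r - 1) * expR (- t).
  by rewrite mulr_ge0 ?powR_ge0 ?expR_ge0.
rewrite ge0_fin_numE; last by apply: integral_ge0 => t _; rewrite lee_fin p0.
have mh (c : R) : measurable_fun setT (fun t : R => expR (- (c * t))).
  apply: measurableT_comp => //; apply: measurableT_comp => //.
apply: (@le_lt_trans _ _ (\int[leb]_(t in `]0%R, +oo[)
    (((2 * r) `^ r)%:E * (expR (- (2^-1 * t)))%:E))%E).
  apply: ge0_le_integral => //.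
  - by move=> t _; rewrite lee_fin p0.
  - apply/measurable_EFinP; apply: measurable_funTS; apply: measurable_funM.
      exact: measurable_powR2.
    by apply: measurableT_comp => //; exact: measurableT_comp.
  - apply/measurable_EFinP; apply: measurable_funTS.
    by apply: measurable_funM => //; exact: mh.
  - move=> t; rewrite /= in_itv/= andbT => t0; rewrite lee_fin.
    rewrite (_ : 1 + r - 1 = r); last by ring.
    rewrite (_ : - (2^-1 * t) = t / 2 - t); last by field.
    by rewrite expRD mulrA ler_wpM2r ?expR_ge0// powR_le_expR.
rewrite ge0_integralZl//; last first.
  by apply/measurable_EFinP; exact: measurable_funTS (mh _).
have h20 : 0 < 2^-1 :> R by rewrite invr_gt0.
have m1 : measurable_fun setT (fun t : R => expR (- t)).
  by apply: measurableT_comp => //; exact: measurableT_comp.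
have := @integral_pos_scale R 2^-1 (fun t => expR (- t)) h20 m1 (fun _ _ => expR_ge0 _).
rewrite integral_itv_obnd_cbnd; last by apply/measurable_EFinP; exact: measurable_funTS.
rewrite integral_expRN_tail oppr0 expR0.
set I := (\int[_]_(_ in _) _)%E; case: I => [x _|/esym|/esym].
- by rewrite -EFinM ltry.
- by rewrite gt0_muley.
- by rewrite gt0_muleNy.
Qed.

Lemma gammaE_gt0 (r : R) : 0 < r -> (0 < gammaE (1 + r))%E.
Proof.
move=> r0; apply: (@lt_le_trans _ _ (\int[leb]_(t in `]1%R, 2%R]) (cst (expR (- 2))%:E t))%E).
  rewrite integral_cst//= lebesgue_measure_itv/= lte_fin ltr1n -EFinB.
  by rewrite -EFinM lte_fin mulr_gt0 ?expR_gt0// subr_gt0 ltr1n.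
apply: (@le_trans _ _ (\int[leb]_(t in `]1%R, 2%R]) (t `^ (1 + r - 1) * expR (- t))%:E)%E).
  apply: ge0_le_integral => //.
  - by move=> t _; rewrite lee_fin expR_ge0.
  - apply/measurable_EFinP; apply: measurable_funTS; apply: measurable_funM.
      exact: measurable_powR2.
    by apply: measurableT_comp => //; exact: measurableT_comp.
  - move=> t; rewrite /= in_itv/= => /andP[t1 t2]; rewrite lee_fin.
    rewrite -[leLHS]mul1r ler_pM ?expR_ge0 ?ler_expR ?lerN2//.
    have t1' := ltW t1; have t0' : 0 <= t := le_trans ler01 t1'.
    rewrite (_ : 1 + r - 1 = r); last by ring.
    by rewrite -[X in X <= _](congr1 (fun f => f r) (powR1 R)) ge0_ler_powR ?nnegrE// ltW.
apply: ge0_subset_integral => //.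
- apply/measurable_EFinP; apply: measurable_funTS; apply: measurable_funM.
    exact: measurable_powR2.
  by apply: measurableT_comp => //; exact: measurableT_comp.
- by move=> t _; rewrite lee_fin mulr_ge0 ?powR_ge0 ?expR_ge0.
- move=> t /=; rewrite !in_itv/= andbT => /andP[t1 _].
  exact: lt_trans t1.
Qed.

Lemma powR_continuous (p x : R) : 0 < x -> {for x, continuous (@powR R ^~ p)}.
Proof.
move=> x0; apply: differentiable_continuous; apply/derivable1_diffP.
by apply: derivable_powR; rewrite in_itv/= andbT.
Qed.

Lemma powR_cvg_at (r t : R) : 0 <= t -> 0 < r -> x `^ r @[x --> t^'+] --> t `^ r.
Proof.
rewrite le_eqVlt => /predU1P[<-|t0] r0.
  by rewrite powR0 ?gt_eqF//; exact: powR_cvg0.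
by apply: cvg_at_right_filter; exact: (@powR_continuous r t).
Qed.

Lemma integral_powR_lt (r t : R) : 0 < r -> 0 < t ->
  (\int[leb]_(x in `]0%R, +oo[) ((x < t)%R%:R * ((1 + r) * x `^ r))%:E =
   (t `^ (1 + r))%:E)%E.
Proof.
move=> r0 t0; have r10 : 0 < 1 + r by rewrite addr_gt0.
have mr : measurable_fun setT (fun x : R => (1 + r) * x `^ r).
  by apply: measurable_funM => //; exact: measurable_powR2.
transitivity (\int[leb]_(x in `]0%R, t[) ((1 + r) * x `^ r)%:E)%E.
  rewrite [LHS]integral_mkcond [RHS]integral_mkcond; apply: eq_integral => x _.
  rewrite !patchE /=; have [xp|xp] := boolP (x \in _).
    rewrite inE/= in_itv/= andbT in xp; rewrite (_ : (x \in _) = (x < t)).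
      by case: ifPn => _; rewrite ?mul1r ?mul0r.
    by apply/idP/idP; rewrite inE/= in_itv/= xp.
  case: ifPn => // xc; case/negP: xp; move: xc; rewrite !inE/= !in_itv/= andbT.
  by case/andP.
rewrite -(@integral_itv_bndoo _ _ _ _ true false); last first.
  by apply/measurable_EFinP; exact: measurable_funTS.
have dp (x : R) : 0 < x -> derivable (@powR R ^~ (1 + r)) x 1.
  by move=> x0; apply: derivable_powR; rewrite in_itv/= andbT.
rewrite (@continuous_FTC2 _ _ (@powR R ^~ (1 + r)))//.
- by rewrite powR0 ?gt_eqF// sube0.
- apply/continuous_within_itvP => //; split.
  + move=> x; rewrite in_itv/= => /andP[x0 _].
    by apply: cvgM; [exact: cvg_cst|exact: powR_continuous].
  + by apply: cvgM; [exact: cvg_cst|exact: powR_cvg_at].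
  + apply: cvgM; first exact: cvg_cst.
    by apply: cvg_at_left_filter; exact: powR_continuous.
- split.
  + by move=> x; rewrite in_itv/= => /andP[x0 _]; exact: dp.
  + exact: powR_cvg_at.
  + by apply: cvg_at_left_filter; exact: powR_continuous.
- move=> x; rewrite in_itv/= => /andP[x0 _].
  rewrite powR_derive1 ?in_itv/= ?andbT//; congr (_ * _ `^ _); ring.
Qed.

(** Tonelli in place of integration by parts: [t^(1 + r)] is the integral of [(1 + r) x^r] over
    [x < t], and [e^(- x)] is the integral of [e^(- t)] over [t > x]. *)
Lemma gammaES (r : R) : 0 < r -> (gammaE (2 + r) = (1 + r)%:E * gammaE (1 + r))%E.
Proof.
move=> r0; have r10 : 0 < 1 + r by rewrite addr_gt0.
transitivity (\int[leb]_(t in `]0%R, +oo[) \int[leb]_(x in `]0%R, +oo[)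
    ((x < t)%R%:R * (((1 + r) * x `^ r) * expR (- t)))%:E)%E.
  apply: eq_integral => t; rewrite inE/= in_itv/= andbT => t0.
  rewrite (_ : 2 + r - 1 = 1 + r); last by ring.
  rewrite EFinM -integral_powR_lt// muleC -ge0_integralZl//.
  - by apply: eq_integral => x _; rewrite -EFinM; congr EFin; ring.
  - apply/measurable_EFinP; apply: measurable_funTS; apply: measurable_ltM => //.
    by apply: measurable_funM => //; exact: measurable_powR2.
  - by move=> x _; rewrite lee_fin !mulr_ge0 ?powR_ge0// ltW.
rewrite (@tonelli_in _ _ _ _ _ leb leb _ _
  (fun z : measurableTypeR R * measurableTypeR R =>
     (z.2 < z.1)%R%:R * (((1 + r) * z.2 `^ r) * expR (- z.1))))//=.
- rewrite /gammaE -ge0_integralZl//.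
  + apply: eq_integral => x; rewrite inE/= in_itv/= andbT => x0.
    rewrite (_ : 1 + r - 1 = r); last by ring.
    rewrite -EFinM mulrA EFinM -(integral_expRN_gt (ltW x0)) -ge0_integralZl//.
    * by apply: eq_integral => t _; rewrite -EFinM; congr EFin; ring.
    * apply/measurable_EFinP; apply: measurable_funTS; apply: measurable_ltM => //.
      by apply: measurableT_comp => //; exact: measurableT_comp.
    * by rewrite lee_fin !mulr_ge0 ?powR_ge0// ltW.
  + apply/measurable_EFinP; apply: measurable_funTS; apply: measurable_funM.
      exact: measurable_powR2.
    by apply: measurableT_comp => //; exact: measurableT_comp.
  + by move=> x _; rewrite lee_fin mulr_ge0 ?powR_ge0 ?expR_ge0.
  + by rewrite lee_fin ltW.
- apply: measurable_ltM => //; apply: measurable_funM.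
    by apply: measurable_funM => //; exact: measurable_powR2.
  by apply: measurableT_comp => //; exact: measurableT_comp.
- by move=> x y _ _; rewrite !mulr_ge0 ?powR_ge0 ?expR_ge0// ltW.
Qed.

End gamma_function.

(** * The kernel of Binet's formula and its Laplace transform *)

Section binet_kernel.
Context {R : realType}.

Lemma ndecr_of_derive (f df : R -> R) (a b : R) : a <= b ->
  (forall x, a <= x <= b -> is_derive x 1 f (df x)) ->
  (forall x, a <= x <= b -> 0 <= df x) -> f a <= f b.
Proof.
move=> ab fd df0.
have d1 (x : R) : x \in `]a, b[ -> is_derive x 1 f (df x).
  by rewrite in_itv/= => /andP[ax xb]; apply: fd; rewrite !ltW.
have c1 : {within `[a, b], continuous f}.
  apply: derivable_within_continuous => x; rewrite in_itv/= => xab.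
  by have [] := fd x xab.
have [x xab] := MVT_segment ab d1 c1.
move=> h; rewrite -subr_ge0 h mulr_ge0 ?subr_ge0//; apply: df0.
by move: xab; rewrite in_itv.
Qed.

(* The kernel of Binet's formula
   [ln Gamma(1 + t) = (t + 1/2) ln t - t + ln (2 pi) / 2 + int e^(-t x) phi(x) / x dx]. *)
Definition binet_phi (x : R) : R := 2^-1 - x^-1 + (expR x - 1)^-1.

Lemma expRB1_gt0 (x : R) : 0 < x -> 0 < expR x - 1.
Proof. by move=> x0; rewrite subr_gt0 expR_gt1. Qed.

Lemma binet_phi_ge0 (x : R) : 0 < x -> 0 <= binet_phi x.
Proof.
move=> x0; have e0 := expRB1_gt0 x0.
rewrite (_ : binet_phi x = ((x - 2) * expR x + x + 2) / (2 * x * (expR x - 1))); last first.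
  by rewrite /binet_phi; field; rewrite !gt_eqF.
rewrite divr_ge0//; last by rewrite !mulr_ge0// ltW.
have := @ndecr_of_derive (fun x => (x - 2) * expR x + x + 2)
  (fun x => (x - 1) * expR x + 1) 0 x (ltW x0).
rewrite expR0 (_ : _ + 2 = 0); last by ring.
apply.
  move=> y _; apply: (drv_eq (drvD (drvD (drvM (drvD (drv_id y) (drv_cst (- 2) y))
   (drv_exp (drv_id y))) (drv_id y)) (drv_cst 2 y))).
  by ring.
move=> y _; have := expR_ge1Dx (- y); rewrite expRN.
have e1 := expR_gt0 y; rewrite -(ler_pM2r e1) mulVf ?gt_eqF//.
by move=> h; rewrite -subr_ge0 in h; apply: le_trans h _; rewrite le_eqVlt; apply/orP; left; apply/eqP; ring.
Qed.

(** Bounds [binet_phi x / x] by [1 / 4], hence its Laplace transform at [t] by [1 / (4 t)]. The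
    estimate comes from [e^x - 1 >= x + x^2 / 2]. *)
Lemma binet_phi_le (x : R) : 0 < x -> binet_phi x <= x / 4.
Proof.
move=> x0; have e0 := expRB1_gt0 x0.
have h : x + x ^+ 2 / 2 <= expR x - 1.
  have := @expR_psum_le R x 3 (ltW x0).
  rewrite !big_ord_recr big_ord0/= add0r expr0 expr1 divr1 !factS fact0 !muln1.
  by rewrite divr1 -addrA -lerBrDl.
have p0 : 0 < x + x ^+ 2 / 2 by rewrite addr_gt0 ?divr_gt0 ?exprn_gt0.
apply: (@le_trans _ _ (2^-1 - x^-1 + (x + x ^+ 2 / 2)^-1)).
  by rewrite lerD2l lef_pV2.
rewrite (_ : _ + _ = x / (2 * (2 + x))); last first.
  by field; rewrite !gt_eqF ?addr_gt0 ?mulr_gt0//.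
rewrite ler_pM2l// lef_pV2 ?posrE ?mulr_gt0 ?addr_gt0//.
by lra.
Qed.

(** The derivative is nonnegative exactly when [z e^(z / 2) <= e^z - 1], that is
    [z <= 2 sinh(z / 2)]. This monotonicity is the source of the positivity of [levy_psi]. *)
Lemma binet_phi_ndecr (x y : R) : 0 < x -> x <= y -> binet_phi x <= binet_phi y.
Proof.
move=> x0 xy.
apply: (@ndecr_of_derive binet_phi (fun z => z ^- 2 - (expR z - 1) ^- 2 * expR z) x y xy).
  move=> z /andP[xz _]; have z0 : 0 < z := lt_le_trans x0 xz.
  have e0 := expRB1_gt0 z0.
  have zn : z != 0 by rewrite gt_eqF.
  have en : expR z - 1 != 0 by rewrite gt_eqF.
  apply: (drv_eq (drvD (drvD (drv_cst 2^-1 z) (drvN (drvV (f := fun z => z) zn (drv_id z))))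
    (drvV (f := fun z => expR z - 1) en (drvD (drv_exp (drv_id z)) (drv_cst (- 1) z))))).
  by rewrite /=; ring.
move=> z /andP[xz _]; have z0 : 0 < z := lt_le_trans x0 xz.
have e0 := expRB1_gt0 z0.
have sh (u : R) : 0 <= u -> 2 * u <= expR u - expR (- u).
  move=> u0.
  have := @ndecr_of_derive (fun u => expR u - expR (- u) - 2 * u)
    (fun u => expR u + expR (- u) - 2) 0 u u0.
  rewrite oppr0 expR0 mulr0 !subrr subr_ge0; apply.
    move=> v _; apply: (drv_eq (drvD (drvD (drv_exp (drv_id v)) (drvN (drv_exp (drvN (drv_id v)))))
      (drvN (drvM (drv_cst 2 v) (drv_id v))))).
    by ring.
  by move=> v _; have := expR_ge1Dx v; have := expR_ge1Dx (- v); lra.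
have h2 : 0 <= z / 2 by rewrite divr_ge0// ltW.
pose a := expR (z / 2).
have za : z <= a - a^-1.
  by have := sh _ h2; rewrite expRN [2 * _]mulrC divfK.
have a0 : 0 < a by exact: expR_gt0.
have ea : expR z = a ^+ 2 by rewrite /a -expRM_natl; congr expR; field.
have h3 : z * a <= a ^+ 2 - 1.
  have -> : a ^+ 2 - 1 = (a - a^-1) * a by field; rewrite gt_eqF.
  by rewrite ler_pM2r.
rewrite subr_ge0 ea mulrC ler_pdivrMr ?exprn_gt0//; last by rewrite -ea.
rewrite mulrC ler_pdivlMr ?exprn_gt0//.
by rewrite -exprMn mulrC lerXn2r ?nnegrE ?mulr_ge0 ?(ltW z0) ?(ltW a0)// -ea ltW.
Qed.

End binet_kernel.

Section binet_integral.
Context {R : realType}.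
Local Notation leb := (@lebesgue_measure R).

Lemma measurable_funV d (T : measurableType d) (f : T -> R) :
  measurable_fun setT f -> measurable_fun setT (fun x => (f x)^-1).
Proof.
(* Writing [1 / f] as [f |f|^(-2)] reduces to real powers; where [f] vanishes both sides are 0 by
   the convention [0^-1 = 0]. *)
move=> mf; rewrite (_ : (fun x => _) = fun x => f x * (`|f x| `^ (-1)) ^+ 2).
  apply: measurable_funM => //; apply: measurable_funX.
  by apply: measurable_powR2; exact: measurableT_comp.
apply/funext => x; rewrite powR_inv1// exprVn real_normK ?num_real//.
by have [->|f0] := eqVneq (f x) 0; [rewrite invr0 mul0r|rewrite expr2 invfM mulrA divff// mul1r].
Qed.

Lemma measurable_binet_phi : measurable_fun setT (@binet_phi R).
Proof.
apply: measurable_funD; first by apply: measurable_funB => //; exact: measurable_funV.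
by apply: measurable_funV; exact: measurable_funB.
Qed.

Lemma measurable_expNM (t : R) : measurable_fun setT (fun x : R => expR (- (t * x))).
Proof.
apply: measurableT_comp => //; apply: measurableT_comp => //.
Qed.

Definition binet_muE (t : R) : \bar R :=
  (\int[leb]_(x in `]0%R, +oo[) (expR (- (t * x)) * (binet_phi x / x))%:E)%E.

Let measurable_mu (t : R) : measurable_fun setT (fun x : R => expR (- (t * x)) * (binet_phi x / x)).
Proof.
apply: measurable_funM; first exact: measurable_expNM.
by apply: measurable_funM; [exact: measurable_binet_phi|exact: measurable_funV].
Qed.

Let mu_ge0 (t x : R) : 0 < x -> 0 <= expR (- (t * x)) * (binet_phi x / x).
Proof. by move=> x0; rewrite mulr_ge0 ?expR_ge0 ?divr_ge0 ?binet_phi_ge0// ltW. Qed.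

Lemma integral_expNM (t : R) : 0 < t ->
  (\int[leb]_(x in `]0%R, +oo[) (expR (- (t * x)))%:E = (t^-1)%:E)%E.
Proof.
move=> t0; have m1 : measurable_fun setT (fun x : R => expR (- x)).
  by apply: measurableT_comp => //; exact: measurableT_comp.
have := @integral_pos_scale R t (fun x => expR (- x)) t0 m1 (fun _ _ => expR_ge0 _).
rewrite integral_itv_obnd_cbnd; last by apply/measurable_EFinP; exact: measurable_funTS.
rewrite integral_expRN_tail oppr0 expR0 => h.
have : (t^-1%:E * 1 = t^-1%:E * (t%:E *
   \int[leb]_(x in `]0%R, +oo[) (expR (- (t * x)))%:E))%E by rewrite {1}h.
by rewrite mule1 muleA -EFinM mulVf ?gt_eqF// mul1e => <-.
Qed.

Lemma integral_xexpNM (t : R) : 0 < t ->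
  (\int[leb]_(x in `]0%R, +oo[) (x * expR (- (t * x)))%:E = (t ^- 2)%:E)%E.
Proof.
move=> t0; have m1 : measurable_fun setT (fun x : R => x * expR (- x)).
  apply: measurable_funM => //.
  by apply: measurableT_comp => //; exact: measurableT_comp.
have p1 (x : R) : 0 < x -> 0 <= x * expR (- x).
  by move=> x0; rewrite mulr_ge0 ?expR_ge0// ltW.
have := @integral_pos_scale R t (fun x => x * expR (- x)) t0 m1 p1.
have -> : (\int[leb]_(x in `]0%R, +oo[) (x * expR (- x))%:E = 1)%E.
  have := @gammaE_layer R 1 ltr01; rewrite /gammaE invr1.
  under eq_integral => x.
    rewrite inE/= in_itv/= andbT => x0.
    rewrite (_ : 1 + 1 - 1 = 1) ?powRr1 ?(ltW x0)//; last by ring.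
    over.
  move=> ->.
  under eq_integral => x.
    rewrite inE/= in_itv/= andbT => x0.
    rewrite powRr1 ?(ltW x0)// -[x in expR (- x)]mul1r.
    over.
  by rewrite integral_expNM// invr1.
under eq_integral do rewrite -mulrA EFinM.
rewrite ge0_integralZl//; last 3 first.
- apply/measurable_EFinP; apply: measurable_funTS.
  by apply: measurable_funM => //; exact: measurable_expNM.
- by move=> x; rewrite /= in_itv/= andbT => x0; rewrite lee_fin mulr_ge0 ?expR_ge0// ltW.
- by rewrite lee_fin ltW.
move=> h.
have : ((t ^- 2)%:E * 1 = (t ^- 2)%:E * (t%:E * (t%:E *
   \int[leb]_(x in `]0%R, +oo[) (x * expR (- (t * x)))%:E)))%E by rewrite {1}h.
rewrite mule1 !muleA -!EFinM (_ : t ^- 2 * t * t = 1) ?mul1e => [<-//|].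
by field; rewrite gt_eqF.
Qed.

Lemma binet_muE_ge0 (t : R) : (0 <= binet_muE t)%E.
Proof.
apply: integral_ge0 => x; rewrite /= in_itv/= andbT => x0.
by rewrite lee_fin mu_ge0.
Qed.

Lemma binet_muE_le (t : R) : 0 < t -> (binet_muE t <= ((4 * t)^-1)%:E)%E.
Proof.
move=> t0; apply: (@le_trans _ _
  (\int[leb]_(x in `]0%R, +oo[) ((4^-1)%:E * (expR (- (t * x)))%:E))%E); last first.
  rewrite ge0_integralZl//.
  - by rewrite integral_expNM// -EFinM invfM.
  - by apply/measurable_EFinP; apply: measurable_funTS; exact: measurable_expNM.
apply: ge0_le_integral => //.
- by move=> x; rewrite /= in_itv/= andbT => x0; rewrite lee_fin mu_ge0.
- by apply/measurable_EFinP; apply: measurable_funTS; exact: measurable_mu.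
- apply/measurable_EFinP; apply: measurable_funTS; apply: measurable_funM => //.
  exact: measurable_expNM.
- move=> x; rewrite /= in_itv/= andbT => x0; rewrite lee_fin mulrC.
  by rewrite ler_wpM2r ?expR_ge0// ler_pdivrMr// mulrC binet_phi_le.
Qed.

(** [u (1 - u) / 2] is the Peano kernel of the trapezoidal rule on [[0, 1]], and the value is the
    error of that rule for [e^(- u x) / x]. In [trapezoid_log] the same kernel gives the error for
    [- ln (t + u)]. *)
Let trapezoid_kernel (x : R) : 0 < x ->
  (\int[leb]_(u in `[0%R, 1%R]) (u * (1 - u) / 2 * (x * expR (- (u * x))))%:E =
   ((1 - expR (- x)) * (binet_phi x / x))%:E)%E.
Proof.
move=> x0.
pose F (u : R) := (- (u * (1 - u)) / 2 + u / x + x ^- 2 - (2 * x)^-1) * expR (- (u * x)).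
have dF (u : R) : is_derive u 1 F (u * (1 - u) / 2 * (x * expR (- (u * x)))).
  apply: (drv_eq (drvM (drvD (drvD (drvD (drvM (drvN (drvM (drv_id u)
    (drvD (drv_cst 1 u) (drvN (drv_id u))))) (drv_cst 2^-1 u))
    (drvM (drv_id u) (drv_cst x^-1 u))) (drv_cst (x ^- 2) u)) (drv_cst (- (2 * x)^-1) u))
    (drv_exp (drvN (drvM (drv_id u) (drv_cst x u)))))).
  by rewrite /=; field; rewrite gt_eqF.
have cF (u : R) : {for u, continuous F} := drv_continuous (dF u).
rewrite (@continuous_FTC2 _ _ F)//.
- rewrite -EFinB; congr EFin; rewrite /F /binet_phi (_ : - (0 * x) = 0) ?mul0r ?oppr0// expR0 (_ : 1 * x = x) ?mul1r// expRN.
  have := expRB1_gt0 x0; have := expR_gt0 x; move: (expR x) => e e0 e1.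
  by field; rewrite !gt_eqF.
- apply: continuous_subspaceT => u.
  exact: drv_continuous (drvM (drvM (drvM (drv_id u)
    (drvD (drv_cst 1 u) (drvN (drv_id u)))) (drv_cst 2^-1 u))
    (drvM (drv_cst x u) (drv_exp (drvN (drvM (drv_id u) (drv_cst x u)))))).
- split.
  + by move=> u _; have [] := dF u.
  + exact: cvg_at_right_filter (cF _).
  + exact: cvg_at_left_filter (cF _).
- by move=> u _; rewrite derive1E; have [] := dF u.
Qed.

Let trapezoid_log (t : R) : 0 < t ->
  (\int[leb]_(u in `[0%R, 1%R]) (u * (1 - u) / 2 / (t + u) ^+ 2)%:E =
   ((t + 2^-1) * ln ((t + 1) / t) - 1)%:E)%E.
Proof.
move=> t0.
pose F (u : R) := - (t + u) / 2 + (t + 2^-1) * ln (t + u) + t * (1 + t) / 2 * (t + u)^-1.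
have tu (u : R) : 0 <= u -> 0 < t + u by move=> u0; rewrite ltr_wpDr.
have dtu (u : R) : is_derive u 1 (fun u => t + u) (0 + 1) := drvD (drv_cst t u) (drv_id u).
have dF (u : R) : 0 <= u -> is_derive u 1 F (u * (1 - u) / 2 / (t + u) ^+ 2).
  move=> u0; have tun : t + u != 0 by rewrite gt_eqF ?tu.
  apply: (drv_eq (drvD (drvD (drvM (drvN (dtu u)) (drv_cst 2^-1 u))
    (drvM (drv_cst (t + 2^-1) u) (drv_ln (f := fun u => t + u) (tu u u0) (dtu u))))
    (drvM (drv_cst (t * (1 + t) / 2) u) (drvV (f := fun u => t + u) tun (dtu u))))).
  by rewrite /=; field.
have cF (u : R) : 0 <= u -> {for u, continuous F}.
  by move=> u0; exact: drv_continuous (dF u u0).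
have cf (u : R) : 0 <= u -> {for u, continuous (fun u : R => u * (1 - u) / 2 / (t + u) ^+ 2)}.
  move=> u0; have tun : (t + u) ^+ 2 != 0 by rewrite expf_neq0// gt_eqF ?tu.
  exact: drv_continuous (drvM (drvM (drvM (drv_id u) (drvD (drv_cst 1 u)
    (drvN (drv_id u)))) (drv_cst 2^-1 u)) (drvV (f := fun u => (t + u) ^+ 2) tun (drvX 2 (dtu u)))).
rewrite (@continuous_FTC2 _ _ F)//.
- rewrite -EFinB; congr EFin; rewrite /F addr0 ln_div ?posrE ?addr_gt0//.
  by field; rewrite !gt_eqF ?addr_gt0.
- apply/continuous_within_itvP => //; split.
  + by move=> u; rewrite in_itv/= => /andP[u0 _]; apply: cf; exact: ltW.
  + exact: cvg_at_right_filter (cf _ _).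
  + exact: cvg_at_left_filter (cf _ _).
- split.
  + by move=> u; rewrite in_itv/= => /andP[u0 _]; have [] := dF u (ltW u0).
  + exact: cvg_at_right_filter (cF _ _).
  + exact: cvg_at_left_filter (cF _ _).
- by move=> u; rewrite in_itv/= => /andP[u0 _]; rewrite derive1E; have [] := dF u (ltW u0).
Qed.

(** The difference of the two transforms has integrand [e^(- t x) (1 - e^(- x)) phi(x) / x]. By
    [trapezoid_kernel] and Tonelli it equals the integral of [u (1 - u) / 2 / (t + u)^2], since
    [x e^(- (t + u) x)] integrates to [(t + u)^(-2)]. *)
Lemma binet_muE_shift (t : R) : 0 < t ->
  (binet_muE t = binet_muE (t + 1) + ((t + 2^-1) * ln ((t + 1) / t) - 1)%:E)%E.
Proof.
move=> t0.
have k0 (x : R) : 0 < x -> 0 <= expR (- (t * x)) * ((1 - expR (- x)) * (binet_phi x / x)).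
  move=> x0; rewrite !mulr_ge0 ?expR_ge0 ?binet_phi_ge0 ?invr_ge0 ?(ltW x0)//.
  by rewrite subr_ge0 expR_le1 oppr_le0 ltW.
have mexp : measurable_fun setT (fun x : R => expR (- x)).
  by apply: measurableT_comp => //; exact: measurableT_comp.
transitivity (\int[leb]_(x in `]0%R, +oo[) ((expR (- ((t + 1) * x)) * (binet_phi x / x))%:E +
   (expR (- (t * x)) * ((1 - expR (- x)) * (binet_phi x / x)))%:E))%E.
  apply: eq_integral => x _; rewrite -EFinD; congr EFin.
  have -> : expR (- ((t + 1) * x)) = expR (- (t * x)) * expR (- x).
    by rewrite -expRD; congr expR; ring.
  by ring.
rewrite ge0_integralD//; first last.
- apply/measurable_EFinP; apply: measurable_funTS; apply: measurable_funM.
    exact: measurable_expNM.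
  apply: measurable_funM; first exact: measurable_funB.
  by apply: measurable_funM; [exact: measurable_binet_phi|exact: measurable_funV].
- by move=> x; rewrite /= in_itv/= andbT => x0; rewrite lee_fin k0.
- by apply/measurable_EFinP; apply: measurable_funTS; exact: measurable_mu.
- by move=> x; rewrite /= in_itv/= andbT => x0; rewrite lee_fin mu_ge0.
congr (_ + _)%E.
transitivity (\int[leb]_(x in `]0%R, +oo[) \int[leb]_(u in `[0%R, 1%R])
   (u * (1 - u) / 2 * (x * expR (- ((t + u) * x))))%:E)%E.
  apply: eq_integral => x; rewrite inE/= in_itv/= andbT => x0.
  rewrite EFinM -trapezoid_kernel// -ge0_integralZl//.
  - apply: eq_integral => u _; rewrite -EFinM; congr EFin.
    have -> : expR (- ((t + u) * x)) = expR (- (t * x)) * expR (- (u * x)).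
      by rewrite -expRD; congr expR; ring.
    by ring.
  - apply/measurable_EFinP; apply: measurable_funTS; apply: measurable_funM.
      by apply: measurable_funM => //; apply: measurable_funM => //; exact: measurable_funB.
    apply: measurable_funM => //; apply: measurableT_comp => //.
    by apply: measurableT_comp => //; exact: measurable_funM.
  - move=> u; rewrite /= in_itv/= => /andP[u0 u1].
    by rewrite lee_fin !mulr_ge0 ?expR_ge0 ?subr_ge0// ltW.
rewrite (@tonelli_in _ _ _ _ _ leb leb _ _
  (fun z : measurableTypeR R * measurableTypeR R =>
     z.2 * (1 - z.2) / 2 * (z.1 * expR (- ((t + z.2) * z.1)))))//=.
- rewrite -trapezoid_log//; apply: eq_integral => u; rewrite inE/= in_itv/= => /andP[u0 u1].
  under eq_integral do rewrite EFinM.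
  rewrite ge0_integralZl//.
  + by rewrite integral_xexpNM// ltr_wpDr.
  + apply/measurable_EFinP; apply: measurable_funTS.
    by apply: measurable_funM => //; exact: measurable_expNM.
  + by move=> x; rewrite /= in_itv/= andbT => x0; rewrite lee_fin mulr_ge0 ?expR_ge0// ltW.
  + by rewrite lee_fin !mulr_ge0 ?subr_ge0.
- apply: measurable_funM.
    by apply: measurable_funM => //; apply: measurable_funM => //; exact: measurable_funB.
  apply: measurable_funM => //; apply: measurableT_comp => //; apply: measurableT_comp => //.
  by apply: measurable_funM => //; exact: measurable_funD.
- move=> x u; rewrite !in_itv/= andbT => x0 /andP[u0 u1].
  by rewrite !mulr_ge0 ?expR_ge0 ?subr_ge0// ltW.
Qed.

End binet_integral.

(** * Log-convexity of Gamma and Binet's formula up to its constant *)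

Section gamma_asymptotics.
Context {R : realType}.
Local Notation leb := (@lebesgue_measure R).

Definition Gamma1p (r : R) : R := fine (gammaE (1 + r)).
Definition binet_mu (t : R) : R := fine (binet_muE t).

Lemma gammaE_Gamma1p (r : R) : 0 < r -> gammaE (1 + r) = (Gamma1p r)%:E.
Proof. by move=> r0; rewrite fineK// gammaE_fin. Qed.

Lemma Gamma1p_gt0 (r : R) : 0 < r -> 0 < Gamma1p r.
Proof. by move=> r0; rewrite -lte_fin -gammaE_Gamma1p// gammaE_gt0. Qed.

Lemma Gamma1pS (r : R) : 0 < r -> Gamma1p (r + 1) = (1 + r) * Gamma1p r.
Proof.
move=> r0; have r10 : 0 < r + 1 by rewrite addr_gt0.
have e : 1 + (r + 1) = 2 + r by ring.
apply: EFin_inj; rewrite EFinM -(gammaE_Gamma1p r0) -(gammaE_Gamma1p r10) e.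
exact: gammaES.
Qed.

(** Weighted inequality of arithmetic and geometric means. With [w] the right-hand side, apply
    [ln y <= y - 1] at [u / w] and at [1 / w] and add with weights [x] and [1 - x]. *)
Lemma powR_le_tangent (u x : R) : 0 < u -> 0 <= x <= 1 -> u `^ x <= 1 + x * (u - 1).
Proof.
move=> u0 /andP[x0 x1].
have w0 : 0 < 1 + x * (u - 1).
  have [->|xn] := eqVneq x 1; first by rewrite mul1r addrC subrK.
  have : 0 < 1 - x by rewrite subr_gt0 lt_neqAle xn.
  by have := mulr_ge0 x0 (ltW u0); nra.
set w := 1 + _ in w0 *.
rewrite /powR gt_eqF// -[leRHS](lnK w0) ler_expR.
have h1 : ln u <= ln w + (u / w - 1).
  rewrite -lerBlDl -ln_div ?posrE//.
  have uw : 0 < u / w by rewrite divr_gt0.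
  have h : -1 < u / w - 1 by lra.
  by have := le_ln1Dx h; rewrite addrC subrK.
have h2 : 0 <= ln w + (w^-1 - 1).
  rewrite -lerBlDl sub0r -lnV ?posrE//.
  have uw : 0 < w^-1 by rewrite invr_gt0.
  have h : -1 < w^-1 - 1 by lra.
  by have := le_ln1Dx h; rewrite addrC subrK.
have x1' : 0 <= 1 - x by rewrite subr_ge0.
have := lerD (ler_wpM2l x0 h1) (ler_wpM2l x1' h2).
rewrite mulr0 addr0 => /le_trans; apply.
rewrite le_eqVlt; apply/orP; left; apply/eqP.
rewrite /w; field; rewrite (_ : _ + _ = w) ?gt_eqF//; rewrite /w; ring.
Qed.

(** Jensen's inequality for the Gamma law of density proportional to [t^r e^(- t)]: [t^x] lies below
    its tangent at the mean [1 + r], and the tangent integrates to the right-hand side by the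
    functional equation. *)
Lemma Gamma1p_le (r x : R) : 0 < r -> 0 <= x <= 1 -> Gamma1p (r + x) <= Gamma1p r * (1 + r) `^ x.
Proof.
move=> r0 x01; have /andP[x0 x1] := x01.
have rx0 : 0 < r + x by rewrite ltr_wpDr.
have c0 : 0 < 1 + r by rewrite addr_gt0.
have cx0 : 0 <= (1 + r) `^ x by exact: powR_ge0.
have x1' : 0 <= 1 - x by rewrite subr_ge0.
have mpe (p : R) : measurable_fun setT (fun t : R => t `^ p * expR (- t)).
  apply: measurable_funM; first exact: measurable_powR2.
  by apply: measurableT_comp => //; exact: measurableT_comp.
have pe0 (p t : R) : 0 <= t `^ p * expR (- t) by rewrite mulr_ge0 ?powR_ge0 ?expR_ge0.
have k1 : 0 <= (1 + r) `^ x * (1 - x) by rewrite mulr_ge0.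
have k2 : 0 <= (1 + r) `^ x * (x / (1 + r)) by rewrite mulr_ge0// divr_ge0// ltW.
rewrite -lee_fin -gammaE_Gamma1p//.
apply: (@le_trans _ _ (\int[leb]_(t in `]0%R, +oo[)
  (((1 + r) `^ x * (1 - x))%:E * (t `^ (1 + r - 1) * expR (- t))%:E +
   ((1 + r) `^ x * (x / (1 + r)))%:E * (t `^ (1 + (r + 1) - 1) * expR (- t))%:E))%E).
  apply: ge0_le_integral => //.
  - by move=> t _; rewrite lee_fin pe0.
  - by apply/measurable_EFinP; exact: measurable_funTS (mpe _).
  - apply/measurable_EFinP; apply: measurable_funTS; apply: measurable_funD.
      by apply: measurable_funM => //; exact: mpe.
    by apply: measurable_funM => //; exact: mpe.
  - move=> t; rewrite /= in_itv/= andbT => t0.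
    rewrite -!EFinM -EFinD lee_fin !mulrA -mulrDl ler_wpM2r ?expR_ge0//.
    rewrite (_ : 1 + (r + x) - 1 = r + x); last by ring.
    rewrite (_ : 1 + r - 1 = r); last by ring.
    rewrite (_ : 1 + (r + 1) - 1 = r + 1); last by ring.
    have tn : t != 0 by rewrite gt_eqF.
    rewrite !powRD ?tn ?implybT// powRr1 ?(ltW t0)//.
    have tc : 0 < t / (1 + r) by rewrite divr_gt0.
    have -> : t `^ x = (1 + r) `^ x * (t / (1 + r)) `^ x.
      by rewrite -powRM ?(ltW c0) ?(ltW tc)// mulrC divfK// gt_eqF.
    have := powR_le_tangent tc x01 => h.
    have := ler_wpM2l (mulr_ge0 (powR_ge0 t r) cx0) h.
    rewrite mulrA => /le_trans; apply; rewrite le_eqVlt; apply/orP; left; apply/eqP.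
    by field; rewrite gt_eqF.
rewrite ge0_integralD//; first last.
- apply/measurable_EFinP; apply: measurable_funTS.
  by apply: measurable_funM => //; exact: mpe.
- by move=> t _; rewrite mule_ge0// lee_fin.
- apply/measurable_EFinP; apply: measurable_funTS.
  by apply: measurable_funM => //; exact: mpe.
- by move=> t _; rewrite mule_ge0// lee_fin.
have mE (p : R) : measurable_fun (`]0%R, +oo[%classic : set (measurableTypeR R)) (fun t : R => (t `^ p * expR (- t))%:E).
  by apply/measurable_EFinP; exact: measurable_funTS (mpe _).
rewrite !ge0_integralZl ?lee_fin//; last 2 first.
- by move=> t _; rewrite lee_fin.
- by move=> t _; rewrite lee_fin.
rewrite -/(gammaE (1 + r)) -/(gammaE (1 + (r + 1))) !gammaE_Gamma1p ?addr_gt0//.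
rewrite Gamma1pS// -!EFinM -EFinD lee_fin le_eqVlt; apply/orP; left; apply/eqP.
by field; rewrite gt_eqF.
Qed.

Lemma ln_Gamma1p_le (r x : R) : 0 < r -> 0 <= x <= 1 ->
  ln (Gamma1p (r + x)) <= ln (Gamma1p r) + x * ln (1 + r).
Proof.
move=> r0 x01; have /andP[x0 _] := x01.
have p0 : 0 < (1 + r) `^ x by rewrite powR_gt0// addr_gt0.
rewrite -ln_powR -lnM ?posrE ?Gamma1p_gt0// ler_ln ?posrE ?mulr_gt0 ?Gamma1p_gt0 ?ltr_wpDr//.
exact: Gamma1p_le.
Qed.

Lemma binet_muE_binet_mu (t : R) : 0 < t -> binet_muE t = (binet_mu t)%:E.
Proof.
move=> t0; rewrite fineK// ge0_fin_numE ?binet_muE_ge0//.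
by apply: le_lt_trans (binet_muE_le t0) _; rewrite ltry.
Qed.

Lemma binet_mu_bounds (t : R) : 0 < t -> 0 <= binet_mu t <= (4 * t)^-1.
Proof. by move=> t0; rewrite -!lee_fin -binet_muE_binet_mu// binet_muE_ge0 binet_muE_le. Qed.

(** The constant term of Binet's formula. [binet_const] proves that it does not depend on [t], and
    it cancels in [gamma_ratio]. *)
Definition binet (t : R) := ln (Gamma1p t) - ((t + 2^-1) * ln t - t + binet_mu t).

Lemma binetS (t : R) : 0 < t -> binet (t + 1) = binet t.
Proof.
move=> t0; have t10 : 0 < t + 1 by rewrite addr_gt0.
have E : binet_mu t = binet_mu (t + 1) + ((t + 2^-1) * ln ((t + 1) / t) - 1).
  by apply: EFin_inj; rewrite EFinD -!binet_muE_binet_mu// binet_muE_shift.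
rewrite (ln_div t10 t0) in E.
have t1 : 0 < 1 + t by rewrite addrC.
rewrite /binet (Gamma1pS t0) (lnM t1 (Gamma1p_gt0 t0)) [1 + t]addrC E.
ring.
Qed.

Lemma lnD_le (a b : R) : 0 < a -> 0 <= b -> ln (a + b) <= ln a + b / a.
Proof.
move=> a0 b0; rewrite (_ : a + b = a * (1 + b / a)); last by field; rewrite gt_eqF.
have ba : 0 <= b / a by rewrite divr_ge0// ltW.
rewrite lnM ?posrE ?ltr_wpDr// lerD2l le_ln1Dx//.
exact: lt_le_trans (ltrN10 _) ba.
Qed.

(** What the increment of [(t + 1/2) ln t - t] leaves beyond [x ln t]. Since [ln Gamma1p] has the
    same main increment by [ln_Gamma1p_increment], [binet] varies by [O(1/t)] over unit steps. The
    bounds come from [x / (t + x) <= ln (t + x) - ln t <= x / t]. *)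
Lemma stirling_increment (t x : R) : 0 < t -> 0 <= x <= 1 ->
  0 <= (t + x + 2^-1) * (ln (t + x) - ln t) - x <= 2 / t.
Proof.
move=> t0 /andP[x0 x1]; have tx0 : 0 < t + x by rewrite ltr_wpDr.
have p0 : 0 <= t + x + 2^-1 by rewrite addr_ge0// ltW.
have A6 : ln (t + x) - ln t <= x / t by rewrite lerBlDl lnD_le.
have A7 : x / (t + x) <= ln (t + x) - ln t.
  have h : -1 < - (x / (t + x)) by rewrite ltrN2 ltr_pdivrMr// mul1r ltrDr.
  have := le_ln1Dx h.
  rewrite (_ : 1 + _ = t / (t + x)); last by field; rewrite gt_eqF.
  by rewrite ln_div ?posrE// lerNr opprB.
apply/andP; split.
  have := ler_wpM2l p0 A7; rewrite -subr_ge0 => h.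
  rewrite subr_ge0; move: h; rewrite subr_ge0; apply: le_trans.
  rewrite mulrA ler_pdivlMr//.
  by clear A6 A7; have := mulr_ge0 x0 (ltW tx0); nra.
have h := ler_wpM2l p0 A6; rewrite lerBlDr; apply: le_trans h _.
rewrite mulrA ler_pdivrMr//.
have -> : (2 / t + x) * t = 2 + x * t by field; rewrite gt_eqF.
by have := mulr_ge0 x0 x0; have := mulr_ge0 x0 (ltW t0); nra.
Qed.

(** Log-convexity used twice: the step from [t] to [t + x] gives the upper bound, and the step from
    [t + x] to [t + 1], where the functional equation applies, the lower one. *)
Lemma ln_Gamma1p_increment (t x : R) : 0 < t -> 0 <= x <= 1 ->
  `|ln (Gamma1p (t + x)) - ln (Gamma1p t) - x * ln t| <= t^-1.
Proof.
move=> t0 x01; have /andP[x0 x1] := x01.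
have tx0 : 0 < t + x by rewrite ltr_wpDr.
have t10 : 0 < 1 + t by rewrite addr_gt0.
have ti : 0 < t^-1 by rewrite invr_gt0.
have x01' : 0 <= 1 - x <= 1 by apply/andP; split; lra.
have /andP[x1' x2'] := x01'.
have A3 : x * ln (1 + t) <= x * ln t + t^-1.
  have := lnD_le t0 ler01; rewrite [t + 1]addrC mul1r => /(ler_wpM2l x0).
  rewrite mulrDr => /le_trans; apply; rewrite lerD2l.
  by rewrite -[leRHS]mul1r ler_wpM2r// ltW.
have A4 : x * ln t <= x * ln (1 + t).
  by rewrite ler_wpM2l// ler_ln ?posrE// lerDr.
have A5 : (1 - x) * ln (1 + (t + x)) <= (1 - x) * ln (1 + t) + t^-1.
  have := lnD_le t10 x0; rewrite -addrA => h.
  have := ler_wpM2l x1' h; rewrite mulrDr => /le_trans; apply; rewrite lerD2l.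
  rewrite -[leRHS]mul1r ler_pM//.
    by rewrite divr_ge0// ltW.
  apply: (@le_trans _ _ (1 + t)^-1); last by rewrite lef_pV2 ?posrE// lerDr.
  by rewrite -[leRHS]mul1r ler_wpM2r// invr_ge0 ltW.
have A1 := ln_Gamma1p_le t0 x01.
have A2 := ln_Gamma1p_le tx0 x01'.
rewrite (_ : t + x + (1 - x) = t + 1) in A2; last by ring.
rewrite (Gamma1pS t0) (lnM t10 (Gamma1p_gt0 t0)) in A2.
move: A1 A2 A3 A4 A5.
move: (ln (Gamma1p (t + x))) (ln (Gamma1p t)) (ln (1 + t)) (ln (1 + (t + x))) (ln t) => g1 g2 l1 l2 l3.
rewrite ler_norml !mulrBl !mul1r => A1 A2 A3 A4 A5.
by apply/andP; split; lra.
Qed.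

Lemma binet_near (t x : R) : 0 < t -> 0 <= x <= 1 -> `|binet (t + x) - binet t| <= 4 / t.
Proof.
move=> t0 x01; have /andP[x0 x1] := x01.
have tx0 : 0 < t + x by rewrite ltr_wpDr.
have M5 : (4 * t)^-1 <= t^-1 by rewrite lef_pV2 ?posrE ?mulr_gt0//; lra.
have M6 : (4 * (t + x))^-1 <= t^-1 by rewrite lef_pV2 ?posrE ?mulr_gt0//; lra.
have := stirling_increment t0 x01; have := ln_Gamma1p_increment t0 x01.
have := binet_mu_bounds t0; have := binet_mu_bounds tx0.
rewrite /binet [4 / t]mulrC [2 / t]mulrC.
have E : (t + x + 2^-1) * ln (t + x) =
  (t + x + 2^-1) * (ln (t + x) - ln t) + (t + 2^-1) * ln t + x * ln t by ring.
rewrite E; move: ((t + x + 2^-1) * _) ((t + 2^-1) * _) (x * _) => z1 z2 z3.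
move: (ln (Gamma1p (t + x))) (ln (Gamma1p t)) (binet_mu (t + x)) (binet_mu t) => g1 g2 m1 m2.
rewrite !ler_norml => /andP[? ?] /andP[? ?] /andP[? ?] /andP[? ?].
by apply/andP; split; lra.
Qed.

(** [binet] has period 1 and varies by at most [4 / t] on [[t, t + 1]]; periodicity carries any
    comparison to arbitrarily large [t]. *)
Lemma binet_const (a b : R) : 0 < a -> 0 < b -> binet a = binet b.
Proof.
have periodic (t : R) n : 0 < t -> binet (t + n%:R) = binet t.
  elim: n t => [|n ih] t t0; first by rewrite addr0.
  have tn0 : 0 < t + n%:R by rewrite ltr_wpDr.
  by rewrite -natr1 addrA (binetS tn0) (ih t t0).
have near (t x : R) : 0 < t -> 0 <= x <= 1 -> binet (t + x) = binet t.
  move=> t0 x01; have /andP[x0 x1] := x01; apply/eqP; rewrite -subr_eq0 -normr_le0.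
  rewrite leNgt; apply/negP => d0.
  set e := `|_| in d0; set n := (Num.truncn (4 / e)).+1.
  have ne : 4 / e < n%:R by exact: truncnS_gt.
  have tn : 0 < t + n%:R by rewrite ltr_wpDr.
  have := binet_near tn x01.
  rewrite (_ : t + n%:R + x = t + x + n%:R); last by ring.
  rewrite !periodic ?ltr_wpDr// -/e.
  rewrite ler_pdivlMr// => h.
  move: ne; rewrite ltr_pdivrMr// => ne.
  by have := mulr_gt0 d0 t0; nra.
have wlog_le (a' b' : R) : 0 < a' -> a' <= b' -> binet a' = binet b'.
  move=> a0 ab; have d0 : 0 <= b' - a' by rewrite subr_ge0.
  have /andP[n1 n2] := truncn_itv d0; set n := Num.truncn _ in n1 n2.
  have b'E : b' = a' + n%:R + (b' - a' - n%:R) by ring.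
  rewrite b'E near ?periodic ?ltr_wpDr//.
  by rewrite -natr1 in n2; apply/andP; split; lra.
move=> a0 b0; have [ab|/ltW ba] := leP a b; first exact: wlog_le.
exact/esym/wlog_le.
Qed.

End gamma_asymptotics.

Section levy_density.
Context {R : realType}.
Local Notation leb := (@lebesgue_measure R).
Variable al : R.
Hypotheses (al_gt0 : 0 < al) (al_lt1 : al < 1).

Lemma gamma_ratio (t : R) : 0 < t ->
  ln (Gamma1p t) - ln (Gamma1p (al * t)) =
  (1 - al) * (t * ln t - t) - al * t * ln al - ln al / 2 - (binet_mu (al * t) - binet_mu t).
Proof.
move=> t0; have at0 : 0 < al * t by rewrite mulr_gt0.
have := binet_const t0 at0; rewrite /binet (lnM al_gt0 t0).
move: (ln (Gamma1p t)) (ln (Gamma1p (al * t))) (binet_mu t) (binet_mu (al * t)) (ln t) (ln al) => g1 g2 m1 m2 l1 l2 h.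
by lra.
Qed.

(** Scaling the variable in [binet_muE (al * t)] by [al] turns the difference of the two Binet terms
    at [al t] and [t] into one Laplace integral, with this density. *)
Definition levy_psi (x : R) := (binet_phi (x / al) - binet_phi x) / x.

Lemma levy_psi_ge0 (x : R) : 0 < x -> 0 <= levy_psi x.
Proof.
move=> x0; rewrite divr_ge0 ?(ltW x0)// subr_ge0 binet_phi_ndecr//.
by rewrite ler_pdivlMr// ler_piMr ?ltW.
Qed.

Lemma measurable_levy_psi : measurable_fun setT levy_psi.
Proof.
apply: measurable_funM; last exact: measurable_funV.
apply: measurable_funB; last exact: measurable_binet_phi.
by apply: measurableT_comp => //; [exact: measurable_binet_phi|exact: measurable_funM].
Qed.

Definition levy_exp (t : R) : R := binet_mu (al * t) - binet_mu t.

Lemma levy_expE (t : R) : 0 < t ->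
  (\int[leb]_(x in `]0%R, +oo[) (expR (- (t * x)) * levy_psi x)%:E = (levy_exp t)%:E)%E.
Proof.
move=> t0; have at0 : 0 < al * t by rewrite mulr_gt0.
have ial : 0 < al^-1 by rewrite invr_gt0.
have mk (c : R) : measurable_fun setT (fun x : R => expR (- (c * x)) * (binet_phi x / x)).
  apply: measurable_funM; first exact: measurable_expNM.
  by apply: measurable_funM; [exact: measurable_binet_phi|exact: measurable_funV].
have k0 (c x : R) : 0 < x -> 0 <= expR (- (c * x)) * (binet_phi x / x).
  by move=> x0; rewrite mulr_ge0 ?expR_ge0 ?divr_ge0 ?binet_phi_ge0// ltW.
have E : (binet_muE (al * t) = binet_muE t +
    \int[leb]_(x in `]0%R, +oo[) (expR (- (t * x)) * levy_psi x)%:E)%E.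
  rewrite /binet_muE (@integral_pos_scale R al^-1 _ ial (mk _) (k0 _)).
  rewrite -ge0_integralZl//; first last.
  - by rewrite lee_fin ltW.
  - move=> x; rewrite /= in_itv/= andbT => x0.
    by rewrite lee_fin k0 ?mulr_gt0.
  - apply/measurable_EFinP; apply: measurable_funTS.
    by apply: (measurableT_comp (mk (al * t))) => //; exact: measurable_funM.
  rewrite -ge0_integralD//; first last.
  - apply/measurable_EFinP; apply: measurable_funTS.
    by apply: measurable_funM; [exact: measurable_expNM|exact: measurable_levy_psi].
  - move=> x; rewrite /= in_itv/= andbT => x0.
    by rewrite lee_fin mulr_ge0 ?expR_ge0 ?levy_psi_ge0.
  - by apply/measurable_EFinP; apply: measurable_funTS; exact: mk.
  - by move=> x; rewrite /= in_itv/= andbT => x0; rewrite lee_fin k0.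
  apply: eq_integral => x; rewrite inE/= in_itv/= andbT => x0.
  rewrite -EFinM -EFinD; congr EFin.
  rewrite (_ : al * t * (al^-1 * x) = t * x); last by field; rewrite gt_eqF.
  rewrite /levy_psi [al^-1 * x]mulrC; field.
  by rewrite !gt_eqF.
move: E; rewrite !binet_muE_binet_mu// /levy_exp.
set I := (\int[_]_(_ in _) _)%E; case: I => //= r [->].
by rewrite addrAC subrr add0r.
Qed.

(** By [gamma_ratio] the distance to the limit consists of terms of order [t |ln t|] and of
    [ln Gamma1p] near 0. At [t = e^(- n)] one has [ln t = - n], and [e^n >= n^2 / 2] gives the rate
    [1 / n]. *)
Lemma levy_exp_cvg : (fun n : nat => levy_exp (expR (- n%:R))) @ \oo --> - (ln al / 2).
Proof.
have G1 : Gamma1p 1 = 1 :> R.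
  apply: EFin_inj; rewrite -gammaE_Gamma1p// /gammaE -[RHS]/((1 : R)%:E).
  have := @integral_xexpNM R 1 ltr01; rewrite expr1n invr1 => <-.
  apply: eq_integral => x; rewrite inE/= in_itv/= andbT => x0.
  by rewrite mul1r (_ : 1 + 1 - 1 = 1) ?powRr1 ?(ltW x0)//; ring.
(* Log-convexity with [Gamma1p 1 = 1]: the step from [t] to 1 gives the lower bound, the step from 1
   to [1 + t] with the functional equation the upper one. *)
have lnGt (t : R) : 0 < t -> t <= 1 -> `|ln (Gamma1p t)| <= t.
  move=> t0 t1; have t01 : 0 <= t <= 1 by rewrite (ltW t0).
  have t01' : 0 <= 1 - t <= 1 by apply/andP; split; lra.
  have t10 : 0 < 1 + t by rewrite addr_gt0.
  have := ln_Gamma1p_le ltr01 t01; have := ln_Gamma1p_le t0 t01'.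
  rewrite (_ : t + (1 - t) = 1); last by ring.
  rewrite (_ : Gamma1p (1 + t) = (1 + t) * Gamma1p t); last by rewrite addrC Gamma1pS// addrC.
  rewrite G1 ln1 lnM ?posrE ?Gamma1p_gt0//.
  have h1 : ln (1 + t) <= t by rewrite le_ln1Dx// (lt_trans (ltrN10 _)).
  have h2 : ln (1 + 1) <= 1 :> R by rewrite le_ln1Dx// (lt_trans (ltrN10 _)).
  have h3 : 0 <= ln (1 + t) by rewrite ln_ge0// lerDl ltW.
  have h2' := ler_wpM2l (ltW t0) h2.
  have h4 : (1 - t) * ln (1 + t) <= t by have := mulr_ge0 (ltW t0) h3; nra.
  move: h1 h2 h3 h2' h4; rewrite mulrBl mul1r.
  move: (ln (1 + t)) (ln (1 + 1)) (ln (Gamma1p t)) => l1 l2 g h1 h2 h3 h2' h4.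
  by rewrite ler_norml => h5 h6; apply/andP; split; lra.
apply: (@cvg_le_harmonic _ _ _ (2 * (6 - ln al))) => n.
set t := expR _; have t0 : 0 < t by exact: expR_gt0.
have t1 : t <= 1 by rewrite expR_le1 oppr_le0.
have at0 : 0 < al * t by rewrite mulr_gt0.
have at1 : al * t <= t by rewrite ler_piMl ?ltW.
have h1 := lnGt _ t0 t1; have h2 := lnGt _ at0 (le_trans at1 t1).
have la : ln al <= 0 by rewrite ln_le0// ltW.
have lt : ln t = - n.+1%:R by rewrite /t expRK.
have tn : t * n.+1%:R <= 2 * n.+1%:R^-1.
  have := @exprn_le_expR R n.+1%:R 2 (ler0n _ _); rewrite !factS fact0 => h.
  by rewrite ler_pdivlMr ?ltr0n// -mulrA -expr2 /t expRN mulrC ler_pdivrMr ?expR_gt0.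
have tn1 : t <= t * n.+1%:R by rewrite ler_peMr ?ler1n// ltW.
have E : levy_exp t - - (ln al / 2) =
  (1 - al) * (t * ln t - t) - al * t * ln al - (ln (Gamma1p t) - ln (Gamma1p (al * t))).
  by rewrite (gamma_ratio t0) /levy_exp; ring.
have q0 : 0 <= - ln al by rewrite oppr_ge0.
have p1 : 0 <= al * t * (- ln al) by rewrite mulr_ge0// ltW.
have p2 : al * t * (- ln al) <= t * n.+1%:R * (- ln al).
  by rewrite ler_wpM2r// (le_trans at1).
have p3 : 0 <= al * (t * n.+1%:R + t) by rewrite mulr_ge0 ?addr_ge0 ?mulr_ge0 ?(ltW al_gt0) ?(ltW t0).
have p4 : al * (t * n.+1%:R + t) <= t * n.+1%:R + t.
  by rewrite ler_piMl ?(ltW al_lt1)// addr_ge0 ?mulr_ge0 ?(ltW t0).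
rewrite E lt; apply: (@le_trans _ _ (t * n.+1%:R * (6 - ln al))); last first.
  rewrite [leRHS]mulrAC ler_wpM2r//.
  by rewrite addr_ge0.
move: h1 h2; move: (ln (Gamma1p t)) (ln (Gamma1p (al * t))) => g1 g2.
rewrite !ler_norml => /andP[h1 h1'] /andP[h2 h2'].
move: p1 p2 p3 p4 tn1; rewrite !mulrN !mulrBr !mulrDr.
move: h1 h1' h2 h2' q0 t0 at0 at1; clear; clearbody t.
move: (t * n.+1%:R) (ln al) => z la.
by move=> *; apply/andP; split; lra.
Qed.

End levy_density.

(** * Compound Poisson domination *)

Section measurable_level_sets.
Context {R : realType} d (T : measurableType d) (f : T -> R).
Hypothesis mf : measurable_fun setT f.

Lemma measurable_set_le x : measurable [set w | f w <= x].
Proof.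
rewrite (_ : [set w | _] = f @^-1` `]-oo, x]); first by rewrite -[X in measurable X]setTI; exact: mf.
by apply/seteqP; split => w /=; rewrite in_itv.
Qed.

Lemma measurable_set_lt x : measurable [set w | f w < x].
Proof.
rewrite (_ : [set w | _] = f @^-1` `]-oo, x[); first by rewrite -[X in measurable X]setTI; exact: mf.
by apply/seteqP; split => w /=; rewrite in_itv.
Qed.

Lemma measurable_set_ge x : measurable [set w | x <= f w].
Proof.
rewrite (_ : [set w | _] = f @^-1` `[x, +oo[); first by rewrite -[X in measurable X]setTI; exact: mf.
by apply/seteqP; split => w /=; rewrite in_itv/= andbT.
Qed.

Lemma measurable_set_gt x : measurable [set w | x < f w].
Proof.
rewrite (_ : [set w | _] = f @^-1` `]x, +oo[); first by rewrite -[X in measurable X]setTI; exact: mf.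
by apply/seteqP; split => w /=; rewrite in_itv/= andbT.
Qed.

End measurable_level_sets.

(** * Measures with a density, finite measures *)

Section measure_constructions.
Local Open Scope ereal_scope.
Context d (T : measurableType d) (R : realType).
Variable mu : {measure set T -> \bar R}.

Section density.
Variable f : T -> R.
Hypotheses (mf : measurable_fun setT f) (f0 : forall x, (0 <= f x)%R).

Definition mdensity (A : set T) := \int[mu]_(x in A) (f x)%:E.

Let mdensity0 : mdensity set0 = 0.
Proof. exact: integral_set0. Qed.

Let mdensity_ge0 A : 0 <= mdensity A.
Proof. by apply: integral_ge0 => x _; rewrite lee_fin. Qed.

Let mdensity_sigma_additive : semi_sigma_additive mdensity.
Proof.
move=> /= F mF tF mUF; rewrite /mdensity; apply: cvg_toP.
  apply: ereal_nondecreasing_is_cvgn => m n mn.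
  by apply: lee_sum_nneg_natr => // k _ _; exact: mdensity_ge0.
rewrite ge0_integral_bigcup//.
- by apply/measurable_EFinP; exact: measurable_funTS.
- by move=> x _; rewrite lee_fin.
Qed.

Definition density_measure : {measure set T -> \bar R} :=
  HB.pack mdensity (isMeasure.Build d T R mdensity
    mdensity0 mdensity_ge0 mdensity_sigma_additive).

Import HBNNSimple.

Let density_nnsfun (h : {nnsfun T >-> R}) :
  \int[density_measure]_x (h x)%:E = \int[mu]_x ((h x)%:E * (f x)%:E).
Proof.
under [LHS]eq_integral do rewrite fimfunE -fsumEFin//.
rewrite [LHS]ge0_integral_fsum//; last 2 first.
  - by move=> r; exact/measurable_EFinP/measurableT_comp.
  - by move=> n x _; rewrite EFinM nnfun_muleindic_ge0.
under [RHS]eq_integral.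
  move=> x xD; rewrite fimfunE -fsumEFin// ge0_mule_fsuml; last first.
    by move=> r; rewrite EFinM nnfun_muleindic_ge0.
  over.
rewrite [RHS]ge0_integral_fsum//; last 2 first.
  - move=> r; apply: emeasurable_funM => //; last exact/measurable_EFinP.
    exact/measurable_EFinP/measurableT_comp.
  - move=> n x _; apply: mule_ge0; last by rewrite lee_fin.
    by rewrite EFinM nnfun_muleindic_ge0.
apply: eq_fsbigr => r _. rewrite integralZl_indic_nnsfun//.
have [r0|r0] := leP 0%R r; last first.
  rewrite (preimage_nnfun0 _ r0); under eq_integral do rewrite indic0/=.
  rewrite integral0 mule0; under eq_integral do rewrite indic0/= mulr0 mul0e.
  by rewrite integral0.
rewrite integral_indic// setIT /density_measure/= /mdensity.
rewrite -integral_indicM.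
rewrite -ge0_integralZl//.
- by apply: eq_integral => x _; rewrite -!EFinM mulrA.
- apply/measurable_EFinP; apply: measurable_funM => //.
- by move=> x _; rewrite lee_fin mulr_ge0.
Qed.

Lemma ge0_integral_density (g : T -> \bar R) : measurable_fun setT g ->
  (forall x, 0 <= g x) ->
  \int[density_measure]_x g x = \int[mu]_x (g x * (f x)%:E).
Proof.
move=> mg g0; pose g_ := nnsfun_approx measurableT mg.
have cg x : (fun n => (g_ n x)%:E) @ \oo --> g x.
  by apply: cvg_nnsfun_approx => // y _; exact: g0.
have ng x : {homo (fun n => (g_ n x)%:E) : n m / (n <= m)%N >-> n <= m}.
  by move=> n m nm; rewrite lee_fin; exact/lefP/nd_nnsfun_approx.
transitivity (limn (fun n => \int[density_measure]_x (g_ n x)%:E)).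
  rewrite -monotone_convergence//.
  - by apply: eq_integral => x _; apply/esym/cvg_lim => //; exact: cg.
  - by move=> n; exact/measurable_EFinP.
  - by move=> n x _; rewrite lee_fin.
transitivity (limn (fun n => \int[mu]_x ((g_ n x)%:E * (f x)%:E))).
  by under eq_fun do rewrite density_nnsfun.
rewrite -monotone_convergence//.
- apply: eq_integral => x _; apply/cvg_lim => //.
  by apply: cvgeZr => //; exact: cg.
- by move=> n; apply: emeasurable_funM; exact/measurable_EFinP.
- by move=> n x _; rewrite mule_ge0 ?lee_fin.
- by move=> x _ n m nm; rewrite lee_wpmul2r ?lee_fin//; have := ng x n m nm; rewrite lee_fin.
Qed.

End density.

Section finite.
Hypothesis fin_mu : fin_num_fun mu.

(** A fresh name for [mu], on which the structure of a finite measure can be declared. *)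
Definition finite_of (A : set T) : \bar R := mu A.

HB.instance Definition _ := Measure.copy finite_of mu.

HB.instance Definition _ := Measure_isFinite.Build d T R finite_of fin_mu.

Definition finite_measure_of : {finite_measure set T -> \bar R} := finite_of.

End finite.

End measure_constructions.

Section compound_poisson.
Local Open Scope ereal_scope.
Context {R : realType}.
Local Notation RR := (measurableTypeR R).

Lemma nneseries_expR (a y : R) :
  \sum_(0 <= k <oo) (a * (y ^+ k / k`!%:R))%:E = (a * expR y)%:E.
Proof.
apply: cvg_lim => //; rewrite (_ : (fun n => _) =
  fun n => (a * \sum_(k < n) y ^+ k / k`!%:R)%:E); last first.
  by apply/funext => n; rewrite mulr_sumr sumEFin big_mkord.
apply: cvg_EFin; first by near=> n.
by apply: cvgMr; exact: expR_psum_cvg.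
Unshelve. all: by end_near. Qed.

Variables (eta mu0 : {finite_measure set RR -> \bar R}) (c : R).

(** The absolute value makes the factor at most 1 on the whole line, for any measure [eta] of the
    jumps. *)
Definition contract (z : RR * RR) : RR := (z.1 * expR (- (c * `|z.2|)))%R.

Lemma measurable_contract : measurable_fun setT contract.
Proof.
apply: measurable_funM; first exact: measurable_fst.
apply: measurableT_comp => //; apply: measurableT_comp => //.
apply: measurable_funM => //; apply: measurableT_comp => //.
Qed.

(** [eta] is not normalized: a jump multiplies the mass by [M], which is why the Poisson weights
    below are [e^(- M) / k!] without the power [M^k]. *)
Definition jump (m : {finite_measure set RR -> \bar R}) : {measure set RR -> \bar R} :=
  measure_function_pushforward__canonical__measure_function_Measure
    (m \x eta) measurable_contract.

Lemma jump_fin m : fin_num_fun (jump m).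
Proof.
move=> A mA; rewrite ge0_fin_numE//.
apply: (@le_lt_trans _ _ ((m \x eta) setT)).
  rewrite -[leLHS]/((m \x eta) (contract @^-1` A)).
  apply: le_measure; rewrite ?inE//.
  by rewrite -[X in measurable X]setTI; exact: measurable_contract.
rewrite -setXTT product_measure1E//.
by rewrite lte_mul_pinfty// ?fin_num_measure// ltey_eq fin_num_measure.
Qed.

Fixpoint jumps (k : nat) : {finite_measure set RR -> \bar R} :=
  if k is k'.+1 then finite_measure_of (jump_fin (jumps k')) else mu0.

Lemma ge0_integral_jump (m : {finite_measure set RR -> \bar R}) (g : R -> R) :
  measurable_fun (setT : set RR) g -> (forall x, (0 <= g x)%R) ->
  \int[jump m]_a (g a)%:E = \int[m]_a \int[eta]_x (g (contract (a, x)))%:E.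
Proof.
move=> mg g0; rewrite ge0_integral_pushforward//=; first last.
- by move=> x _; rewrite lee_fin.
- exact/measurable_EFinP.
- exact: measurable_contract.
rewrite preimage_setT fubini_tonelli1//.
  by apply/measurable_EFinP; apply: (measurableT_comp mg); exact: measurable_contract.
by move=> x; rewrite lee_fin.
Qed.

Variables (M : R) (m_ L : nat -> R).
Hypothesis c0 : (0 <= c)%R.
Hypothesis etaT : eta setT = M%:E.
Hypothesis mom0 : forall n, \int[mu0]_a (`|a| ^+ n)%:E = (m_ n)%:E.
Hypothesis laplace_eta : forall n,
  \int[eta]_x (expR (- (c * n%:R * `|x|)))%:E = (L n)%:E.

Let measurable_normX n : measurable_fun (setT : set RR) (fun a : RR => `|a| ^+ n)%R.
Proof. by apply: measurable_funX; exact: normr_measurable. Qed.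

Lemma jumps_moment k n :
  \int[jumps k]_a (`|a| ^+ n)%:E = (m_ n * L n ^+ k)%:E.
Proof.
elim: k => [|k IH] /=; first by rewrite expr0 mulr1.
transitivity (\int[jump (jumps k)]_a (`|a| ^+ n)%:E); first by [].
rewrite ge0_integral_jump//.
transitivity (\int[jumps k]_a ((`|a| ^+ n)%:E * (L n)%:E)).
  apply: eq_integral => a _; rewrite -laplace_eta -ge0_integralZl//.
  - apply: eq_integral => x _; rewrite /contract/= -EFinM; congr EFin.
    rewrite normrM exprMn (ger0_norm (expR_ge0 _)) -expRM_natl; congr (_ * expR _)%R.
    by ring.
  - apply/measurable_EFinP.
    exact: (measurableT_comp (measurable_expNM (c * n%:R)) (@normr_measurable R setT)).
rewrite ge0_integralZr//.
- by rewrite IH -EFinM exprSr mulrA.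
- exact/measurable_EFinP.
- rewrite -laplace_eta; apply: integral_ge0 => x _.
  by rewrite lee_fin expR_ge0.
Qed.

(** A jump can only shrink [|a|], so an event [x0 < |a|] after it already held before it; the
    product with [eta] contributes the mass [M]. *)
Lemma jumps_tail k x0 :
  jumps k [set a | (x0 < `|a|)%R] <= (M ^+ k)%:E * mu0 [set a | (x0 < `|a|)%R].
Proof.
elim: k => [|k IH] /=; first by rewrite expr0 mul1e.
rewrite -[leLHS]/((jumps k \x eta) (contract @^-1` [set a | (x0 < `|a|)%R])).
have mA : measurable ([set a | (x0 < `|a|)%R] : set RR).
  exact: (measurable_set_gt (@normr_measurable R setT)).
apply: (@le_trans _ _ ((jumps k \x eta) ([set a | (x0 < `|a|)%R] `*` setT))).
  apply: le_measure; rewrite ?inE//.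
  - by rewrite -[X in measurable X]setTI; exact: measurable_contract.
  - exact: measurableX.
  move=> [a x]/= h; split => //=; apply: (lt_le_trans h).
  rewrite /contract/= normrM (ger0_norm (expR_ge0 _)) ler_piMr//.
  by rewrite expR_le1 oppr_le0 mulr_ge0.
rewrite product_measure1E//.
have M0 : 0 <= M%:E by rewrite -etaT.
rewrite -[X in _ * X]/(eta setT) etaT muleC exprS EFinM -muleA.
by rewrite lee_wpmul2l.
Qed.

Let M0 : (0 <= M)%R. Proof. by rewrite -lee_fin -etaT. Qed.

Let weight (k : nat) : R := (expR (- M) / k`!%:R)%R.

Let weight_ge0 k : (0 <= weight k)%R.
Proof. by rewrite divr_ge0 ?expR_ge0. Qed.

(* The law of [a * expR (- c * (|x_1| + ... + |x_N|))] where [a] has law [mu0], [N] is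
   Poisson of mean [M] and the jumps [x_i] have law [eta / M]. *)
Definition compound_poisson : {measure set RR -> \bar R} :=
  mseries (fun k => mscale (NngNum (weight_ge0 k)) (jumps k)) 0.

Lemma compound_poisson_moment n :
  \int[compound_poisson]_a (`|a| ^+ n)%:E = (m_ n * expR (L n - M))%:E.
Proof.
rewrite ge0_integral_measure_series//; last first.
  by apply/measurable_EFinP; exact: measurable_normX.
have -> : (m_ n * expR (L n - M) = expR (- M) * m_ n * expR (L n))%R by rewrite expRD; ring.
rewrite -nneseries_expR; apply: eq_eseriesr => k _.
rewrite ge0_integral_mscale//; last first.
  by apply/measurable_EFinP; exact: measurable_normX.
rewrite jumps_moment -EFinM; congr EFin; rewrite /weight/=; ring.
Qed.

Lemma compound_poisson_tail x0 :
  compound_poisson [set a | (x0 < `|a|)%R] <= mu0 [set a | (x0 < `|a|)%R].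
Proof.
have mA : measurable ([set a | (x0 < `|a|)%R] : set RR).
  exact: (measurable_set_gt (@normr_measurable R setT)).
have /fineK E := fin_num_measure mu0 _ mA.
apply: (@le_trans _ _
  (\sum_(0 <= k <oo) (expR (- M) * fine (mu0 [set a | (x0 < `|a|)%R]) * (M ^+ k / k`!%:R))%:E)).
  apply: lee_nneseries => // k _.
  rewrite /mscale/=.
  apply: (@le_trans _ _ ((weight k)%:E * ((M ^+ k)%:E * mu0 [set a | (x0 < `|a|)%R]))).
    by rewrite lee_wpmul2l ?lee_fin ?jumps_tail.
  by rewrite -E -!EFinM lee_fin /weight le_eqVlt; apply/orP; left; apply/eqP; ring.
by rewrite nneseries_expR mulrAC -expRD addNr expR0 mul1r E.
Qed.

Lemma compound_poisson_fin : fin_num_fun compound_poisson.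
Proof.
move=> A mA; rewrite ge0_fin_numE//.
apply: (@le_lt_trans _ _ (compound_poisson setT)).
  by apply: le_measure; rewrite ?inE.
have := compound_poisson_moment 0; under eq_integral do rewrite expr0.
by rewrite integral_cst// mul1e => ->; exact: ltry.
Qed.

End compound_poisson.

Section levy_measure.
Context {R : realType}.
Local Notation leb := (@lebesgue_measure R).
Local Notation RR := (measurableTypeR R).
Variable al : R.
Hypotheses (al_gt0 : 0 < al) (al_lt1 : al < 1).

(** Monotone convergence of the Laplace transform along [t = e^(- n)], whose limit is
    [levy_exp_cvg]. *)
Lemma integral_levy_psi :
  (\int[leb]_(x in `]0%R, +oo[) (levy_psi al x)%:E = (- (ln al / 2))%:E)%E.
Proof.
pose g n x := (expR (- (expR (- n%:R) * x)) * levy_psi al x)%:E.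
have mg n : measurable_fun (`]0%R, +oo[ : set RR) (g n).
  apply/measurable_EFinP; apply: measurable_funTS; apply: measurable_funM.
    exact: measurable_expNM.
  exact: measurable_levy_psi.
have g0 n (x : R) : `]0%R, +oo[%classic x -> (0 <= g n x)%E.
  by move=> /=; rewrite in_itv/= andbT => x0; rewrite lee_fin mulr_ge0 ?expR_ge0 ?levy_psi_ge0.
have ndg (x : R) : `]0%R, +oo[%classic x ->
    {homo g^~ x : n m / (n <= m)%N >-> (n <= m)%E}.
  move=> /=; rewrite in_itv/= andbT => x0 n m nm.
  rewrite lee_fin ler_wpM2r ?levy_psi_ge0// ler_expR lerN2 ler_wpM2r//; first exact: ltW.
  by rewrite ler_expR lerN2 ler_nat.
have := @cvg_monotone_convergence _ _ R leb `]0%R, +oo[%classic (measurable_itv _) g mg g0 ndg.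
have -> : (\int[leb]_(x in `]0%R, +oo[) limn (g^~ x) =
           \int[leb]_(x in `]0%R, +oo[) (levy_psi al x)%:E)%E.
  apply: eq_integral => x; rewrite inE/= in_itv/= andbT => x0.
  apply: cvg_lim => //; apply: cvg_EFin; first by near=> n.
  rewrite -[X in _ --> X]mul1r; apply: cvgMl.
  have e0 : expR (- (0 * x)) = 1 by rewrite mul0r oppr0 expR0.
  rewrite -[X in _ --> X]e0.
  apply: continuous_cvg; first exact: continuous_expR.
  by apply: cvgN; apply: cvgMl; exact: cvgn_expR.
move=> h; apply: (cvg_unique (@ereal_hausdorff R) h).
rewrite (_ : (fun n => _) = (fun n => (levy_exp al (expR (- n%:R)))%:E)); last first.
  by apply/funext => n; rewrite levy_expE ?expR_gt0.
apply: cvg_EFin; first by near=> n.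
exact: levy_exp_cvg.
Unshelve. all: by end_near. Qed.

Let density (x : R) : R := \1_(`]0, +oo[ : set R) x * levy_psi al x.

Let measurable_density : measurable_fun (setT : set RR) density.
Proof. by apply: measurable_funM => //; exact: measurable_levy_psi. Qed.

Let density_ge0 (x : RR) : 0 <= density x.
Proof.
rewrite /density indicE; case: (boolP (x \in _)); rewrite ?mul0r// mul1r inE/=.
by rewrite in_itv/= andbT => x0; rewrite levy_psi_ge0.
Qed.

Let levy0 : {measure set RR -> \bar R} := density_measure leb measurable_density density_ge0.

Let levy0_integral (g : R -> R) : measurable_fun (setT : set RR) g ->
  (forall x, 0 <= g x) ->
  (\int[levy0]_x (g x)%:E = \int[leb]_(x in `]0%R, +oo[) (g x * levy_psi al x)%:E)%E.
Proof.
move=> mg g0; rewrite ge0_integral_density//; last exact/measurable_EFinP.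
rewrite -(integral_indicM leb `]0%R, +oo[ (fun x => g x * levy_psi al x)).
by apply: eq_integral => x _; rewrite -EFinM /density mulrCA.
Qed.

Let levy0T : levy0 setT = (- (ln al / 2))%:E.
Proof.
have := levy0_integral (measurable_cst (1 : R)) (fun=> ler01).
rewrite (@integral_cst _ _ _ levy0 setT measurableT 1%E) mul1e => ->; rewrite -integral_levy_psi.
by apply: eq_integral => x _; rewrite mul1r.
Qed.

Let levy0_fin : fin_num_fun levy0.
Proof.
move=> A mA; rewrite ge0_fin_numE//.
apply: (@le_lt_trans _ _ (levy0 setT)).
  by apply: le_measure; rewrite ?inE.
by rewrite levy0T ltry.
Qed.

Definition levy : {finite_measure set RR -> \bar R} := finite_measure_of levy0_fin.

Lemma levyT : levy setT = (- (ln al / 2))%:E.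
Proof. exact: levy0T. Qed.

Lemma levy_laplace (t : R) : 0 < t ->
  (\int[levy]_x (expR (- (t * `|x|)))%:E = (levy_exp al t)%:E)%E.
Proof.
move=> t0; rewrite -levy_expE//.
transitivity (\int[levy0]_x (expR (- (t * `|x|)))%:E)%E; first by [].
rewrite levy0_integral; first last.
- by move=> x; exact: expR_ge0.
- exact: (measurableT_comp (measurable_expNM t) (@normr_measurable R setT)).
by apply: eq_integral => x; rewrite inE/= in_itv/= andbT => x0; rewrite gtr0_norm.
Qed.

End levy_measure.

Section stable_domination.
Context {R : realType}.
Local Notation RR := (measurableTypeR R).
Variable al : R.
Hypotheses (al_gt0 : 0 < al) (al_lt1 : al < 1).
Context d (T : measurableType d) (P : probability T R).
Variable f : T -> R.
Hypotheses (mf : measurable_fun setT f) (f_gt0 : forall w, 0 < f w).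
Hypothesis f_laplace : forall l, 0 <= l ->
  (\int[P]_w (expR (- (l * f w)))%:E = (expR (- (l `^ al)))%:E)%E.

(* At [z = Z_al] this is the variable [S_al]. *)
Definition stable_pow (z : R) : R := (1 - al) * (z / al) `^ (- (al / (1 - al))).

Let S (w : T) : RR := stable_pow (f w).

Let al1 : 0 < 1 - al. Proof. by rewrite subr_gt0. Qed.

Let mS : measurable_fun setT S.
Proof.
apply: measurable_funM => //; apply: measurable_powR2.
by apply: measurable_funM.
Qed.

Let S_gt0 w : 0 < S w.
Proof. by rewrite mulr_gt0// powR_gt0// divr_gt0. Qed.

(** With [t = n / (1 - al)], [S^n] is a multiple of [f^(- al t)], whose expectation is
    [Gamma1p t / Gamma1p (al t)]. The constants [1 - al] and [al] in [stable_pow] are those that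
    cancel the terms linear in [t] of [gamma_ratio]. *)
Lemma stable_pow_moment (n : nat) : (0 < n)%N ->
  (\int[P]_w (S w ^+ n)%:E =
   (expR (n%:R * ln n%:R - n%:R - ln al / 2 - levy_exp al ((1 - al)^-1 * n%:R)))%:E)%E.
Proof.
move=> n0; have n0' : 0 < n%:R :> R by rewrite ltr0n.
set t := (1 - al)^-1 * n%:R.
have t0 : 0 < t by rewrite mulr_gt0// invr_gt0.
have at0 : 0 < al * t by rewrite mulr_gt0.
have nt : n%:R = (1 - al) * t by rewrite /t mulrA mulfV ?mul1r// gt_eqF.
have SE w : S w ^+ n = expR (n%:R * ln (1 - al) + al * t * ln al) * f w `^ (- (al * t)).
  rewrite -[S w]lnK ?posrE// -expRM_natl [f w `^ _]/powR gt_eqF// -expRD; congr expR.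
  rewrite /S /stable_pow lnM ?posrE ?powR_gt0 ?divr_gt0// ln_powR.
  rewrite lnM ?posrE ?invr_gt0// lnV ?posrE// nt.
  move: (ln _) (ln _) (ln _) => a b c; field.
  by rewrite gt_eqF.
under eq_integral do rewrite SE EFinM.
rewrite ge0_integralZl//; first last.
- by move=> w _; rewrite lee_fin powR_ge0.
- by apply/measurable_EFinP; exact: measurable_powR2.
have := neg_moment_of_laplace al_gt0 at0 mf f_gt0 f_laplace.
rewrite [al * t / al]mulrAC mulfV ?gt_eqF// mul1r !gammaE_Gamma1p// => E.
have -> : (\int[P]_w (f w `^ (- (al * t)))%:E = (Gamma1p t / Gamma1p (al * t))%:E)%E.
  have g0 := @Gamma1p_gt0 R _ at0.
  rewrite EFinM E muleAC -EFinM divff ?gt_eqF// mul1e//.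
have -> : Gamma1p t / Gamma1p (al * t) = expR (ln (Gamma1p t) - ln (Gamma1p (al * t))).
  by rewrite expRD expRN (lnK (Gamma1p_gt0 t0)) (lnK (Gamma1p_gt0 at0)).
rewrite gamma_ratio// -EFinM -expRD; congr (expR _)%:E.
have -> : ln t = ln n%:R - ln (1 - al).
  by rewrite /t lnM ?posrE ?invr_gt0// lnV ?posrE// addrC.
rewrite /levy_exp nt.
move: (binet_mu _) (binet_mu _) (ln al) (ln (1 - al)) (ln (_ * _)) => a b c e g; by field.
Qed.

Variable (d' : measure_display) (T' : measurableType d') (P' : probability T' R).
Variables (X : {RV P' >-> R}) (X_law : log_S_law X).

Lemma stable_pow_dominates (x : R) :
  (P' [set w | x < expR (X w)]%R <= P [set w | x < stable_pow (f w)]%R)%E.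
Proof.
pose c : R := (1 - al)^-1.
pose M : R := - (ln al / 2).
(* At 0 the Laplace transform is the total mass [M]; [levy_exp] represents it at positive
   arguments. *)
pose L (n : nat) : R := if n is 0%N then M else levy_exp al (c * n%:R).
pose m_ (n : nat) : R := expR (n%:R * ln n%:R - n%:R + M - L n).
pose law : {measure set RR -> \bar R} :=
  measure_function_pushforward__canonical__measure_function_Measure P mS.
have law_fin : fin_num_fun law.
  move=> A mA; rewrite -[law A]/(P (S @^-1` A)); apply: fin_num_measure.
  by rewrite -[X in measurable X]setTI; exact: mS.
pose mu0 := finite_measure_of law_fin.
have mn n : measurable_fun (setT : set RR) (fun a : RR => `|a| ^+ n : R).
  by apply: measurable_funX; exact: normr_measurable.
have mom0 n : (\int[mu0]_a (`|a| ^+ n)%:E = (m_ n)%:E)%E.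
  transitivity (\int[law]_a (`|a| ^+ n)%:E)%E; first by [].
  rewrite ge0_integral_pushforward//; last exact/measurable_EFinP.
  rewrite preimage_setT; case: n => [|n].
    under eq_integral do rewrite /= expr0.
    rewrite integral_cst// mul1e [LHS]probability_setT /m_ /L.
    by rewrite mul0r subr0 add0r subrr expR0.
  rewrite /m_ /L /M -stable_pow_moment//; apply: eq_integral => w _ /=.
  by rewrite gtr0_norm.
have c0 : 0 < c by rewrite invr_gt0.
have laplace_eta n : (\int[levy al_gt0 al_lt1]_x (expR (- (c * n%:R * `|x|)))%:E = (L n)%:E)%E.
  case: n => [|n].
    under eq_integral do rewrite mulr0 mul0r oppr0 expR0.
    by rewrite integral_cst// mul1e [LHS]levyT.
  by rewrite levy_laplace// mulr_gt0.
pose cp := finite_measure_of (compound_poisson_fin M mom0 laplace_eta).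
have cpm n : (\int[cp]_a (`|a| ^+ n)%:E = (expR (n%:R * ln n%:R - n%:R))%:E)%E.
  transitivity (\int[compound_poisson (levy al_gt0 al_lt1) mu0 c M]_a (`|a| ^+ n)%:E)%E; first by [].
  rewrite (compound_poisson_moment M mom0 laplace_eta) -expRD; congr (expR _)%:E.
  by ring.
have mX : measurable_fun setT X by [].
have Xm n : (\int[P']_w (expR (X w) ^+ n)%:E = (expR (n%:R * ln n%:R - n%:R))%:E)%E.
  case: n => [|n].
    under eq_integral do rewrite expr0.
    by rewrite integral_cst// mul1e [LHS]probability_setT mul0r subr0 expR0.
  under eq_integral do rewrite -expRM_natl.
  apply: (exp_moment_log_S mX) => // l l0; first exact: (log_S_fourier X_law l0).1.
  exact: (log_S_fourier X_law l0).2.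
have bnd n : expR (n%:R * ln n%:R - n%:R) <= n`!%:R :> R.
  case: n => [|n]; first by rewrite mul0r subr0 expR0.
  rewrite expRD expRN ler_pdivrMr ?expR_gt0// expRM_natl lnK ?posrE//.
  exact: exprn_le_expR.
have meX : measurable_fun setT (fun w => expR (X w)) by apply: measurableT_comp.
rewrite (@moments_determine_tail R _ T' _ RR P' cp (fun w => expR (X w)) (fun a : RR => `|a|)
  (fun n => expR (n%:R * ln n%:R - n%:R)) meX (@normr_measurable R setT) (fun w => expR_ge0 _) (fun a => normr_ge0 _) Xm cpm bnd x).
apply: le_trans (compound_poisson_tail mu0 (ltW c0) (levyT al_gt0 al_lt1) x) _.
rewrite -[leLHS]/(P (S @^-1` [set a | x < `|a|])) (_ : S @^-1` _ = [set w | x < stable_pow (f w)])//.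
by apply/seteqP; split => w /=; rewrite gtr0_norm.
Qed.

End stable_domination.

(** * The bounds on the median *)

Section stable_pow_inverse.
Context {R : realType}.
Variable al : R.
Hypotheses (al_gt0 : 0 < al) (al_lt1 : al < 1).

Let al1 : 0 < 1 - al. Proof. by rewrite subr_gt0. Qed.

(** The inverse of the decreasing map [stable_pow al]; its values at [ln 2] and at [m_S] are two of
    the bounds of the theorem. *)
Definition stable_inv (y : R) : R := al * ((1 - al) / y) `^ ((1 - al) / al).

Lemma stable_inv_gt0 (y : R) : 0 < y -> 0 < stable_inv y.
Proof. by move=> y0; rewrite mulr_gt0// powR_gt0// divr_gt0. Qed.

Lemma stable_invK (y : R) : 0 < y -> stable_pow al (stable_inv y) = y.
Proof.
move=> y0; rewrite /stable_pow /stable_inv mulrAC mulfV ?gt_eqF// mul1r -powRrM.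
rewrite (_ : (1 - al) / al * - (al / (1 - al)) = -1); last first.
  by field; rewrite !gt_eqF.
by rewrite powRN powRr1 ?divr_ge0 ?ltW// invf_div mulrCA mulfV ?mulr1// gt_eqF.
Qed.

Lemma stable_pow_lt (x z : R) : 0 < x -> x < z -> stable_pow al z < stable_pow al x.
Proof.
move=> x0 xz; have z0 := lt_trans x0 xz.
rewrite /stable_pow ltr_pM2l// !powRN ltf_pV2 ?posrE ?powR_gt0 ?divr_gt0//.
have e0 : 0 < al / (1 - al) by rewrite divr_gt0.
by rewrite gt0_ltr_powR// ?nnegrE ?divr_ge0 ?ltW// ltr_pM2r ?invr_gt0.
Qed.

Lemma stable_pow_le (x z : R) : 0 < x -> x <= z -> stable_pow al z <= stable_pow al x.
Proof. by move=> x0; rewrite le_eqVlt => /predU1P[->//|/(stable_pow_lt x0)/ltW]. Qed.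

Section chernoff.
Context d (T : measurableType d) (P : probability T R).
Variable f : T -> R.
Hypotheses (mf : measurable_fun setT f).
Hypothesis f_laplace : forall l, 0 <= l ->
  (\int[P]_w (expR (- (l * f w)))%:E = (expR (- (l `^ al)))%:E)%E.

(** [stable_pow al x] is also the maximum over [l] of [l^al - l x], so the optimal exponential
    Markov inequality involves the same map as [S_al]. *)
Lemma stable_chernoff (x : R) : 0 < x ->
  (P [set w | f w <= x]%R <= (expR (- stable_pow al x))%:E)%E.
Proof.
move=> x0; pose u := x / al; have u0 : 0 < u by rewrite divr_gt0.
(* The optimal [l], solving [al l^(al - 1) = x]. *)
pose l := u `^ (- (1 - al)^-1); have l0 : 0 < l by rewrite powR_gt0.
have mA := measurable_set_le mf x.
have lx : l * x = al * u `^ (- (al / (1 - al))).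
  rewrite (_ : x = u * al); last by rewrite mulfVK// gt_eqF.
  rewrite mulrA mulrC; congr (_ * _); rewrite -[X in _ * X]powRr1 ?ltW//.
  rewrite -powRD; last by apply/implyP => _; rewrite gt_eqF.
  by congr (_ `^ _); field; rewrite gt_eqF.
have lal : l `^ al = u `^ (- (al / (1 - al))).
  by rewrite -powRrM mulNr mulrC.
rewrite (_ : - _ = l * x - l `^ al); last first.
  by rewrite lx lal /stable_pow -/u; ring.
have l0' := ltW l0; rewrite expRD EFinM -(f_laplace l0').
rewrite -ge0_integralZl//; last first.
  apply/measurable_EFinP; apply: measurableT_comp => //.
  by apply: measurableT_comp => //; exact: measurable_funM.
rewrite -[X in P X]setIT -integral_indic//; apply: ge0_le_integral => //.
- by apply/measurable_EFinP.
- apply/measurable_EFinP; apply: measurable_funM => //; apply: measurableT_comp => //.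
  by apply: measurableT_comp => //; exact: measurable_funM.
- move=> w _; rewrite lee_fin -expRD indicE; case: (boolP (_ \in _)) => h /=.
    by move: h; rewrite inE/= => h; rewrite -expR0 ler_expR subr_ge0 ler_pM2l.
  exact: expR_ge0.
Qed.

End chernoff.
End stable_pow_inverse.

(** * Strict stability and the tail of [Z] *)

Section stable_tail.
Context {R : realType}.
Local Notation leb := (@lebesgue_measure R).
Variable al : R.
Hypotheses (al_gt0 : 0 < al) (al_lt1 : al < 1).
Context d (T : measurableType d) (P : probability T R).
Variable f : T -> R.
Hypotheses (mf : measurable_fun setT f) (f_gt0 : forall w, 0 < f w).
Hypothesis f_laplace : forall l, 0 <= l ->
  (\int[P]_w (expR (- (l * f w)))%:E = (expR (- (l `^ al)))%:E)%E.

Let m_le := measurable_set_le mf.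

Definition cdf_of (x : R) : R := fine (P [set w | f w <= x]).

Lemma cdf_ofE (x : R) : P [set w | f w <= x] = (cdf_of x)%:E.
Proof. by rewrite fineK// fin_num_measure. Qed.

Lemma cdf_of_ge0 (x : R) : 0 <= cdf_of x.
Proof. by rewrite fine_ge0. Qed.

Lemma cdf_of_ndecr (x y : R) : x <= y -> cdf_of x <= cdf_of y.
Proof.
move=> xy; rewrite -lee_fin -!cdf_ofE; apply: le_measure; rewrite ?inE//.
by move=> w /= /le_trans; apply.
Qed.

(* [a Z' + b Z''] has the law of [Z] for independent copies [Z'], [Z''] of [Z]. *)
Lemma stable_cdf_split (a b x : R) : 0 < a -> 0 < b -> a `^ al + b `^ al = 1 ->
  cdf_of x <= cdf_of (x / a) * cdf_of (x / b).
Proof.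
move=> a0 b0 ab; pose g (z : T * T) := a * f z.1 + b * f z.2.
have mg : measurable_fun setT g.
  apply: measurable_funD; apply: measurable_funM => //.
    exact: (measurableT_comp mf).
  exact: (measurableT_comp mf).
have PPT : (P \x P)%E setT = 1%E.
  by rewrite -setXTT product_measure1E// [X in (X * _)%E]probability_setT mul1e [LHS]probability_setT.
have PPfin : fin_num_fun (P \x P)%E.
  move=> A mA; rewrite ge0_fin_numE//; apply: (@le_lt_trans _ _ ((P \x P)%E setT)).
    by apply: le_measure; rewrite ?inE.
  by rewrite PPT ltry.
pose PP := finite_measure_of PPfin.
have eqL n : (\int[PP]_z (expR (- (n%:R * g z)))%:E = \int[P]_w (expR (- (n%:R * f w)))%:E)%E.
  have n0 : 0 <= n%:R :> R by [].
  rewrite f_laplace//.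
  transitivity (\int[(P \x P)%E]_z (expR (- (n%:R * g z)))%:E)%E; first by [].
  have mh : measurable_fun setT (fun z => (expR (- (n%:R * g z)))%:E).
    apply/measurable_EFinP; apply: measurableT_comp => //.
    by apply: measurableT_comp => //; exact: measurable_funM.
  rewrite fubini_tonelli1//.
  have mk (c : R) : measurable_fun setT (fun w => (expR (- (c * f w)))%:E).
    apply/measurable_EFinP; apply: measurableT_comp => //.
    by apply: measurableT_comp => //; exact: measurable_funM.
  have na0 : 0 <= n%:R * a by rewrite mulr_ge0// ltW.
  have nb0 : 0 <= n%:R * b by rewrite mulr_ge0// ltW.
  transitivity (\int[P]_w ((expR (- (n%:R * a * f w)))%:E * (expR (- ((n%:R * b) `^ al)))%:E))%E.
    apply: eq_integral => w _; rewrite /fubini_F -f_laplace// -ge0_integralZl//.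
      by apply: eq_integral => w' _; rewrite -EFinM -expRD /g/=; congr (expR _)%:E; ring.
  rewrite ge0_integralZr//.
    rewrite f_laplace// -EFinM -expRD -opprD; congr (expR (- _))%:E.
    have a0' := ltW a0; have b0' := ltW b0.
    by rewrite !powRM// -mulrDr ab mulr1.
have g0 z : 0 <= g z by rewrite addr_ge0// mulr_ge0// ltW.
have f0 w : 0 <= f w := ltW (f_gt0 w).
have sf : ~` [set w | f w <= x] = [set w | x < f w].
  by apply/seteqP; split => w /=; rewrite ltNge => /negP.
have sg : ~` [set z | g z <= x] = [set z | x < g z].
  by apply/seteqP; split => w /=; rewrite ltNge => /negP.
have tails : ((P \x P)%E (~` [set z | g z <= x]) = P (~` [set w | f w <= x])).
  by rewrite sf sg; exact: (laplace_determines_tail mg mf g0 f0 eqL x).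
have mgx := measurable_set_le mg x.
have := tails; rewrite probability_setC// -setTD measureD//; last by rewrite [ltLHS]PPT ltry.
rewrite setTI [X in (X - _)%E = _]PPT => h.
have E : ((P \x P)%E [set z | g z <= x] = (cdf_of x)%:E).
  have hp : ((P \x P)%E [set z | g z <= x]) \is a fin_num := PPfin _ mgx.
  have {}h : (1 - (P \x P) [set z | g z <= x]%R = 1 - (cdf_of x)%:E)%E.
    by rewrite -cdf_ofE -h.
  move: hp h; case: ((P \x P)%E _) => // p _; rewrite -!EFinB => -[h].
  by congr EFin; lra.
(* Both summands being nonnegative, [a Z' + b Z'' <= x] forces [Z' <= x / a] and [Z'' <= x / b],
   which are independent. *)
rewrite -lee_fin EFinM -E -!cdf_ofE -product_measure1E//.
apply: le_measure; rewrite ?inE//; first exact: measurableX.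
move=> [w w']; rewrite /g/= => zx; split; rewrite /= ler_pdivlMr// mulrC; apply: le_trans zx.
  by rewrite lerDl mulr_ge0// ltW.
by rewrite lerDr mulr_ge0// ltW.
Qed.

End stable_tail.

Lemma powR_invl {R : realType} (y r : R) : 0 < y -> y^-1 `^ r = (y `^ r)^-1.
Proof. by move=> /ltW y0; rewrite -powR_inv1// -powRrM mulN1r powRN. Qed.

Section stable_tail_bound.
Context {R : realType}.
Local Notation leb := (@lebesgue_measure R).
Variable al : R.
Hypotheses (al_gt0 : 0 < al) (al_lt1 : al < 1).
Context d (T : measurableType d) (P : probability T R).
Variable f : T -> R.
Hypotheses (mf : measurable_fun setT f) (f_gt0 : forall w, 0 < f w).
Hypothesis f_laplace : forall l, 0 <= l ->
  (\int[P]_w (expR (- (l * f w)))%:E = (expR (- (l `^ al)))%:E)%E.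

Local Notation F := (cdf_of P f).

(** One copy is split off at a time, with weights such that [a^al = 1 / (n + 2)] and
    [b^al = (n + 1) / (n + 2)]; rescaling by [b] turns the factor for [n + 1] copies into the one
    for [n + 2]. *)
Lemma stable_cdf_pow (n : nat) (x : R) : F x <= F (n.+1%:R `^ al^-1 * x) ^+ n.+1.
Proof.
elim: n x => [|n IH] x; first by rewrite powR1 mul1r expr1.
have n1 : 0 < n.+1%:R :> R by []. 
have n2 : 0 < n.+2%:R :> R by [].
pose a : R := (n.+2%:R `^ al^-1)^-1.
pose b : R := n.+1%:R `^ al^-1 / n.+2%:R `^ al^-1.
have a0 : 0 < a by rewrite invr_gt0 powR_gt0.
have b0 : 0 < b by rewrite divr_gt0 ?powR_gt0.
have pK (y : R) : 0 <= y -> (y `^ al^-1) `^ al = y.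
  by move=> y0; rewrite -powRrM mulVf ?gt_eqF// powRr1.
have aE : a `^ al = n.+2%:R^-1.
  by rewrite /a powR_invl ?powR_gt0// pK.
have bE : b `^ al = n.+1%:R / n.+2%:R.
  by rewrite /b powRM ?powR_ge0 ?invr_ge0// pK// -aE.
have ab : a `^ al + b `^ al = 1.
  rewrite aE bE -[n.+2%:R]natr1; move: (n.+1%:R) n1 => u u0; field.
  by rewrite gt_eqF// addr_gt0.
apply: le_trans (stable_cdf_split mf f_gt0 f_laplace x a0 b0 ab) _.
rewrite exprS; apply: ler_pM; rewrite ?cdf_of_ge0//.
  by apply: cdf_of_ndecr => //; rewrite /a invrK mulrC.
apply: le_trans (IH _) _; rewrite (_ : _ * (x / b) = n.+2%:R `^ al^-1 * x)//.
rewrite /b; field.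
by rewrite !gt_eqF ?powR_gt0.
Qed.

Variable m : R.
Hypothesis m0 : 0 < m.
Hypothesis half_cdf : 2^-1 <= F m.

(** If [p] is the tail probability, then [1 / 2 <= (1 - p)^(n + 1) <= e^(- (n + 1) p)]; this is
    where [ln 2] comes from. *)
Lemma stable_tail_nat (n : nat) : 1 - F (n.+1%:R `^ al^-1 * m) <= ln 2 / n.+1%:R.
Proof.
have n1 : 0 < n.+1%:R :> R by [].
have h := le_trans half_cdf (stable_cdf_pow n m).
set p := 1 - F _; have Fp : F (n.+1%:R `^ al^-1 * m) = 1 - p by rewrite /p; ring.
rewrite Fp in h.
have p1 : 0 <= 1 - p by rewrite -Fp cdf_of_ge0.
have h2 : (1 - p) ^+ n.+1 <= expR (n.+1%:R * - p).
  by rewrite expRM_natl lerXn2r ?nnegrE ?expR_ge0// expR_ge1Dx.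
have h3 := le_trans h h2.
rewrite ler_pdivlMr// mulrC -lerN2 -mulrN -(ler_expR (- ln 2)) expRN lnK// posrE//.
Qed.

(* At scale [y = (x/m)^al] take the largest integer [n < y], so that [y <= n + 1]. *)
Lemma stable_tail_bound (e x : R) : 0 < e -> e < 1 -> 0 < x -> e^-1 <= (x / m) `^ al ->
  1 - ln 2 / (1 - e) * m `^ al * x `^ (- al) <= fine (P [set w | f w < x]).
Proof.
move=> e0 e1 x0; set y := (x / m) `^ al => ey.
have ie1 : 1 < e^-1 by rewrite invf_gt1.
have y1 : 1 < y := lt_le_trans ie1 ey.
have exn : exists n : nat, y <= n%:R.
  by exists (Num.trunc y).+1; rewrite ltW// truncnS_gt.
have [k yk kmin] := ex_minnP exn.
case: k yk kmin => [|[|n]] yk kmin.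
- by have := lt_le_trans y1 yk; rewrite ltr10.
- by have := lt_le_trans y1 yk; rewrite ltxx.
have ny : n.+1%:R < y.
  by rewrite ltNge; apply/negP => /kmin; rewrite ltnn.
have y0 : 0 < y := lt_trans ltr01 y1.
have xE : x = y `^ al^-1 * m.
  by rewrite /y -powRrM mulfV ?gt_eqF// powRr1 ?divr_ge0 ?ltW// mulfVK// gt_eqF.
have nx : n.+1%:R `^ al^-1 * m < x.
  rewrite xE ltr_pM2r// gt0_ltr_powR ?invr_gt0 ?nnegrE//; exact: ltW.
have mlt := measurable_set_lt mf x.
have mle := measurable_set_le mf (n.+1%:R `^ al^-1 * m).
have FP : F (n.+1%:R `^ al^-1 * m) <= fine (P [set w | f w < x]).
  rewrite /cdf_of fine_le ?fin_num_measure//; apply: le_measure; rewrite ?inE//.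
  by move=> w /= /le_lt_trans; apply.
apply: le_trans FP; have := stable_tail_nat n; rewrite lerBlDl -lerBlDr => tn; apply: le_trans tn.
rewrite lerB// -[leRHS]mulrA.
have -> : m `^ al * x `^ (- al) = y^-1.
  have x0' := ltW x0; have m0' := ltW m0.
  by rewrite /y powRM ?invr_ge0// powRN invfM powR_invl// invrK mulrC.
have ln2 : 0 <= ln 2 :> R by rewrite ln_ge0// ler1n.
have e1' : 0 < 1 - e by rewrite subr_gt0.
rewrite -[leRHS]mulrA -invfM ler_wpM2l// lef_pV2 ?posrE ?mulr_gt0//.
(* [1 <= e y] turns [y - 1 <= n.+1] into [(1 - e) y <= n.+1], the origin of the factor [1 - e]. *)
have ey1 : 1 <= e * y by rewrite -(mulfV (lt0r_neq0 e0)) ler_pM2l.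
by move: yk; rewrite -natr1 mulrBl mul1r; lra.
Qed.

End stable_tail_bound.

Section stable_gamma_bound.
Context {R : realType}.
Local Notation leb := (@lebesgue_measure R).
Variable al : R.
Hypotheses (al_gt0 : 0 < al) (al_lt1 : al < 1).
Context d (T : measurableType d) (P : probability T R).
Variable f : T -> R.
Hypotheses (mf : measurable_fun setT f) (f_gt0 : forall w, 0 < f w).
Hypothesis f_laplace : forall l, 0 <= l ->
  (\int[P]_w (expR (- (l * f w)))%:E = (expR (- (l `^ al)))%:E)%E.

Let mlt := measurable_set_lt mf.

(** [expR (- (l * f))] is the integral of [expR (- t)] over [t > l f]; Tonelli then gives the
    distribution function of [f] at [t / l]. *)
Lemma laplace_layer (l : R) : 0 < l ->
  ((expR (- (l `^ al)))%:E =
   \int[leb]_(t in `]0%R, +oo[) (fine (P [set w | f w < t / l]%R) * expR (- t))%:E)%E.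
Proof.
move=> l0; have l0' := ltW l0; rewrite -f_laplace//.
transitivity (\int[P]_w \int[leb]_(t in `]0%R, +oo[) ((l * f w < t)%R%:R * expR (- t))%:E)%E.
  by apply: eq_integral => w _; rewrite integral_expRN_gt// mulr_ge0// ltW.
rewrite (@tonelli_in R _ _ T (measurableTypeR R) P leb setT `]0%R, +oo[
  (fun z : T * measurableTypeR R => (l * f z.1 < z.2)%R%:R * expR (- z.2)))//=; first last.
  apply: measurable_ltM => //.
    apply: measurable_funM => //; exact: (measurableT_comp mf).
  by apply: measurableT_comp => //; exact: measurableT_comp.
apply: eq_integral => t _.
transitivity (\int[P]_w ((\1_[set w | f w < t / l]%R w)%:E * (expR (- t))%:E))%E.
  apply: eq_integral => w _; rewrite -EFinM indicE; congr ((nat_of_bool _)%:R * _)%:E.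
  by rewrite mulrC -ltr_pdivlMr//; apply/idP/idP; rewrite inE.
rewrite ge0_integralZr//; last exact/measurable_EFinP.
by rewrite integral_indic// setIT EFinM fineK// fin_num_measure.
Qed.

Variable m : R.
Hypothesis m0 : 0 < m.
Hypothesis half_cdf : 2^-1 <= cdf_of P f m.

(** A pointwise comparison under the integral [1 = int expR (- t) dt]. The threshold [x1] solves
    [(x1 / m)^al = 1 / e]: for [t >= l x1] the tail bound applies at [x = t / l], and the range
    [t < l x1] costs at most its length. *)
Lemma one_le_laplace (e l : R) : 0 < e -> e < 1 -> 0 < l ->
  gammaE (1 - al) \is a fin_num ->
  1 <= expR (- (l `^ al)) + l * (m * e `^ (- al^-1)) +
       ln 2 / (1 - e) * m `^ al * l `^ al * fine (gammaE (1 - al)).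
Proof.
move=> e0 e1 l0 gfin; set x1 := m * _; set K := ln 2 / _ * _.
have x10 : 0 < x1 by rewrite mulr_gt0// powR_gt0.
have K0 : 0 <= K by rewrite mulr_ge0 ?powR_ge0// divr_ge0 ?ln_ge0 ?ler1n// subr_ge0 ltW.
have mp : measurable_fun setT (fun t : R => fine (P [set w | f w < t / l])).
  apply: nondecreasing_measurable => // s t st; apply: fine_le; rewrite ?fin_num_measure//.
  apply: le_measure; rewrite ?inE// => w /= /lt_le_trans; apply.
  by rewrite ler_pM2r// invr_gt0.
have mE : measurable_fun setT (fun t : R => expR (- t)) by exact: measurableT_comp.
have D1 : (\int[leb]_(t in `]0%R, +oo[) (expR (- t))%:E = 1)%E.
  have := @integral_expRN_gt R 0 (lexx _); rewrite oppr0 expR0 => <-.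
  by apply: eq_integral => t; rewrite inE/= in_itv/= andbT => ->; rewrite mul1r.
have D2 := integral_ltM (ltW (mulr_gt0 l0 x10)) (@ler01 R).
have D3 : (\int[leb]_(t in `]0%R, +oo[) (K * l `^ al * (t `^ (- al) * expR (- t)))%:E =
    (K * l `^ al * fine (gammaE (1 - al)))%:E)%E.
  under eq_integral do rewrite EFinM.
  rewrite ge0_integralZl//.
  - rewrite [RHS]EFinM (fineK gfin); congr (_ * _)%E; apply: eq_integral => t _.
    by congr (_ `^ _ * _)%:E; ring.
  - by apply/measurable_EFinP; apply: measurable_funTS; apply: measurable_funM => //; exact: measurable_powR2.
  - by move=> t _; rewrite lee_fin mulr_ge0 ?powR_ge0 ?expR_ge0.
  - by rewrite lee_fin mulr_ge0 ?powR_ge0.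
rewrite -lee_fin !EFinD.
rewrite laplace_layer// -D3 -[l * x1]mulr1 -D2 -D1.
have p0 t : 0 <= fine (P [set w | f w < t / l]) by rewrite fine_ge0.
have m1 : measurable_fun (`]0, +oo[ : set R) (fun t => (fine (P [set w | f w < t / l]%R) * expR (- t))%:E).
  by apply/measurable_EFinP; apply: measurable_funTS; exact: measurable_funM.
have m2 : measurable_fun (`]0, +oo[ : set R) (fun t : R => ((t < l * x1)%R%:R * 1)%:E : \bar R).
  by apply/measurable_EFinP; apply: measurable_funTS; exact: measurable_ltM.
have m3 : measurable_fun (`]0, +oo[ : set R)
    (fun t : R => (K * l `^ al * (t `^ (- al) * expR (- t)))%:E).
  apply/measurable_EFinP; apply: measurable_funTS; apply: measurable_funM => //.
  by apply: measurable_funM => //; exact: measurable_powR2.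
have g1 (t : R) : (0 <= (fine (P [set w | f w < t / l]%R) * expR (- t))%:E)%E.
  by rewrite lee_fin mulr_ge0 ?expR_ge0.
have g2 (t : R) : (0 <= ((t < l * x1)%R%:R * 1)%:E :> \bar R)%E by rewrite lee_fin mulr_ge0.
have g3 (t : R) : (0 <= (K * l `^ al * (t `^ (- al) * expR (- t)))%:E)%E.
  by rewrite lee_fin; apply: mulr_ge0; apply: mulr_ge0; rewrite ?expR_ge0 ?powR_ge0.
rewrite -ge0_integralD// -ge0_integralD//; [|by move=> t _; rewrite adde_ge0|exact: emeasurable_funD].
apply: ge0_le_integral => //.
- by apply/measurable_EFinP; exact: measurable_funTS.
- by apply: emeasurable_funD => //; exact: emeasurable_funD.
move=> t /=; rewrite in_itv/= andbT => t0; rewrite -!EFinD lee_fin.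
have [tx|tx] := ltP t (l * x1).
  rewrite mul1r -addrA ler_wpDl ?mulr_ge0 ?expR_ge0// ler_wpDr//.
    by rewrite -lee_fin.
  by rewrite expR_le1 oppr_le0 ltW.
rewrite mul0r addr0.
have tl0 : 0 < t / l by rewrite divr_gt0.
have ey : e^-1 <= (t / l / m) `^ al.
  have -> : e^-1 = (x1 / m) `^ al.
    rewrite /x1 mulrAC mulfV ?gt_eqF// mul1r -powRrM mulNr mulVf ?gt_eqF//.
    by rewrite powR_inv1// ltW.
  have al0' := ltW al_gt0.
  apply: ge0_ler_powR; rewrite ?nnegrE ?divr_ge0 ?(ltW x10) ?(ltW m0) ?(ltW t0) ?(ltW l0)//.
  by rewrite ler_pM2r ?invr_gt0// ler_pdivlMr// mulrC.
have := stable_tail_bound al_gt0 mf f_gt0 f_laplace m0 half_cdf e0 e1 tl0 ey.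
have -> : (t / l) `^ (- al) = t `^ (- al) * l `^ al.
  by rewrite powRM ?invr_ge0 ?(ltW t0) ?(ltW l0)// powR_invl// [l `^ _]powRN invrK.
rewrite -/K => h; rewrite -[leLHS]mul1r.
have -> : K * l `^ al * (t `^ (- al) * expR (- t)) = K * (t `^ (- al) * l `^ al) * expR (- t) by ring.
by rewrite -mulrDl ler_wpM2r ?expR_ge0// -lerBlDr.
Qed.

(* Divide [one_le_laplace] by [u = l^al] and let [u] tend to [0]. *)
Lemma stable_gamma_bound : gammaE (1 - al) \is a fin_num ->
  1 <= ln 2 * m `^ al * fine (gammaE (1 - al)).
Proof.
move=> gfin; set g := fine _.
have bound_e (e : R) : 0 < e -> e < 1 -> 1 <= ln 2 / (1 - e) * m `^ al * g.
  move=> e0 e1; set K := _ * g; set x1 := m * e `^ (- al^-1).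
  have p0 : 0 < al^-1 - 1 by rewrite subr_gt0 invf_gt1.
  (* The inequality divided by [u], with [expR (- u)] weakened to [(1 + u)^-1]; then
     [(1 - (1 + u)^-1) / u] is [(1 + u)^-1], continuous at 0. *)
  pose h (u : R) := x1 * u `^ (al^-1 - 1) + K - (1 + u)^-1.
  have hcvg : h u @[u --> 0^'+] --> K - 1.
    have -> : K - 1 = x1 * 0 + K - (1 + 0)^-1 by rewrite mulr0 add0r addr0 invr1.
    apply: cvgB; first apply: cvgD; last 1 first.
    - apply: cvgV; first by rewrite addr0.
      apply: cvgD; first exact: cvg_cst.
      exact: cvg_at_right_filter.
    - by apply: cvgMr; exact: powR_cvg0.
    - exact: cvg_cst.
  rewrite -subr_ge0; apply: (cvgr_to_ge hcvg).
  near=> u.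
  have u0 : 0 < u by near: u; exact: nbhs_right_gt.
  have l0 : 0 < u `^ al^-1 by rewrite powR_gt0.
  have lal : (u `^ al^-1) `^ al = u.
    by rewrite -powRrM mulVf ?gt_eqF// powRr1// ltW.
  have := one_le_laplace e0 e1 l0 gfin; rewrite lal -/x1 -/g.
  have -> : u `^ al^-1 = u * u `^ (al^-1 - 1).
    rewrite -{2}[u]powRr1 ?ltW// -powRD; first by congr (_ `^ _); ring.
    by apply/implyP => _; rewrite gt_eqF.
  have -> : ln 2 / (1 - e) * m `^ al * u * g = u * K by rewrite /K; ring.
  have eu : expR (- u) <= (1 + u)^-1.
    rewrite expRN lef_pV2 ?posrE ?expR_gt0 ?addr_gt0// expR_ge1Dx//.
  have uE : 1 - (1 + u)^-1 = u * (1 + u)^-1 by field; rewrite gt_eqF// addr_gt0.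
  move=> hh; have : 0 <= u * h u.
    have -> : u * h u = u * u `^ (al^-1 - 1) * x1 + u * K - (1 - (1 + u)^-1).
      by rewrite uE /h; ring.
    move: hh eu; move: (u * u `^ _ * x1) (expR _) ((1 + u)^-1) (u * K) => z a b c.
    by lra.
  by rewrite pmulr_rge0.
rewrite leNgt; apply/negP => lt1; set A := ln 2 * _ * g in lt1.
have ln2 : 0 < ln 2 :> R by rewrite ln_gt0// ltr1n.
have g0 : 0 <= g by rewrite fine_ge0//; apply: integral_ge0 => t _; rewrite lee_fin mulr_ge0 ?powR_ge0 ?expR_ge0.
have A0 : 0 <= A := mulr_ge0 (mulr_ge0 (ltW ln2) (powR_ge0 _ _)) g0.
(* For [e = (1 - A) / 2] the bound reads [(1 + A) / 2 <= A], which contradicts [A < 1]. *)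
have e0 : 0 < (1 - A) / 2 by rewrite divr_gt0// subr_gt0.
have e1 : (1 - A) / 2 < 1 by lra.
have := bound_e _ e0 e1.
have -> : ln 2 / (1 - (1 - A) / 2) * m `^ al * g = A / (1 - (1 - A) / 2).
  by rewrite /A; ring.
rewrite ler_pdivlMr; last lra.
lra.
Unshelve. all: by end_near. Qed.

End stable_gamma_bound.

Lemma probability_ae_eq {R : realType} d (T : measurableType d) (P : probability T R)
    (f g : T -> R) (D : set R) : measurable_fun setT f -> measurable_fun setT g ->
  measurable D -> {ae P, forall w, f w = g w} -> P (f @^-1` D) = P (g @^-1` D).
Proof.
move=> mf mg mD fg.
have mp (h : T -> R) : measurable_fun setT h -> measurable (h @^-1` D).
  by move=> mh; rewrite -[X in measurable X]setTI; exact: mh.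
rewrite -[f @^-1` D]setIT -[g @^-1` D]setIT -!integral_indic//; last 2 first.
- exact: mp.
- exact: mp.
apply: ae_eq_integral => //.
- by apply/measurable_EFinP; apply: measurable_indic; exact: mp.
- by apply/measurable_EFinP; apply: measurable_indic; exact: mp.
by apply: filterS fg => w fgw _; rewrite !indicE; congr ((nat_of_bool _)%:R)%:E;
  apply/idP/idP; rewrite !inE/= fgw.
Qed.

Theorem mainTheorem7 (R : realType) (alpha : R)
    (alpha_gt0 : 0 < alpha) (alpha_lt1 : alpha < 1)
    (d : measure_display) (T : measurableType d) (P : probability T R)
    (Z : {RV P >-> R}) (Z_law : positive_stable alpha Z)
    (d' : measure_display) (T' : measurableType d') (P' : probability T' R)
    (X : {RV P' >-> R}) (X_law : log_S_law X)
    (m_alpha m_S : R)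
    (m_alphaP : is_median P Z m_alpha)
    (m_SP : is_median P' (fun w => expR (X w)) m_S) :
  Num.max (alpha * ((1 - alpha) / ln 2) `^ ((1 - alpha) / alpha))
          ((1 / (ln 2 * Gamma (1 - alpha))) `^ (1 / alpha)) <= m_alpha /\
  m_alpha <= alpha * ((1 - alpha) / m_S) `^ ((1 - alpha) / alpha).
Proof.
have [Z_gt0 Z_laplace] := Z_law.
have [[mZle mZge] m_uniq] := m_alphaP.
have [[mSle mSge] _] := m_SP.
(* [Z] is positive almost surely; [f] is a version of it that is positive everywhere. *)
pose f w := if 0 < Z w then Z w else 1.
have f_gt0 w : 0 < f w by rewrite /f; case: ifP.
have mf : measurable_fun setT f.
  apply: measurable_fun_ifT => //.
  exact: measurable_fun_ltr.
have fZ : {ae P, forall w, f w = Z w} by apply: filterS Z_gt0 => w; rewrite /f => ->.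
have f_laplace l : 0 <= l ->
    (\int[P]_w (expR (- (l * f w)))%:E = (expR (- (l `^ alpha)))%:E)%E.
  move=> l0; rewrite -Z_laplace// [@expectation]unlock.
  have mk (h : T -> R) : measurable_fun setT h ->
      measurable_fun setT (fun w => (expR (- (l * h w)))%:E).
    move=> mh; apply/measurable_EFinP; apply: measurableT_comp => //.
    by apply: measurableT_comp => //; exact: measurable_funM.
  apply: ae_eq_integral => //; first exact: mk.
    by apply: mk.
  by apply: filterS fZ => w ->.
have leE (x : R) : P [set w | Z w <= x] = P [set w | f w <= x].
  have E (h : T -> R) : [set w | h w <= x] = h @^-1` `]-oo, x].
    by apply/seteqP; split => w /=; rewrite in_itv.
  rewrite !E; apply: probability_ae_eq => //.
  by apply: filterS fZ => w ->.
have geE (x : R) : P [set w | x <= Z w] = P [set w | x <= f w].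
  have E (h : T -> R) : [set w | x <= h w] = h @^-1` `[x, +oo[.
    by apply/seteqP; split => w /=; rewrite in_itv/= andbT.
  rewrite !E; apply: probability_ae_eq => //.
  by apply: filterS fZ => w ->.
have half_gt0 : 0 < 2^-1 :> R by [].
have m_gt0 : 0 < m_alpha.
  rewrite ltNge; apply/negP => m0; move: mZle; rewrite leE.
  rewrite (_ : [set w | _] = set0) ?measure0; first by case=> /eqP; rewrite lt_eqF.
  by apply/seteqP; split => w //= /le_trans /(_ m0); rewrite leNgt f_gt0.
have mS_gt0 : 0 < m_S.
  rewrite ltNge; apply/negP => m0; move: mSle.
  rewrite (_ : [set w | _] = set0) ?measure0; first by case=> /eqP; rewrite lt_eqF.
  by apply/seteqP; split => w //= /le_trans /(_ m0); rewrite leNgt expR_gt0.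
have half_cdf : cdf_of P f m_alpha = 2^-1 by rewrite /cdf_of -leE mZle.
have ln2 : 0 < ln 2 :> R by rewrite ln_gt0// ltr1n.
rewrite -!/(stable_inv alpha _); split; last first.
  (* If the bound failed, any [v] strictly between it and [m_alpha] would be a second median of [Z],
     against uniqueness. *)
  rewrite leNgt; apply/negP => lt_m; set u := stable_inv alpha m_S in lt_m.
  have u0 : 0 < u by exact: stable_inv_gt0.
  pose v := (u + m_alpha) / 2.
  have uv : u < v by rewrite /v; lra.
  have vm : v < m_alpha by rewrite /v; lra.
  have v0 : 0 < v := lt_trans u0 uv.
  have mflt := measurable_set_lt mf v.
  have mfle := measurable_set_le mf.
  have mfge := measurable_set_ge mf.
  have meX : measurable_fun setT (fun w => expR (X w)) by exact: measurableT_comp.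
  (* Since [v] exceeds [stable_inv alpha m_S], its image [y] under the decreasing map lies strictly
     below [m_S], so that the event [m_S <= e^X] is contained in the strict tail event at [y], to
     which the domination applies. *)
  have half_lt : ((2^-1)%:E <= P [set w | f w < v]%R)%E.
    rewrite -mSge; set y := stable_pow alpha v.
    have yS : y < m_S by rewrite -(stable_invK alpha_gt0 alpha_lt1 mS_gt0) stable_pow_lt.
    apply: (@le_trans _ _ (P' [set w | y < expR (X w)]%R)).
      apply: le_measure; rewrite ?inE.
      - exact: measurable_set_ge.
      - exact: measurable_set_gt.
      by move=> w /=; exact: lt_le_trans.
    apply: le_trans (stable_pow_dominates alpha_gt0 alpha_lt1 mf f_gt0 f_laplace X_law y) _.
    rewrite (_ : [set w | y < _] = [set w | f w < v])//.
    apply/seteqP; split => w /=; last exact: stable_pow_lt.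
    by move=> yw; rewrite ltNge; apply/negP => /(stable_pow_le alpha_gt0 alpha_lt1 v0); rewrite leNgt yw.
  have := m_uniq v; suff vP : P [set w | Z w <= v] = (2^-1)%:E /\ P [set w | v <= Z w] = (2^-1)%:E.
    by move=> /(_ vP) mv; move: vm; rewrite mv ltxx.
  rewrite leE geE; split; apply/eqP; rewrite eq_le; apply/andP; split.
  - rewrite -mZle leE; apply: le_measure; rewrite ?inE//.
    by move=> w /= /le_trans; apply; exact: ltW.
  - apply: (le_trans half_lt); apply: le_measure; rewrite ?inE//.
    by move=> w /= /ltW.
  - have -> : [set w | v <= f w] = ~` [set w | f w < v].
      by apply/seteqP; split => w /=; rewrite leNgt => /negP.
    rewrite probability_setC//; move: half_lt.
    have /fineK <- := fin_num_measure P _ mflt.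
    by rewrite -EFinB !lee_fin; lra.
  - rewrite -mZge geE; apply: le_measure; rewrite ?inE//.
    by move=> w /=; apply: le_trans; exact: ltW.
rewrite ge_max; apply/andP; split.
  rewrite leNgt; apply/negP => m_lt.
  have := stable_pow_lt alpha_gt0 alpha_lt1 m_gt0 m_lt; rewrite stable_invK//.
  apply/negP; rewrite -leNgt.
  (* At the median the Chernoff bound reads [1 / 2 <= e^(- stable_pow alpha m_alpha)], that is
     [stable_pow alpha m_alpha <= ln 2]. *)
  have := stable_chernoff alpha_gt0 alpha_lt1 mf f_laplace m_gt0.
  rewrite -leE mZle lee_fin -[2^-1]lnK ?posrE// ler_expR lnV ?posrE//.
  by rewrite lerN2.
have GE : Gamma (1 - alpha) = fine (gammaE (1 - alpha)) by [].
(* [gammaE_fin] covers arguments above 1, while here the argument is below 1. In the infinite case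
   [fine] makes [Gamma] equal to 0, and with [0^-1 = 0] the bound becomes [0 <= m_alpha]. *)
have [gfin|ginf] := boolP (gammaE (1 - alpha) \is a fin_num); last first.
  have -> : Gamma (1 - alpha) = 0.
    by move: ginf; rewrite GE; case: gammaE.
  by rewrite mulr0 invr0 mulr0 powR0 ?ltW// div1r invr_neq0// gt_eqF.
have half_le : 2^-1 <= cdf_of P f m_alpha by rewrite half_cdf.
have := stable_gamma_bound alpha_gt0 alpha_lt1 mf f_gt0 f_laplace m_gt0 half_le gfin.
rewrite -GE; set g := Gamma _ => bound.
have g_gt0 : 0 < g.
  have g0 : 0 <= g by rewrite /g GE fine_ge0//; apply: integral_ge0 => t _; rewrite lee_fin mulr_ge0 ?powR_ge0 ?expR_ge0.
  rewrite lt_def g0 andbT; apply/eqP => gE.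
  by move: bound; rewrite gE mulr0 ler10.
have -> : m_alpha = (m_alpha `^ alpha) `^ (1 / alpha).
  by rewrite -powRrM div1r mulfV ?gt_eqF// powRr1// ltW.
apply: ge0_ler_powR.
- by rewrite divr_ge0// ltW.
- by rewrite nnegrE divr_ge0// mulr_ge0// ltW.
- by rewrite nnegrE powR_ge0.
by rewrite ler_pdivrMr ?mulr_gt0// mulrCA mulrA.
Qed.
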